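(* Let $d\in\{1,2\}$, let $X^s = H^{s+\frac12}(\mathbb{R}^d)\times H^s(\mathbb{R}^d)$, and assume $\tau>0$ and $g\in[0,\infty)$. For any $T>0$ the flow map associated to the water wave system $$\partial_t h = G(h)\psi,\qquad \partial_t\psi = -gh+\tau\,\operatorname{div}\left(\frac{\nabla h}{\sqrt{1+|\nabla h|^2}}\right)-\frac12|\nabla\psi|^2+\frac{\left(G(h)\psi+\nabla h\cdot\nabla\psi\right)^2}{2\left(1+|\nabla h|^2\right)}$$ on $\mathbb{R}^d$ is not of class $C^3$ - from $X^s$ to $C([0,T];X^s)$ for $s<3$ when $d=2$; - from $X^s$ to $C([0,T];X^s)$ for $s<\frac52$ when $d=1$.
   Context: The unknowns are $h=h(t,x)$ (the height of the free surface) and $\psi=\psi(t,x)$ (the trace of the velocity potential on the free surface), $x\in\mathbb{R}^d$, where $d$ is the dimension of the interface. The fluid domain at time $t$ is $\Omega_t=\{(x,z)\in\mathbb{R}^{d}\times\mathbb{R}: z\le h(t,x)\}$ (infinite depth). $G(h)$ is the rescaled Dirichlet-Neumann operator: $G(h)\psi=\sqrt{1+|\nabla h|^2}\,\partial_{\mathbf n_+}\phi|_{z=h(t,x)}$, where $\phi$ is the harmonic function in $\Omega_t$ with boundary value $\psi$ on $z=h(t,x)$ (with gradient vanishing as $z\to-\infty$), and $\mathbf n_+$ is the outward unit normal to the free surface. In particular $G(0)=|D|$, the Fourier multiplier with symbol $|\xi|$, where $D=-i\nabla$. Here $g$ is the gravity constant and $\tau$ the surface tension coefficient. The flow map sends initial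 data $(h_0,\psi_0)$ to the solution $(h,\psi)$ with $(h,\psi)|_{t=0}=(h_0,\psi_0)$. The zero data give the zero solution, and the regularity of the flow map is considered at the origin (zero data), in the following sense. For fixed $(h_0,\psi_0)$ consider the solution $(h,\psi)(\alpha,t)$ with initial data $\alpha(h_0,\psi_0)$, $\alpha\ge0$. If the flow map is $C^3$ from $X^s$ to $C([0,T];X^s)$ then there is a constant $C$, uniform in $(h_0,\psi_0)$, such that $$\sup_{0\le t\le T}\left\|\partial_\alpha^3\begin{pmatrix}h\\ \psi\end{pmatrix}(\alpha,t)\Big|_{\alpha=0}\right\|_{X^s}\le C\left\|\begin{pmatrix}h_0\\ \psi_0\end{pmatrix}\right\|_{X^s}^3 .$$ Failure to be of class $C^3$ means that for every $C$ there are initial data violating this inequality. The variations in $\alpha$ are those computed from the Duhamel formula: with $$\mathcal L=\begin{pmatrix}0&|D|\\ \tau\Delta-g&0\end{pmatrix},$$ $$\begin{pmatrix}h_1\\ \psi_1\end{pmatrix}=e^{t\mathcal L}\begin{pmatrix}h_0\\ \psi_0\end{pmatrix},\qquad \begin{pmatrix}h_2\\ \psi_2\end{pmatrix}=\int_0^te^{(t-t')\mathcal L}\begin{pmatrix}-2\left[\operatorname{div}(h_1\nabla\psi_1)+|D|(h_1|D|\psi_1)\right]\\ (|D|\psi_1)^2-|\nabla\psi_1|^2\end{pmatrix}(t')\,dt',$$ the third variation is $$\partial_\alpha^3\begin{pmatrix}h\\ \psi\end{pmatrix}\Big|_{\alpha=0}=\int_0^te^{(t-t')\mathcal L}\begin{pmatrix}M_1\\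 M_2\end{pmatrix}(t')\,dt',$$ where $$\begin{aligned}M_1=&-3\left[\operatorname{div}(h_1\nabla\psi_2)+|D|(h_1|D|\psi_2)\right]-3\left[\operatorname{div}(h_2\nabla\psi_1)+|D|(h_2|D|\psi_1)\right]\\&+3\left[\Delta(h_1^2|D|\psi_1)+|D|(h_1^2\Delta\psi_1)+2|D|\left(h_1|D|(h_1|D|\psi_1)\right)\right],\\ M_2=&-3\tau\operatorname{div}\left(\nabla h_1|\nabla h_1|^2\right)-6\,|D|\psi_1\left(h_1\Delta\psi_1+|D|(h_1|D|\psi_1)\right)+3\left([|D|\psi_1][|D|\psi_2]-\nabla\psi_1\cdot\nabla\psi_2\right).\end{aligned}$$ *)

(* Defs.v *)
From HB Require Import structures.
From mathcomp Require Import all_boot all_order all_algebra.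
From mathcomp Require Import ring complex.
From mathcomp Require Import all_classical all_reals all_analysis.

Set Implicit Arguments.
Unset Strict Implicit.
Unset Printing Implicit Defensive.
Import Order.TTheory GRing.Theory Num.Theory.
Import numFieldNormedType.Exports.

Local Open Scope classical_set_scope.
Local Open Scope ring_scope.
Local Open Scope complex_scope.

(* R^d, as a measurable space with its Lebesgue measure and its coordinates;
   the library has no d-dimensional Lebesgue measure, so the cases d = 1 and
   d = 2 are built by hand below. *)
Record euclid (R : realType) := Euclid {
  dim : nat ;
  edisp : measure_display ;
  point : measurableType edisp ;
  leb : {measure set point -> \bar R} ;
  coord : point -> 'I_dim -> R }.

Arguments leb {R} e.

Definition euclid1 (R : realType) : euclid R :=
  @Euclid R 1 _ (measurableTypeR R) (@lebesgue_measure R) (fun x _ => x).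

Definition euclid2 (R : realType) : euclid R :=
  @Euclid R 2 _ (measurableTypeR R * measurableTypeR R)%type
    (@lebesgue_measure R \x @lebesgue_measure R)%E
    (fun p j => if j == ord0 then p.1 else p.2).

Section Fourier.
Context {R : realType} {E : euclid R}.
Local Notation V := (point E).
Local Notation C := R[i].
Implicit Types (x xi : V) (u v w h psi : V -> R) (a b : V -> C).

Definition dot x xi : R := \sum_j coord x j * coord xi j.

Definition enorm xi : R := Num.sqrt (dot xi xi).

Definition cis (theta : R) : C := cos theta +i* sin theta.

Definition cintegrable (f : V -> C) : Prop :=
  (leb E).-integrable setT (EFin \o (fun xi => complex.Re (f xi))) /\
  (leb E).-integrable setT (EFin \o (fun xi => complex.Im (f xi))).

Definition cintegral (f : V -> C) : C :=
  (\int[leb E]_xi complex.Re (f xi)) +i* (\int[leb E]_xi complex.Im (f xi)).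

Definition inv_fourier a x : C :=
  ((2 * pi) ^- dim E)%:C * cintegral (fun xi => cis (dot x xi) * a xi).

(* [a] is the Fourier transform of [u].  It is pinned down by Fourier
   inversion, with [a] integrable, rather than by an integral of [u]: |D| and
   exp(tL) create singularities at xi = 0, so that the functions below
   decay slowly.  The Fourier transform is injective on integrable functions,
   so [a] is unique up to a null set and the relations below are the graphs of
   single-valued (partial) operators. *)
Definition has_fourier u a : Prop :=
  cintegrable a /\ forall x, (u x)%:C = inv_fourier a x.

(* v = m(D) u with D = - i grad; partial derivatives are the case m = i xi_j. *)
Definition multiplier (m : V -> C) u v : Prop :=
  exists a, has_fourier u a /\ has_fourier v (fun xi => m xi * a xi).

Definition is_absD u v : Prop := multiplier (fun xi => (enorm xi)%:C) u v.

Definition is_laplacian u v : Prop :=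
  multiplier (fun xi => (- enorm xi ^+ 2)%:C) u v.

Definition is_partial (j : 'I_(dim E)) u v : Prop :=
  multiplier (fun xi => 0 +i* coord xi j) u v.

Definition is_grad u (v : 'I_(dim E) -> V -> R) : Prop :=
  forall j, is_partial j u (v j).

Definition is_div (v : 'I_(dim E) -> V -> R) w : Prop :=
  exists2 z : 'I_(dim E) -> V -> R, (forall j, is_partial j (v j) (z j)) &
    forall x, w x = \sum_j z j x.

Definition is_sobolev_norm (s : R) u (n : \bar R) : Prop :=
  exists2 a, has_fourier u a &
    n = Lnorm (leb E) 2%:E (fun xi =>
          ((1 + enorm xi ^+ 2) `^ (s / 2) * Normc.normc (a xi))%:E).

(* The norm of X^s = H^(s+1/2) x H^s. *)
Definition is_X_norm (s : R) h psi (n : \bar R) : Prop :=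
  exists n1 n2 : \bar R, [/\ is_sobolev_norm (s + 2^-1) h n1,
    is_sobolev_norm s psi n2 & n = (n1 + n2)%E].

End Fourier.

Section WaterWaves.
Context {R : realType} {E : euclid R}.
Variables (g tau : R).
Local Notation V := (point E).
Implicit Types (t : R) (x xi : V) (h psi : V -> R).

(* The symbol of L, |D| in the upper right and tau Delta - g in the lower left
   corner. *)
Definition Lsymbol (xi : V) : 'M[R]_2 := \matrix_(i, j)
  if (i == 0) && (j == 1) then enorm xi
  else if (i == 1) && (j == 0) then - (tau * enorm xi ^+ 2) - g
  else 0.

Definition omega (xi : V) : R :=
  Num.sqrt (enorm xi * (g + tau * enorm xi ^+ 2)).

(* exp(t Lsymbol), computed from Lsymbol ^ 2 = - omega ^ 2; see [expL0] and
   [expL_derive]. *)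
Definition expL t (xi : V) : 'M[R]_2 :=
  (cos (t * omega xi))%:M +
  (if omega xi == 0 then t else sin (t * omega xi) / omega xi) *: Lsymbol xi.

(* (h', psi') = exp(tL) (h, psi) *)
Definition is_evolution t h psi h' psi' : Prop :=
  exists a b : V -> R[i],
    [/\ has_fourier h a, has_fourier psi b,
      has_fourier h' (fun xi =>
        (expL t xi 0 0)%:C * a xi + (expL t xi 0 1)%:C * b xi) &
      has_fourier psi' (fun xi =>
        (expL t xi 1 0)%:C * a xi + (expL t xi 1 1)%:C * b xi)].

(* (w1, w2) = \int_0^t exp((t-t')L) (F1, F2)(t') dt' *)
Definition is_duhamel t (F1 F2 : R -> V -> R) (w1 w2 : V -> R) : Prop :=
  exists v1 v2 : R -> V -> R,
    (forall t', 0 <= t' <= t ->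
       is_evolution (t - t') (F1 t') (F2 t') (v1 t') (v2 t')) /\
    (forall x,
      [/\ lebesgue_measure.-integrable `[0, t] (EFin \o v1 ^~ x),
          lebesgue_measure.-integrable `[0, t] (EFin \o v2 ^~ x),
          w1 x = \int[lebesgue_measure]_(t' in `[0, t]) v1 t' x &
          w2 x = \int[lebesgue_measure]_(t' in `[0, t]) v2 t' x]).

(* q = div (h grad psi) + |D| (h |D| psi) *)
Definition is_Q h psi (q : V -> R) : Prop :=
  exists (dpsi : 'I_(dim E) -> V -> R) (Dpsi q1 q2 : V -> R),
    [/\ is_grad psi dpsi, is_absD psi Dpsi,
        is_div (fun j => h \* dpsi j) q1, is_absD (h \* Dpsi) q2 &
        forall x, q x = q1 x + q2 x].

Definition is_quadratic h1 psi1 (N1 N2 : V -> R) : Prop :=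
  exists (q Dpsi1 : V -> R) (dpsi1 : 'I_(dim E) -> V -> R),
    [/\ is_Q h1 psi1 q, is_absD psi1 Dpsi1, is_grad psi1 dpsi1,
        forall x, N1 x = - 2 * q x &
        forall x, N2 x = Dpsi1 x ^+ 2 - \sum_j dpsi1 j x ^+ 2].

Definition is_cubic_h h1 psi1 h2 psi2 (M1 : V -> R) : Prop :=
  exists q12 q21 Dpsi1 Lpsi1 D_hDpsi1 A B F : V -> R,
    [/\ is_Q h1 psi2 q12, is_Q h2 psi1 q21,
        is_absD psi1 Dpsi1, is_laplacian psi1 Lpsi1 &
        is_absD (h1 \* Dpsi1) D_hDpsi1] /\
    [/\ is_laplacian (fun x => h1 x ^+ 2 * Dpsi1 x) A,
        is_absD (fun x => h1 x ^+ 2 * Lpsi1 x) B,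
        is_absD (h1 \* D_hDpsi1) F &
        forall x, M1 x = - 3 * q12 x - 3 * q21 x + 3 * (A x + B x + 2 * F x)].

Definition is_cubic_psi h1 psi1 psi2 (M2 : V -> R) : Prop :=
  exists (dh1 dpsi1 dpsi2 : 'I_(dim E) -> V -> R)
         (Dpsi1 Dpsi2 Lpsi1 D_hDpsi1 K : V -> R),
    [/\ is_grad h1 dh1, is_grad psi1 dpsi1 & is_grad psi2 dpsi2] /\
    [/\ is_absD psi1 Dpsi1, is_absD psi2 Dpsi2, is_laplacian psi1 Lpsi1 &
        is_absD (h1 \* Dpsi1) D_hDpsi1] /\
    is_div (fun j x => dh1 j x * \sum_k dh1 k x ^+ 2) K /\
    forall x, M2 x = - 3 * tau * K x
      - 6 * Dpsi1 x * (h1 x * Lpsi1 x + D_hDpsi1 x)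
      + 3 * (Dpsi1 x * Dpsi2 x - \sum_j dpsi1 j x * dpsi2 j x).

(* (h3, psi3) is the third derivative at alpha = 0 of the solution, on the time
   interval [0, T], with data alpha (h0, psi0). *)
Definition is_third_variation (T : R) h0 psi0 (h3 psi3 : R -> V -> R) : Prop :=
  exists h1 psi1 h2 psi2 N1 N2 M1 M2 : R -> V -> R,
    forall t, 0 <= t <= T ->
      [/\ is_evolution t h0 psi0 (h1 t) (psi1 t),
          is_quadratic (h1 t) (psi1 t) (N1 t) (N2 t) &
          is_duhamel t N1 N2 (h2 t) (psi2 t)] /\
      [/\ is_cubic_h (h1 t) (psi1 t) (h2 t) (psi2 t) (M1 t),
          is_cubic_psi (h1 t) (psi1 t) (psi2 t) (M2 t) &
          is_duhamel t M1 M2 (h3 t) (psi3 t)].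

(* The cubic estimate that a flow map of class C^3 from X^s to C([0,T]; X^s)
   satisfies at the origin.  [n0] is finite, so (h0, psi0) is in X^s, while
   [n3 t] may be infinite, when (h3, psi3)(t) is not. *)
Definition flow_C3_at_origin (s T : R) : Prop :=
  exists C : R, forall (h0 psi0 : V -> R) (h3 psi3 : R -> V -> R)
      (n0 : R) (n3 : R -> \bar R),
    is_X_norm s h0 psi0 n0%:E ->
    is_third_variation T h0 psi0 h3 psi3 ->
    (forall t, 0 <= t <= T -> is_X_norm s (h3 t) (psi3 t) (n3 t)) ->
    (ereal_sup [set n3 t | t in `[0%R, T]] <= (C * n0 ^+ 3)%:E)%E.

Lemma expL0 (xi : V) : expL 0 xi = 1%:M.
Proof.
by rewrite /expL mul0r cos0 sin0 mul0r; case: ifP => _; rewrite scale0r addr0.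
Qed.

Lemma dot_ge0 (xi : V) : 0 <= dot xi xi.
Proof. by apply: sumr_ge0 => j _; rewrite -expr2 sqr_ge0. Qed.

Lemma Lsymbol2 (xi : V) : 0 <= g -> 0 <= tau ->
  Lsymbol xi *m Lsymbol xi = (- omega xi ^+ 2)%:M.
Proof.
move=> g0 tau0; rewrite /omega sqr_sqrtr; last first.
  by rewrite mulr_ge0 ?sqrtr_ge0// addr_ge0// mulr_ge0// sqr_ge0.
apply/matrixP => i j; rewrite mxE big_ord_recl big_ord1 !mxE.
case: i => -[|[|//]] ?; case: j => -[|[|//]] ? /=; rewrite ?(mulr0, mul0r) //=;
  rewrite ?mulr1n ?mulr0n ?addr0 ?add0r //.
- by rewrite -opprD mulrN addrC.
- by rewrite -opprD mulNr addrC mulrC.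
Qed.

Lemma expL_derive (xi : V) t (i j : 'I_2) : 0 <= g -> 0 <= tau ->
  is_derive t (1 : R) (fun r => expL r xi i j) ((Lsymbol xi *m expL t xi) i j).
Proof.
move=> g0 tau0; rewrite mulmxDr -scalemxAr Lsymbol2// mul_mx_scalar.
rewrite /expL; set w := omega xi; move: (Lsymbol xi) => M.
have wP : is_derive t (1 : R) (fun r : R => r * w) w.
  by apply: is_derive_eq; rewrite scaler0 add0r /GRing.scale/= mulr1.
have cP := @is_derive1_comp _ cos ( *%R^~ w) t _ _ (is_derive_cos _) wP.
have sP := @is_derive1_comp _ sin ( *%R^~ w) t _ _ (is_derive_sin _) wP.
set F := fun r => _.
have {F}-> : F = (i == j)%:R *: (cos \o *%R^~ w) +
    M i j *: (if w == 0 then id else w^-1 *: (sin \o *%R^~ w)).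
  apply/funext => r; rewrite /F !mxE -[RHS]/(_ *: _ + _ *: _ r).
  congr (_ + _); first by rewrite -[LHS]mulr_natl.
  by rewrite [LHS]mulrC; case: ifP => // _; rewrite [_ / w]mulrC.
rewrite !mxE; case: ifPn => [/eqP w0|w0].
  apply: is_derive_eq.
  by rewrite w0 !mulr0 cos0 expr0n oppr0 mul0rn mulr0 addr0 scaler0 add0r
    mul1r /GRing.scale/= mulr1.
apply: is_derive_eq; rewrite /GRing.scale/= -mulr_natl.
by field.
Qed.

End WaterWaves.

Arguments flow_C3_at_origin {R} E g tau s T.

(* Main.v *)
Require Import Defs.
From HB Require Import structures.
From mathcomp Require Import all_boot all_order all_algebra.
From mathcomp Require Import ring lra complex.
From mathcomp Require Import all_classical all_reals all_analysis.
From mathcomp Require Import measurable_realfun.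

(* Norm inflation at third order, for every s.  Take psi0 = 0 and let the Fourier
   transform of h0 be 1_L + kap 1_H, symmetrised, where L and H are small boxes at
   the frequencies e_1 and N e_1, N = P^2, and kap is such that the norm of h0
   stays bounded in H^(s+1/2).  Let t omega(N e_1) = 2 pi k, so that t is of order
   k P^-3.  Near the frequency (N+2) e_1 only the interactions of two packets at L
   and one at H contribute to psi3(t).  In the capillary term
   -3 tau div (grad h |grad h|^2) they oscillate in phase with the propagator,
   which yields the integral of 3 tau P^4 cos^2, a secular growth of size
   (3/2) tau t P^4.  Everything else is smaller: the symbol
   |xi| |eta| - xi . eta of the quadratic terms nearly vanishes as all frequencies
   are nearly parallel to e_1, and in the cubic term of G the part of |xi| equal to
   xi_1 cancels, since multiplication by xi_1 is a derivation for the
   convolution.  Hence the H^s norm of psi3(t) is at least a constant times k, with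
   k arbitrary and a constant that does not depend on k and P. *)

Set Implicit Arguments.
Unset Strict Implicit.
Unset Printing Implicit Defensive.
Import Order.TTheory GRing.Theory Num.Theory.
Import numFieldNormedType.Exports.

Local Open Scope classical_set_scope.
Local Open Scope ring_scope.

(** * Integration of bounded functions supported in sets of finite measure *)

(** The half derivative between the norms of h0 and psi3 costs one factor P: kap times the H^s
    weight at the frequency P^2 is of order P^-1, so the growth tau t P^4 becomes t P^3, of order k.
    The exponent s enters only through weights that cancel up to constants. The order of the choices
    matters: k comes from the constant to be refuted, it fixes the bound K of t P^3, and only then
    is P taken large. Every error with a spare power of P then disappears, and t can be made smaller
    than any T. In so short a time the low packet does not move, and the phases of the high packets
    differ by O(P^-2). The obstacle is the cubic term of G: after the cancellation it is still of
    order tau P^4, like the secular term, and only its constant is smaller. It carries a defect |xi|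
    - xi_1, at most r^2 / (2p) in a box of side r at p e_1, hence the boxes of side 1/10 and the
    explicit constants throughout. Upper and lower bounds are pointwise multiples of the
    self-convolutions of the nonnegative packet, which are never computed; a lower bound of the
    triple one on a smaller box suffices. *)

Section Tame.
Context {R : realType} d (T : measurableType d) (mu : {measure set T -> \bar R}).
Implicit Types (f g : T -> R) (A : set T).

(** All integrands below are of this kind, so that integrability becomes a closure property and
    needs no estimate. *)
Definition tame f := measurable_fun setT f /\
  exists (M : R) A, [/\ measurable A, (mu A < +oo)%E &
                  forall x, `|f x| <= M * \1_A x].

Lemma tame_integrable f : tame f -> mu.-integrable setT (EFin \o f).
Proof.
move=> [mf [M [A [mA Afin fM]]]].
apply: (@le_integrable _ _ _ _ _ measurableT _ (EFin \o (fun x => M * \1_A x))) => //.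
- exact/measurable_EFinP.
- by move=> x _ /=; rewrite lee_fin; exact: le_trans (fM x) (ler_norm _).
- apply/integrableP; split.
    by apply/measurable_EFinP; apply: measurable_funM.
  under eq_integral do
    rewrite /= normrM EFinM (@ger0_norm _ (\1_A _))//.
  rewrite ge0_integralZl//; first by rewrite integral_indic// setIT lte_mul_pinfty.
  exact/measurable_EFinP.
Qed.

Lemma tame_le K f g : tame f -> measurable_fun setT g ->
  (forall x, `|g x| <= K * `|f x|) -> tame g.
Proof.
move=> [mf [M [A [mA Afin fM]]]] mg gK; split=> //.
exists (`|K| * M), A; split=> // x; apply: le_trans (gK x) _.
rewrite -mulrA; apply: le_trans (ler_wpM2r (normr_ge0 _) (ler_norm _)) _.
exact: ler_wpM2l.
Qed.

Lemma tame_of_bound f M A : measurable_fun setT f -> measurable A ->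
  (mu A < +oo)%E -> (forall x, `|f x| <= M * \1_A x) -> tame f.
Proof. by move=> mf mA Afin fM; split=> //; exists M, A. Qed.

Lemma tame0 : tame (fun=> 0).
Proof.
split; first exact: measurable_cst.
by exists 0, set0; split=> //; rewrite ?measure0// => x; rewrite normr0 mul0r.
Qed.

Lemma tameD f g : tame f -> tame g -> tame (fun x => f x + g x).
Proof.
move=> [mf [M [A [mA Afin fM]]]] [mg [M' [B [mB Bfin gM]]]].
split; first exact: measurable_funD.
exists (`|M| + `|M'|), (A `|` B); split.
- exact: measurableU.
- apply: le_lt_trans (measureU2 mu mA mB) _; exact: lte_add_pinfty.
move=> x; apply: le_trans (ler_normD _ _) _.
rewrite mulrDl; apply: lerD; [apply: le_trans (fM x) _|apply: le_trans (gM x) _].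
  apply: le_trans (ler_wpM2r _ (ler_norm M)) _; first by [].
  by apply: ler_wpM2l => //; rewrite !indicE in_setU; case: (x \in A) => //=; rewrite ler0n.
apply: le_trans (ler_wpM2r _ (ler_norm M')) _; first by [].
by apply: ler_wpM2l => //; rewrite !indicE in_setU; case: (x \in B); rewrite ?orbT.
Qed.

Lemma tameZ c f : tame f -> tame (fun x => c * f x).
Proof.
move=> tf; apply: (tame_le (K := `|c|) tf) => [|x]; last by rewrite normrM.
by case: tf => mf _; exact: measurable_funM.
Qed.

Lemma tameN f : tame f -> tame (fun x => - f x).
Proof.
by move=> /(tameZ (-1)); under eq_fun do rewrite mulN1r.
Qed.

Lemma tame_norm f : tame f -> tame (fun x => `|f x|).
Proof.
move=> tf; apply: (tame_le (K := 1) tf) => [|x]; last by rewrite mul1r normr_id.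
by case: tf => mf _; exact: measurableT_comp.
Qed.

Lemma integral_tameD f g : tame f -> tame g ->
  \int[mu]_x (f x + g x) = \int[mu]_x f x + \int[mu]_x g x.
Proof. by move=> tf tg; rewrite RintegralD//; exact: tame_integrable. Qed.

Lemma integral_tameZ c f : tame f -> \int[mu]_x (c * f x) = c * \int[mu]_x f x.
Proof. by move=> tf; rewrite RintegralZl//; exact: tame_integrable. Qed.

Lemma integral_tameN f : tame f -> \int[mu]_x (- f x) = - \int[mu]_x f x.
Proof.
by move=> tf; rewrite -mulN1r -integral_tameZ//; under [in RHS]eq_Rintegral do rewrite mulN1r.
Qed.

Lemma integral_tameB f g : tame f -> tame g ->
  \int[mu]_x (f x - g x) = \int[mu]_x f x - \int[mu]_x g x.
Proof. by move=> tf tg; rewrite RintegralB//; exact: tame_integrable. Qed.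

Lemma le_integral_tame f g : tame f -> tame g -> (forall x, f x <= g x) ->
  \int[mu]_x f x <= \int[mu]_x g x.
Proof. by move=> tf tg fg; apply: le_Rintegral => //; exact: tame_integrable. Qed.

Lemma le_norm_integral_tame f g : tame f -> tame g ->
  (forall x, `|f x| <= g x) -> `|\int[mu]_x f x| <= \int[mu]_x g x.
Proof.
move=> tf tg fg; apply: le_trans (le_integral_tame (tame_norm tf) tg fg).
by apply: le_normr_Rintegral => //; exact: tame_integrable.
Qed.

Lemma integral_tame_sum (I : Type) (r : seq I) (F : I -> T -> R) :
  (forall i, tame (F i)) ->
  \int[mu]_x (\sum_(i <- r) F i x) = \sum_(i <- r) \int[mu]_x F i x.
Proof.
move=> tF; elim: r => [|i r IH].
  under eq_Rintegral do rewrite big_nil.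
  by rewrite big_nil Rintegral_cst// mul0r.
have ts : tame (fun x => \sum_(j <- r) F j x).
  elim: r {IH} => [|j r IH]; first by under eq_fun do rewrite big_nil; exact: tame0.
  by under eq_fun do rewrite big_cons; exact: tameD.
under eq_Rintegral do rewrite big_cons.
by rewrite big_cons integral_tameD// IH.
Qed.

Lemma tame_sum (I : Type) (r : seq I) (F : I -> T -> R) :
  (forall i, tame (F i)) -> tame (fun x => \sum_(i <- r) F i x).
Proof.
move=> tF; elim: r => [|j r IH].
  by under eq_fun do rewrite big_nil; exact: tame0.
by under eq_fun do rewrite big_cons; exact: tameD.
Qed.

End Tame.

(** * Measurability and exchange of real-valued double integrals *)

Section Fubini.
Context {R : realType} d1 d2 (T1 : measurableType d1) (T2 : measurableType d2).
Variables (m1 : {sigma_finite_measure set T1 -> \bar R})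
          (m2 : {sigma_finite_measure set T2 -> \bar R}).

Lemma measurable_Rintegral (f : T1 * T2 -> R) : measurable_fun setT f ->
  measurable_fun setT (fun x => \int[m2]_y f (x, y)).
Proof.
move=> mf; have mF : measurable_fun setT (EFin \o f) by exact/measurable_EFinP.
(* Tonelli gives measurability for nonnegative integrands, so the positive and negative parts are
   integrated apart. *)
have -> : (fun x => \int[m2]_y f (x, y)) = fine \o
    ((fun x => \int[m2]_y ((EFin \o f)^\+ (x, y)))%E \-
     (fun x => \int[m2]_y ((EFin \o f)^\- (x, y)))%E)%E.
  apply/funext => x; rewrite /Rintegral/= [in LHS]integralE.
  by congr (fine (_ - _))%E; apply: eq_integral => y _;
    rewrite ?funeposE ?funenegE.
apply: measurableT_comp => //; apply: emeasurable_funB.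
- by apply: measurable_fun_fubini_tonelli_F => //; exact: measurable_funepos.
- by apply: measurable_fun_fubini_tonelli_F => //; exact: measurable_funeneg.
Qed.

(** Domination by a product of indicators makes every slice integrable, so that the real inner
    integrals are the extended ones at every point, with no exceptional null set. *)
Lemma Rfubini (f : T1 * T2 -> R) M A B : measurable_fun setT f ->
  measurable A -> (m1 A < +oo)%E -> measurable B -> (m2 B < +oo)%E ->
  (forall x y, `|f (x, y)| <= M * (\1_A x * \1_B y)) ->
  \int[m1]_x \int[m2]_y f (x, y) = \int[m2]_y \int[m1]_x f (x, y).
Proof.
move=> mf mA Afin mB Bfin fM.
have tf : tame (m1 \x m2)%E f.
  apply: (@tame_of_bound _ _ _ _ _ M (A `*` B)) => //.
  - exact: measurableX.
  - by rewrite /= product_measure1E// lte_mul_pinfty// ge0_fin_numE.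
  - move=> [x y]; apply: le_trans (fM x y) _.
    by rewrite !indicE in_setX/= -natrM mulnb.
have itf := tame_integrable tf.
have fin1 x : (\int[m2]_y (f (x, y))%:E)%E = (\int[m2]_y f (x, y))%:E.
  rewrite /Rintegral fineK//; apply: integrable_fin_num => //.
  apply: (@tame_integrable _ _ _ m2 (fun y => f (x, y))).
  apply: (@tame_of_bound _ _ _ _ _ (`|M|) B) => //.
  - by apply: (measurableT_comp mf); exact: measurable_pair1.
  move=> y; apply: le_trans (fM x y) _.
  apply: le_trans (ler_wpM2r _ (ler_norm M)) _; first by rewrite mulr_ge0.
  by apply: ler_wpM2l => //; rewrite !indicE; case: (x \in A); rewrite ?mul1r ?mul0r.
have fin2 y : (\int[m1]_x (f (x, y))%:E)%E = (\int[m1]_x f (x, y))%:E.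
  rewrite /Rintegral fineK//; apply: integrable_fin_num => //.
  apply: (@tame_integrable _ _ _ m1 (fun x => f (x, y))).
  apply: (@tame_of_bound _ _ _ _ _ (`|M|) A) => //.
  - by apply: (measurableT_comp mf); exact: measurable_pair2.
  move=> x; apply: le_trans (fM x y) _.
  apply: le_trans (ler_wpM2r _ (ler_norm M)) _; first by rewrite mulr_ge0.
  by apply: ler_wpM2l => //; rewrite !indicE; case: (y \in B); rewrite ?mulr1 ?mulr0.
rewrite {1}/Rintegral [RHS]/Rintegral; congr fine.
transitivity (\int[m1]_x \int[m2]_y (EFin \o f) (x, y))%E.
  by apply: eq_integral => x _; rewrite /= fin1.
rewrite Fubini//; apply: eq_integral => y _; rewrite /= fin2//.
Qed.

End Fubini.

(** * Amplitudes, convolution and the Fourier transform *)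

(* The frequency space R^d, d = codim + 1 <= 2, treated uniformly; the axioms
   are what the argument uses of the Lebesgue measure. *)
Record freq_space (R : realType) := FreqSpace {
  codim : nat ;
  fdisp : measure_display ;
  freq : measurableType fdisp ;
  mu : {sigma_finite_measure set freq -> \bar R} ;
  co : freq -> 'I_codim.+1 -> R ;
  sub : freq -> freq -> freq ;
  codim_le1 : (codim <= 1)%N ;
  co_inj : forall x y, co x =1 co y -> x = y ;
  co_sub : forall x y j, co (sub x y) j = co x j - co y j ;
  measurable_co : forall j, measurable_fun setT (co ^~ j) ;
  measurable_sub : measurable_fun setT (fun p : freq * freq => sub p.1 p.2) ;
  mu_sub : forall x A, measurable A -> mu (sub x @^-1` A) = mu A ;
  mu_box : forall p q r, 0 <= r ->
    mu [set xi | p <= co xi ord0 <= p + r /\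
                 forall j, j != ord0 -> q <= co xi j <= q + r] =
    (r ^+ codim.+1)%:E }.

Arguments mu {R} f.

Section Frequencies.
Context {R : realType} (S : freq_space R).
Local Notation V := (freq S).
Local Notation RT := (measurableTypeR R).
Implicit Types (x y xi eta : V) (a b f : V -> R).

Definition euc : euclid R := @Euclid R (codim S).+1 _ V (mu S) (@co R S).

Definition nrm xi : R := @enorm R euc xi.
Definition dt x xi : R := @dot R euc x xi.

Definition box p q r : set V := [set xi | p <= co xi ord0 <= p + r /\
                 forall j, j != ord0 -> q <= co xi j <= q + r].

Definition cube r : set V := [set xi | forall j, `|co xi j| <= r].

Definition neg xi : V := sub (sub xi xi) xi.

Lemma co_neg xi j : co (neg xi) j = - co xi j.
Proof. by rewrite !co_sub subrr sub0r. Qed.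

Lemma sub_sub x y : sub x (sub x y) = y.
Proof. by apply: co_inj => j; rewrite !co_sub; ring. Qed.

Lemma dtE x xi : dt x xi = \sum_j co x j * co xi j. Proof. by []. Qed.

Lemma dt_sub x xi eta : dt x (sub xi eta) = dt x xi - dt x eta.
Proof.
rewrite !dtE -sumrB; apply: eq_bigr => j _.
by rewrite co_sub mulrBr.
Qed.

Lemma dt_neg x xi : dt x (neg xi) = - dt x xi.
Proof.
by rewrite !dtE -sumrN; apply: eq_bigr => j _; rewrite co_neg mulrN.
Qed.

Lemma nrm_neg xi : nrm (neg xi) = nrm xi.
Proof.
rewrite /nrm /enorm; congr Num.sqrt; apply: eq_bigr => j _.
by rewrite [Defs.coord _ _]co_neg mulrNN.
Qed.

Lemma neg_sub xi eta : neg (sub xi eta) = sub (neg xi) (neg eta).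
Proof. by apply: co_inj => j; rewrite !(co_neg, co_sub); ring. Qed.

Lemma negK : involutive neg.
Proof. by move=> x; apply: co_inj => j; rewrite !co_neg opprK. Qed.

Lemma measurable_nrm : measurable_fun setT nrm.
Proof.
apply: (@measurableT_comp _ _ _ _ _ _ (@Num.sqrt R)).
  by apply: continuous_measurable_fun; exact: sqrt_continuous.
apply: measurable_sum => j.
by apply: measurable_funM; exact: (@measurable_co R S).
Qed.

Lemma measurable_dt x : measurable_fun setT (dt x).
Proof.
apply: measurable_sum => j; apply: measurable_funM; first exact: measurable_cst.
exact: (@measurable_co R S).
Qed.

Lemma measurable_subr x : measurable_fun setT (sub x : V -> V).
Proof. exact: (measurableT_comp (@measurable_sub R S) (measurable_pair1 x)). Qed.

Lemma cubeE r : 0 <= r -> cube r = box (- r) (- r) (r + r).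
Proof.
move=> r0; apply/seteqP; split => xi.
- move=> c; split; first by have := c ord0; rewrite ler_norml; lra.
  by move=> j _; have := c j; rewrite ler_norml; lra.
- move=> [c0 c] j; rewrite ler_norml; have [->|/c] := eqVneq j ord0; lra.
Qed.

Lemma measurable_box p q r : measurable (box p q r).
Proof.
have mc j u v : measurable [set xi : V | u <= co xi j <= v].
  have -> : [set xi : V | u <= co xi j <= v] = (@co R S ^~ j) @^-1` `[u, v].
    by apply/seteqP; split => xi /=; rewrite in_itv.
  by rewrite -[X in measurable X]setTI; exact: measurable_co.
have -> : box p q r = [set xi | p <= co xi ord0 <= p + r] `&`
    \bigcap_(j in [set j | j != ord0]) [set xi | q <= co xi j <= q + r].
  by apply/seteqP; split => xi [? ?]; split=> //= j /=; auto.
apply: measurableI; first exact: mc.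
by apply: fin_bigcap_measurable => [|j _]; [exact: finite_finset|exact: mc].
Qed.

Lemma mu_boxE p q r : 0 <= r -> mu S (box p q r) = (r ^+ (codim S).+1)%:E.
Proof. exact: mu_box. Qed.

Lemma mu_subE x A : measurable A ->
  (mu S : {measure set V -> \bar R}) (sub x @^-1` A) =
  (mu S : {measure set V -> \bar R}) A.
Proof. exact: mu_sub. Qed.

Lemma measurable_cube r : measurable (cube r).
Proof.
have [r0|r0] := leP 0 r; first by rewrite cubeE//; exact: measurable_box.
suff -> : cube r = set0 by [].
apply/seteqP; split=> // xi /(_ ord0); rewrite leNgt => /negP; apply.
exact: lt_le_trans r0 _.
Qed.

Lemma mu_cube_fin r : (mu S (cube r) < +oo)%E.
Proof.
have [r0|r0] := leP 0 r; first by rewrite cubeE// mu_boxE ?ltry ?addr_ge0.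
suff -> : cube r = set0 by rewrite measure0.
apply/seteqP; split=> // xi /(_ ord0); rewrite leNgt => /negP; apply.
exact: lt_le_trans r0 _.
Qed.

Lemma cube_sub r s xi eta : cube r eta -> cube s (sub xi eta) -> cube (r + s) xi.
Proof.
move=> c d j; have -> : co xi j = co eta j + co (sub xi eta) j.
  by rewrite co_sub addrC subrK.
by apply: le_trans (ler_normD _ _) _; exact: lerD.
Qed.

Lemma tame_sub x f : tame (mu S) f -> tame (mu S) (fun xi => f (sub x xi)).
Proof.
move=> [mf [M [A [mA Afin fM]]]]; split.
  exact: (measurableT_comp mf (measurable_subr x)).
exists M, (sub x @^-1` A); split => [||xi].
- by rewrite -[X in measurable X]setTI; exact: measurable_subr.
- by move: Afin; rewrite -(mu_subE x mA).
- exact: fM.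
Qed.

(** Reflections [sub x] are the only symmetries assumed of the measure. Two of them compose to a
    translation, and [neg] is itself one of them. *)
Lemma integral_reflect x f : tame (mu S) f ->
  \int[mu S]_xi f (sub x xi) = \int[mu S]_xi f xi.
Proof.
move=> tf; rewrite /Rintegral; congr fine.
have itf := tame_integrable (tame_sub x tf).
have := @integral_pushforward _ _ _ _ R _ (measurable_subr x) (mu S) setT (EFin \o f).
rewrite preimage_setT => <-//.
- apply: eq_measure_integral => [|mf A mA _]; first exact: measurable_subr.
  by rewrite /= /pushforward; exact: mu_subE.
- by apply/measurable_EFinP; case: tf.
Qed.

Lemma neg_subE x : neg x = sub (sub point point) x.
Proof. by apply: co_inj => j; rewrite !(co_neg, co_sub) subrr sub0r. Qed.

Lemma integral_neg f : tame (mu S) f ->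
  \int[mu S]_xi f (neg xi) = \int[mu S]_xi f xi.
Proof.
move=> tf; rewrite -(integral_reflect (sub point point) tf).
by apply: eq_Rintegral => xi _; rewrite neg_subE.
Qed.

Definition fcst : R := (2 * pi) ^- (codim S).+1.

Lemma fcst_gt0 : 0 < fcst.
Proof. by rewrite /fcst -exprVn exprn_gt0// invr_gt0 mulr_gt0// pi_gt0. Qed.

(** The constant is that of the inverse transform, so that a product of functions has the
    convolution of the amplitudes as amplitude, with no further factor. *)
Definition convolve a b xi : R := fcst * \int[mu S]_eta (a eta * b (sub xi eta)).

(* [a t] is a real amplitude, even if [e = false] and odd if [e = true]; the
   Fourier transform that it encodes is [a t] or ['i * a t] respectively, so that
   the function is real in both cases. *)
Record fam (T : R) (e : bool) (a : R -> V -> R) : Prop := Fam {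
  fam_meas : measurable_fun setT (fun p : RT * V => a p.1 p.2) ;
  fam_bnd : exists M r : R, forall t xi, 0 <= t <= T ->
    `|a t xi| <= M * \1_(cube r) xi ;
  fam_par : forall t xi, 0 <= t <= T -> a t (neg xi) = (-1) ^+ e * a t xi }.

(** Local bounds in frequency are enough for a multiplier, since it acts on amplitudes of bounded
    support. Parities combine by exclusive or. *)
Record mult (T : R) (e : bool) (m : R -> V -> R) : Prop := Mult {
  mult_meas : measurable_fun setT (fun p : RT * V => m p.1 p.2) ;
  mult_bnd : forall r, exists M : R, forall t xi, 0 <= t <= T -> cube r xi ->
    `|m t xi| <= M ;
  mult_par : forall t xi, m t (neg xi) = (-1) ^+ e * m t xi }.

(** The form in which boundedness is used: nonnegative constants, and the bound and the support
    available separately. *)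
Lemma bnd_normalize (P : R -> V -> Prop) (a : R -> V -> R) :
  (exists M r : R, forall t xi, P t xi -> `|a t xi| <= M * \1_(cube r) xi) ->
  exists M r : R, [/\ 0 <= M, 0 <= r & forall t xi, P t xi ->
     `|a t xi| <= M /\ (`|a t xi| <= M * \1_(cube r) xi)
     /\ (a t xi != 0 -> cube r xi)].
Proof.
move=> [M [r H]]; exists `|M|, `|r|; split=> // t xi /H {}H.
have H1 : `|a t xi| <= `|M| * \1_(cube r) xi.
  by apply: le_trans H _; apply: ler_wpM2r => //; exact: ler_norm.
have H2 : a t xi != 0 -> cube r xi.
  move=> a0; apply/not_notP => nc; move: H1; rewrite indicE memNset// mulr0.
  by rewrite normr_le0 (negbTE a0).
have H3 : a t xi != 0 -> cube `|r| xi.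
  by move=> /H2 c j; exact: le_trans (c j) (ler_norm _).
have H4 : `|a t xi| <= `|M|.
  apply: le_trans H1 _; rewrite ler_piMr// indicE.
split=> //; split=> //.
have [->|/H3 c] := eqVneq (a t xi) 0; first by rewrite normr0 mulr_ge0.
by rewrite indicE mem_set// mulr1.
Qed.

Lemma bnd_of (P : R -> V -> Prop) (a : R -> V -> R) M r : 0 <= M ->
  (forall t xi, P t xi -> `|a t xi| <= M) ->
  (forall t xi, P t xi -> a t xi != 0 -> cube r xi) ->
  exists M r : R, forall t xi, P t xi -> `|a t xi| <= M * \1_(cube r) xi.
Proof.
move=> M0 H H'; exists M, r => t xi Pt.
have [->|/(H' _ _ Pt) c] := eqVneq (a t xi) 0; first by rewrite normr0 mulr_ge0.
by rewrite indicE mem_set// mulr1; exact: H.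
Qed.

Lemma fam_cst T e a : fam 0 e (fun=> a) -> fam T e (fun=> a).
Proof.
move=> [m [M [r b]] p]; split=> //.
by exists M, r => t xi _; apply: (b 0); rewrite lexx.
by move=> t xi _; apply: (p 0); rewrite lexx.
Qed.

Lemma fam_slice T e (a : R -> V -> R) t : fam T e a -> 0 <= t <= T ->
  fam 0 e (fun=> a t).
Proof.
move=> [m [M [r b]] p] tT; split=> //; [|by exists M, r => _ xi _; exact: b|by move=> _ xi _; exact: p].
apply: (measurableT_comp m (g := fun q : RT * V => (t : RT, q.2))).
by apply: measurable_fun_pair; [exact: measurable_cst|exact: measurable_snd].
Qed.

Lemma famD T e (a b : R -> V -> R) : fam T e a -> fam T e b ->
  fam T e (fun t xi => a t xi + b t xi).
Proof.
move=> [m bnd p] [m' bnd' p']; split=> [||t xi tT]; last by rewrite p// p'// mulrDr.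
- exact: measurable_funD.
- have [M [r [M0 r0 H]]] := bnd_normalize bnd.
  have [M' [r' [M0' r0' H']]] := bnd_normalize bnd'.
  apply: (@bnd_of _ _ (M + M') (r + r')); first exact: addr_ge0.
    move=> t xi tT; apply: le_trans (ler_normD _ _) _.
    by apply: lerD; [case: (H t xi tT)|case: (H' t xi tT)].
  move=> t xi tT ab0 j.
  have [a0|a0] := eqVneq (a t xi) 0.
    have b0 : b t xi != 0 by apply: contra_neq ab0 => ->; rewrite a0 addr0.
    by have [_ [_ /(_ b0) /(_ j)]] := H' t xi tT; move: r0; lra.
  by have [_ [_ /(_ a0) /(_ j)]] := H t xi tT; move: r0'; lra.
Qed.

Lemma fam_mult T e e' (m a : R -> V -> R) : mult T e m -> fam T e' a ->
  fam T (e (+) e') (fun t xi => m t xi * a t xi).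
Proof.
move=> [mm bm pm] [ma bnda pa]; split=> [||t xi tT].
- exact: measurable_funM.
- have [M [r [M0 r0 H]]] := bnd_normalize bnda.
  have [K HK] := bm r.
  apply: (@bnd_of _ _ (`|K| * M) r); first exact: mulr_ge0.
    move=> t xi tT; have [Ha [_ Ha']] := H t xi tT; rewrite normrM.
    have [->|/Ha' c] := eqVneq (a t xi) 0.
      by rewrite normr0 mulr0 mulr_ge0.
    by apply: ler_pM => //; exact: le_trans (HK _ _ tT c) (ler_norm _).
  move=> t xi tT ma0; have [_ [_]] := H t xi tT; apply.
  by apply: contra_neq ma0 => ->; rewrite mulr0.
- by rewrite pm pa// signr_addb; ring.
Qed.

Lemma mult_cst T c : mult T false (fun _ _ => c).
Proof.
split=> [|r|t xi]; [exact: measurable_cst|by exists `|c| |by rewrite expr0 mul1r].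
Qed.

Lemma mult_slice T e (m : R -> V -> R) t : mult T e m -> 0 <= t <= T ->
  forall T', mult T' e (fun=> m t).
Proof.
move=> [mm b p] tT T'; split=> //.
- apply: (measurableT_comp mm (g := fun q : RT * V => (t : RT, q.2))).
  by apply: measurable_fun_pair; [exact: measurable_cst|exact: measurable_snd].
- by move=> r; have [M H] := b r; exists M => _ xi _; exact: H.
Qed.

Lemma multM T e e' (m m' : R -> V -> R) : mult T e m -> mult T e' m' ->
  mult T (e (+) e') (fun t xi => m t xi * m' t xi).
Proof.
move=> [mm bm pm] [mm' bm' pm']; split=> [|r|t xi].
- exact: measurable_funM.
- have [M H] := bm r; have [M' H'] := bm' r; exists (M * M') => t xi tT c.
  by rewrite normrM; apply: ler_pM => //; [exact: H|exact: H'].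
- by rewrite pm pm' signr_addb; ring.
Qed.

Lemma multD T e (m m' : R -> V -> R) : mult T e m -> mult T e m' ->
  mult T e (fun t xi => m t xi + m' t xi).
Proof.
move=> [mm bm pm] [mm' bm' pm']; split=> [|r|t xi].
- exact: measurable_funD.
- have [M H] := bm r; have [M' H'] := bm' r; exists (M + M') => t xi tT c.
  by apply: le_trans (ler_normD _ _) _; apply: lerD; [exact: H|exact: H'].
- by rewrite pm pm' mulrDr.
Qed.

Lemma famZ T e c (a : R -> V -> R) : fam T e a -> fam T e (fun t xi => c * a t xi).
Proof. by move=> fa; rewrite -[e]addFb; exact: fam_mult (mult_cst T c) fa. Qed.

Lemma nrm_ge0 xi : 0 <= nrm xi. Proof. exact: sqrtr_ge0. Qed.

Lemma sqr_nrm xi : nrm xi ^+ 2 = \sum_j co xi j ^+ 2.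
Proof. by rewrite sqr_sqrtr//; exact: dot_ge0. Qed.

Lemma co_le_nrm xi j : `|co xi j| <= nrm xi.
Proof.
rewrite -ler_sqr ?nnegrE ?nrm_ge0// real_normK ?num_real// sqr_nrm.
by rewrite (bigD1 j)//= lerDl sumr_ge0// => i _; rewrite sqr_ge0.
Qed.

Lemma mult_nrm T : mult T false (fun _ xi => nrm xi).
Proof.
split=> [|r|t xi]; last by rewrite expr0 mul1r nrm_neg.
- by apply: (measurableT_comp measurable_nrm); exact: measurable_snd.
(* From n ^ 2 <= s follows n <= 1 + s, which avoids a square root in the bound. *)
- exists (1 + \sum_(j < (codim S).+1) r ^+ 2) => _ xi _ c.
  rewrite ger0_norm ?nrm_ge0//.
  have : nrm xi ^+ 2 <= \sum_(j < (codim S).+1) r ^+ 2.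
    rewrite sqr_nrm; apply: ler_sum => j _.
    rewrite -[leLHS]real_normK ?num_real//.
    by rewrite ler_sqr ?nnegrE//; exact: le_trans (c j).
  set s := \sum_(j < _) _; have := nrm_ge0 xi; move: (nrm xi) => n n0 ns.
  nra.
Qed.

Lemma mult_co T j : mult T true (fun _ xi => co xi j).
Proof.
split=> [|r|t xi]; last by rewrite expr1 mulN1r co_neg.
- by apply: (measurableT_comp (@measurable_co R S j)); exact: measurable_snd.
- by exists r => _ xi _ c; exact: c.
Qed.

Lemma fam_tame e T (a : R -> V -> R) t : fam T e a -> 0 <= t <= T ->
  tame (mu S) (a t).
Proof.
move=> fa tT; have [m [M [r b]] _] := fam_slice fa tT.
apply: (@tame_of_bound _ _ _ _ _ M (cube r)).
- apply: (measurableT_comp m (g := fun xi => (0 : RT, xi))).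
  by apply: measurable_fun_pair; [exact: measurable_cst|exact: measurable_id].
- exact: measurable_cube.
- exact: mu_cube_fin.
- by move=> xi; apply: (b 0); rewrite lexx.
Qed.

Lemma tame_conv_integrand a b xi : tame (mu S) a -> tame (mu S) b ->
  (exists M : R, forall eta, `|b eta| <= M) ->
  tame (mu S) (fun eta => a eta * b (sub xi eta)).
Proof.
move=> ta tb [M HM]; apply: (tame_le (K := M) ta) => [|eta].
  apply: measurable_funM; first by case: ta.
  by case: (tame_sub xi tb).
by rewrite normrM mulrC; apply: ler_wpM2r.
Qed.

Lemma fam_bounded e T (a : R -> V -> R) t : fam T e a -> 0 <= t <= T ->
  exists M : R, forall xi, `|a t xi| <= M.
Proof.
move=> [_ b _] tT; have [M [r [M0 r0 H]]] := bnd_normalize b.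
by exists M => xi; have [] := H t xi tT.
Qed.

Lemma fam_tame_conv e e' T (a b : R -> V -> R) t xi : fam T e a -> fam T e' b ->
  0 <= t <= T -> tame (mu S) (fun eta => a t eta * b t (sub xi eta)).
Proof.
move=> fa fb tT; apply: tame_conv_integrand.
- exact: fam_tame fa tT.
- exact: fam_tame fb tT.
- exact: fam_bounded fb tT.
Qed.

(** The bound is the product of the two bounds and the measure of the first cube, the support lies
    in the sum of the cubes, and the parity follows by reflecting the integration variable. *)
Lemma fam_conv e e' T (a b : R -> V -> R) : fam T e a -> fam T e' b ->
  fam T (e (+) e') (fun t => convolve (a t) (b t)).
Proof.
move=> fa fb; have [ma ba pa] := fa; have [mb bb pb] := fb; split=> [||t xi tT].
- apply: measurable_funM; first exact: measurable_cst.
  pose F (q : RT * V * V) := a q.1.1 q.2 * b q.1.1 (sub q.1.2 q.2).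
  apply: (@measurable_Rintegral _ _ _ _ _ (mu S) F).
  apply: measurable_funM.
    apply: (measurableT_comp ma (g := fun q : RT * V * V => (q.1.1, q.2))).
    apply: measurable_fun_pair; last exact: measurable_snd.
    by apply: measurableT_comp; [exact: measurable_fst|exact: measurable_fst].
  apply: (measurableT_comp mb (g := fun q : RT * V * V => (q.1.1, sub q.1.2 q.2))).
  apply: measurable_fun_pair.
    by apply: measurableT_comp; [exact: measurable_fst|exact: measurable_fst].
  apply: (measurableT_comp (@measurable_sub R S)
     (g := fun q : RT * V * V => (q.1.2, q.2))).
  apply: measurable_fun_pair; last exact: measurable_snd.
  by apply: measurableT_comp; [exact: measurable_snd|exact: measurable_fst].
- have [M [r [M0 r0 H]]] := bnd_normalize ba.
  have [M' [r' [M0' r0' H']]] := bnd_normalize bb.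
  apply: (@bnd_of _ _ (fcst * (M * M' * fine (mu S (cube r)))) (r + r')).
  + by rewrite mulr_ge0 ?(ltW fcst_gt0)// mulr_ge0 ?mulr_ge0// fine_ge0.
  + move=> t xi tT; rewrite normrM gtr0_norm ?fcst_gt0//.
    apply: ler_wpM2l; first exact: ltW fcst_gt0.
    have -> : M * M' * fine (mu S (cube r)) =
        \int[mu S]_eta (M * M' * \1_(cube r) eta).
      rewrite RintegralZl//.
        congr (_ * _); rewrite /Rintegral integral_indic ?setIT//.
        exact: measurable_cube.
      apply: tame_integrable; split.
        by apply: measurable_indic; exact: measurable_cube.
      exists 1, (cube r); split; [exact: measurable_cube|exact: mu_cube_fin|].
      by move=> eta; rewrite mul1r ger0_norm.
    apply: le_norm_integral_tame; first exact: fam_tame_conv fa fb tT.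
      apply: tameZ; split.
        by apply: measurable_indic; exact: measurable_cube.
      exists 1, (cube r); split; [exact: measurable_cube|exact: mu_cube_fin|].
      by move=> eta; rewrite mul1r ger0_norm.
    move=> eta; rewrite normrM mulrAC; have [_ [Ha _]] := H t eta tT.
    by have [Hb _] := H' t (sub xi eta) tT; exact: ler_pM.
  + move=> t xi tT; apply: contra_neqP => nc; rewrite /convolve.
    rewrite (_ : Rintegral _ _ _ = 0) ?mulr0//.
    under eq_Rintegral => eta _.
      rewrite (_ : _ * _ = 0); first over.
      have [->|a0] := eqVneq (a t eta) 0; first by rewrite mul0r.
      have [->|b0] := eqVneq (b t (sub xi eta)) 0; first by rewrite mulr0.
      exfalso; apply: nc; apply: (@cube_sub _ _ _ eta).
        by have [_ [_]] := H t eta tT; apply.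
      by have [_ [_]] := H' t (sub xi eta) tT; apply.
    by rewrite Rintegral_cst// mul0r.
- rewrite /convolve mulrCA; congr (_ * _).
  rewrite -integral_neg; last exact: fam_tame_conv fa fb tT.
  rewrite -integral_tameZ; last exact: fam_tame_conv fa fb tT.
  apply: eq_Rintegral => eta _; rewrite -neg_sub pa// pb// signr_addb.
  by ring.
Qed.

End Frequencies.

(** * Lipschitz bounds for sine and cosine *)

Section Trigo.
Local Open Scope complex_scope.
Context {R : realType}.
Implicit Types x y : R.

Lemma sin_lipschitz x y : `|sin y - sin x| <= `|y - x|.
Proof.
wlog xy : x y / x <= y.
  by move=> H; have [/H//|/ltW/H] := leP x y; rewrite distrC [in leRHS]distrC.
have [z _ ->] := MVT_segment xy (fun z _ => is_derive_sin z)
  (continuous_subspaceT (@continuous_sin R)).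
by rewrite normrM ler_piMl// cos_max.
Qed.

Lemma cos_lipschitz x y : `|cos y - cos x| <= `|y - x|.
Proof.
wlog xy : x y / x <= y.
  by move=> H; have [/H//|/ltW/H] := leP x y; rewrite distrC [in leRHS]distrC.
have [z _ ->] := MVT_segment xy (fun z _ => is_derive_cos z)
  (continuous_subspaceT (@continuous_cos R)).
by rewrite normrM ler_piMl// normrN sin_max.
Qed.

Lemma abs_sin_le x : `|sin x| <= `|x|.
Proof. by have := sin_lipschitz 0 x; rewrite sin0 !subr0. Qed.

End Trigo.

(** * Real inverse transforms and the convolution theorem *)

Section Transform.
Local Open Scope complex_scope.
Context {R : realType} (S : freq_space R).
Local Notation V := (freq S).
Local Notation nrm := (@nrm R S).
Local Notation dt := (@dt R S).
Local Notation E := (euc S).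
Implicit Types (x y xi eta : V) (a b f : V -> R).

(** A single amplitude is a constant family on the time interval [0, 0], so that the lemmas on
    families apply to it. *)
Definition nice (e : bool) a := fam 0 e (fun=> a).

Lemma nice_slice T e (a : R -> V -> R) t : fam T e a -> 0 <= t <= T -> nice e (a t).
Proof. exact: fam_slice. Qed.

Lemma nice_tame e a : nice e a -> tame (mu S) a.
Proof. by move=> /(@fam_tame _ _ _ _ _ 0); apply; rewrite lexx. Qed.

Lemma nice_par e a xi : nice e a -> a (neg xi) = (-1) ^+ e * a xi.
Proof. by move=> [_ _ p]; apply: (p 0); rewrite lexx. Qed.

Lemma nice_conv e e' a b : nice e a -> nice e' b -> nice (e (+) e') (convolve a b).
Proof. exact: fam_conv. Qed.

Lemma nice_nrm e a : nice e a -> nice e (fun xi => nrm xi * a xi).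
Proof. by move=> na; rewrite -[e]addFb; exact: fam_mult (mult_nrm S 0) na. Qed.

Lemma nice_co e j a : nice e a -> nice (~~ e) (fun xi => co xi j * a xi).
Proof. by move=> na; rewrite -addTb; exact: fam_mult (mult_co 0 j) na. Qed.

Lemma niceZ e c a : nice e a -> nice e (fun xi => c * a xi).
Proof. exact: famZ. Qed.

Lemma niceD e a b : nice e a -> nice e b -> nice e (fun xi => a xi + b xi).
Proof. exact: famD. Qed.

Lemma niceN e a : nice e a -> nice e (fun xi => - a xi).
Proof. by move=> /(niceZ (-1)); under eq_fun do rewrite mulN1r. Qed.

Lemma nice0 e : nice e (fun=> 0).
Proof.
split=> [||t xi _]; [exact: measurable_cst| |by rewrite mulr0].
by exists 0, 0 => t xi _; rewrite normr0 mul0r.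
Qed.

Lemma nice_sum e (I : Type) (r : seq I) (F : I -> V -> R) :
  (forall i, nice e (F i)) -> nice e (fun xi => \sum_(i <- r) F i xi).
Proof.
move=> nF; elim: r => [|i r IH].
  by under eq_fun do rewrite big_nil; exact: nice0.
by under eq_fun do rewrite big_cons; exact: niceD.
Qed.

(** [phase] and [cophase] are the real and imaginary parts of exp(i th), multiplied by i when [e]
    holds. *)
Definition phase (e : bool) (th : R) : R := if e then - sin th else cos th.
Definition cophase (e : bool) (th : R) : R := if e then cos th else sin th.

Lemma phase_le1 e th : `|phase e th| <= 1.
Proof. by case: e; rewrite /= ?normrN ?sin_max ?cos_max. Qed.

Lemma cophase_le1 e th : `|cophase e th| <= 1.
Proof. by case: e; rewrite /= ?sin_max ?cos_max. Qed.

Lemma measurable_phase d (T : measurableType d) e (f : T -> R) :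
  measurable_fun setT f -> measurable_fun setT (fun z => phase e (f z)).
Proof.
move=> mf; apply: (@measurableT_comp _ _ _ _ _ _ (phase e) _ f) => //.
apply: continuous_measurable_fun; case: e => /= x; last exact: continuous_cos.
by apply: continuousN; exact: continuous_sin.
Qed.

Lemma measurable_cophase d (T : measurableType d) e (f : T -> R) :
  measurable_fun setT f -> measurable_fun setT (fun z => cophase e (f z)).
Proof.
move=> mf; apply: (@measurableT_comp _ _ _ _ _ _ (cophase e) _ f) => //.
apply: continuous_measurable_fun; case: e => /= x; first exact: continuous_cos.
exact: continuous_sin.
Qed.

Lemma tame_phase e e' a x : nice e' a ->
  tame (mu S) (fun xi => phase e (dt x xi) * a xi).
Proof.
move=> /nice_tame ta; apply: (tame_le (K := 1) ta) => [|xi].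
  apply: measurable_funM; last by case: ta.
  by apply: measurable_phase; exact: measurable_dt.
by rewrite normrM; apply: ler_wpM2r => //; exact: phase_le1.
Qed.

Lemma tame_cophase e e' a x : nice e' a ->
  tame (mu S) (fun xi => cophase e (dt x xi) * a xi).
Proof.
move=> /nice_tame ta; apply: (tame_le (K := 1) ta) => [|xi].
  apply: measurable_funM; last by case: ta.
  by apply: measurable_cophase; exact: measurable_dt.
by rewrite normrM; apply: ler_wpM2r => //; exact: cophase_le1.
Qed.

(** The integrand is odd under [neg]: sine meets an even amplitude, cosine an odd one. This is why
    the encoded functions are real. *)
Lemma integral_cophase e a x : nice e a ->
  \int[mu S]_xi (cophase e (dt x xi) * a xi) = 0.
Proof.
move=> na; have tc := tame_cophase e x na.
suff : \int[mu S]_xi (cophase e (dt x xi) * a xi) =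
       - \int[mu S]_xi (cophase e (dt x xi) * a xi) by lra.
rewrite -{1}(integral_neg tc) -integral_tameN//; apply: eq_Rintegral => xi _.
rewrite (nice_par _ na) dt_neg.
by case: e {na tc} => /=; rewrite ?cosN ?sinN ?expr1 ?expr0; ring.
Qed.

(** The inverse Fourier transform of [camp e a], of which only the real part is kept; the imaginary
    part vanishes by [integral_cophase]. *)
Definition tr (e : bool) a x : R := fcst S * \int[mu S]_xi (phase e (dt x xi) * a xi).

Definition camp (e : bool) a : V -> R[i] :=
  fun xi => if e then 0 +i* a xi else a xi +i* 0.

Lemma has_fourier_tr e a : nice e a -> @has_fourier R E (tr e a) (camp e a).
Proof.
move=> na; have ta := nice_tame na; split.
  split; case: e {na} => /=.
  - exact: tame_integrable (tame0 _).
  - exact: tame_integrable.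
  - exact: tame_integrable.
  - exact: tame_integrable (tame0 _).
move=> x; rewrite /inv_fourier /cintegral.
have -> : \int[leb E]_xi complex.Re (cis (dot x xi) * camp e a xi) =
    \int[mu S]_xi (phase e (dt x xi) * a xi).
  apply: eq_Rintegral => xi _; rewrite /camp /cis -[dot _ _]/(dt x xi).
  by case: e {na} => /=; ring.
have -> : \int[leb E]_xi complex.Im (cis (dot x xi) * camp e a xi) =
    \int[mu S]_xi (cophase e (dt x xi) * a xi).
  apply: eq_Rintegral => xi _; rewrite /camp /cis -[dot _ _]/(dt x xi).
  by case: e {na} => /=; ring.
rewrite integral_cophase// /tr.
by apply/eqP; rewrite eq_complex /= !mul0r !mulr0 subr0 addr0 !eqxx.
Qed.

Lemma integral_add x f : tame (mu S) f ->
  \int[mu S]_xi f (sub x (neg xi)) = \int[mu S]_xi f xi.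
Proof. by move=> tf; rewrite (integral_neg (tame_sub x tf)) integral_reflect. Qed.

(** The sign left over when two prefactors i meet: the product is -1 times an even amplitude. *)
Definition sg (e e' : bool) : R := if e && e' then -1 else 1.

Lemma phaseD e e' s t : sg e e' * phase (e (+) e') (s + t) =
  phase e s * phase e' t - cophase e s * cophase e' t.
Proof. by case: e; case: e'; rewrite /sg /= ?cosD ?sinD; ring. Qed.

Lemma nice_bound e a : nice e a -> exists M r : R, [/\ 0 <= M, 0 <= r,
  forall xi, `|a xi| <= M & forall xi, a xi != 0 -> cube r xi].
Proof.
move=> [_ /bnd_normalize[M [r [M0 r0 H]]] _]; exists M, r.
by split=> // xi; have [|Ha [_ Hb]] := H 0 xi; rewrite ?lexx.
Qed.

Lemma integral_cube r : \int[mu S]_xi \1_(cube r) xi = fine (mu S (cube r)) :> R.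
Proof. by rewrite /Rintegral integral_indic ?setIT//; exact: measurable_cube. Qed.

(** The convolution theorem: exchange the two integrals, translate the first variable by the second
    and expand the phase of the sum. The product of the two cophases integrates to zero. *)
Lemma tr_mul e e' a b x : nice e a -> nice e' b ->
  tr e a x * tr e' b x = tr (e (+) e') (fun xi => sg e e' * convolve a b xi) x.
Proof.
move=> na nb; have ta := nice_tame na; have tb := nice_tame nb.
pose F (q : V * V) := sg e e' * phase (e (+) e') (dt x q.1) *
  (a q.2 * b (sub q.1 q.2)).
have sg1 : `|sg e e'| = 1 by rewrite /sg; case: ifP; rewrite ?normrN1 ?normr1.
have [M [r [M0 r0 Ma ra]]] := nice_bound na.
have [M' [r' [M0' r0' Mb rb]]] := nice_bound nb.
have FM xi eta : `|F (xi, eta)| <= M * M' * (\1_(cube (r + r')) xi * \1_(cube r) eta).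
  rewrite /F /= !normrM sg1 mul1r.
  have [->|a0] := eqVneq (a eta) 0; first by rewrite normr0 mul0r mulr0 !mulr_ge0.
  have [->|b0] := eqVneq (b (sub xi eta)) 0.
    by rewrite normr0 !mulr0 !mulr_ge0.
  have ca := ra _ a0; have cb := cube_sub ca (rb _ b0).
  rewrite !indicE !mem_set// !mulr1.
  apply: le_trans (ler_wpM2r _ (phase_le1 _ _)) _; first by rewrite mulr_ge0.
  by rewrite mul1r; exact: ler_pM.
have mF : measurable_fun setT F.
  apply: measurable_funM.
    apply: measurable_funM; first exact: measurable_cst.
    apply: measurable_phase; apply: (measurableT_comp (measurable_dt x)).
    exact: measurable_fst.
  apply: measurable_funM.
    by apply: (measurableT_comp (proj1 ta)); exact: measurable_snd.
  by apply: (measurableT_comp (proj1 tb)); exact: measurable_sub.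
have fub := Rfubini mF (measurable_cube S (r + r')) (@mu_cube_fin R S _)
  (measurable_cube S r) (@mu_cube_fin R S _) FM.
have tF xi : tame (mu S) (fun eta => a eta * b (sub xi eta)).
  by apply: tame_conv_integrand ta tb _; exists M'.
have -> : tr (e (+) e') (fun xi => sg e e' * convolve a b xi) x =
    fcst S * (fcst S * \int[mu S]_xi \int[mu S]_eta F (xi, eta)).
  rewrite /tr; congr (_ * _); rewrite -integral_tameZ; last first.
    apply: (@tame_of_bound _ _ _ _ _
       (M * M' * fine (mu S (cube r))) (cube (r + r'))).
    - exact: measurable_Rintegral mF.
    - exact: measurable_cube.
    - exact: mu_cube_fin.
    - move=> xi; have -> : M * M' * fine (mu S (cube r)) * \1_(cube (r + r')) xi =
         \int[mu S]_eta (M * M' * (\1_(cube (r + r')) xi * \1_(cube r) eta)).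
        under eq_Rintegral do rewrite mulrA.
        rewrite integral_tameZ.
          by rewrite integral_cube; ring.
        apply: (@tame_of_bound _ _ _ _ _ 1 (cube r)).
        + by apply: measurable_indic; exact: measurable_cube.
        + exact: measurable_cube.
        + exact: mu_cube_fin.
        + by move=> eta; rewrite mul1r ger0_norm.
      apply: le_norm_integral_tame => [||eta].
      - have := tameZ (sg e e' * phase (e (+) e') (dt x xi)) (tF xi); exact.
      - apply: (@tame_of_bound _ _ _ _ _ (M * M') (cube r)).
        + apply: measurable_funM; first exact: measurable_cst.
          apply: measurable_funM; first exact: measurable_cst.
          by apply: measurable_indic; exact: measurable_cube.
        + exact: measurable_cube.
        + exact: mu_cube_fin.
        + move=> eta; rewrite ger0_norm ?mulr_ge0//; apply: ler_wpM2l.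
            exact: mulr_ge0.
          by rewrite !indicE; case: (xi \in _); rewrite ?mul1r ?mul0r.
      - exact: FM.
  apply: eq_Rintegral => xi _; rewrite /F /= /convolve.
  by rewrite integral_tameZ//; ring.
rewrite fub.
have -> : \int[mu S]_eta \int[mu S]_xi F (xi, eta) =
   \int[mu S]_eta (phase e (dt x eta) * a eta *
     \int[mu S]_xi (phase e' (dt x xi) * b xi)).
  apply: eq_Rintegral => eta _.
  have tp := tame_phase e' x nb; have tc := tame_cophase e' x nb.
  transitivity (\int[mu S]_xi (phase e (dt x eta) * a eta *
     (phase e' (dt x xi) * b xi) - cophase e (dt x eta) * a eta *
     (cophase e' (dt x xi) * b xi))); last first.
    rewrite integral_tameB; [|exact: tameZ..].
    by rewrite !integral_tameZ// integral_cophase// mulr0 subr0.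
  rewrite -(integral_add eta); last first.
    apply: (@tame_of_bound _ _ _ _ _ (M * M') (cube (r + r'))).
    - by apply: (measurableT_comp mF); exact: measurable_pair2.
    - exact: measurable_cube.
    - exact: mu_cube_fin.
    - move=> xi; apply: le_trans (FM xi eta) _; apply: ler_wpM2l.
        exact: mulr_ge0.
      by rewrite !indicE; case: (eta \in _); rewrite ?mulr1 ?mulr0.
  apply: eq_Rintegral => xi _; rewrite /F /=.
  have -> : dt x (sub eta (neg xi)) = dt x eta + dt x xi.
    by rewrite dt_sub dt_neg opprK.
  have -> : sub (sub eta (neg xi)) eta = xi.
    by apply: co_inj => j; rewrite !(co_sub, co_neg); ring.
  by rewrite phaseD; ring.
rewrite RintegralZr//; last exact: tame_integrable (tame_phase e x na).
by rewrite /tr; ring.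
Qed.

Lemma trD e a b x : nice e a -> nice e b ->
  tr e (fun xi => a xi + b xi) x = tr e a x + tr e b x.
Proof.
move=> na nb; rewrite /tr -mulrDr; congr (_ * _).
rewrite -integral_tameD; [|exact: tame_phase na|exact: tame_phase nb].
by apply: eq_Rintegral => xi _; rewrite mulrDr.
Qed.

Lemma trZ e c a x : nice e a -> tr e (fun xi => c * a xi) x = c * tr e a x.
Proof.
move=> na; rewrite /tr mulrCA; congr (_ * _).
rewrite -integral_tameZ; last exact: tame_phase na.
by apply: eq_Rintegral => xi _; rewrite mulrCA.
Qed.

Lemma trN e a x : nice e a -> tr e (fun xi => - a xi) x = - tr e a x.
Proof.
by move=> na; rewrite -mulN1r -trZ//; congr tr; apply/funext => xi; rewrite mulN1r.
Qed.

Lemma tr0 e x : tr e (fun=> 0) x = 0.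
Proof.
by rewrite /tr; under eq_Rintegral do rewrite mulr0; rewrite Rintegral_cst// mul0r mulr0.
Qed.

Lemma tr_sum e (I : Type) (r : seq I) (F : I -> V -> R) x :
  (forall i, nice e (F i)) ->
  tr e (fun xi => \sum_(i <- r) F i xi) x = \sum_(i <- r) tr e (F i) x.
Proof.
move=> nF; elim: r => [|i r IH].
  by rewrite big_nil -[RHS](tr0 e x); congr tr; apply/funext => xi; rewrite big_nil.
rewrite big_cons -IH -trD//; last exact: nice_sum.
by congr tr; apply/funext => xi; rewrite big_cons.
Qed.

Lemma absD_tr e a : nice e a ->
  @is_absD R E (tr e a) (tr e (fun xi => nrm xi * a xi)).
Proof.
move=> na; exists (camp e a); split; first exact: has_fourier_tr.
have := has_fourier_tr (nice_nrm na); congr (has_fourier _ _).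
apply/funext => xi; rewrite /camp -[enorm xi]/(nrm xi).
by case: e {na}; apply/eqP; rewrite eq_complex /= !mul0r !mulr0 ?subr0 ?addr0 !eqxx.
Qed.

Lemma laplacian_tr e a : nice e a ->
  @is_laplacian R E (tr e a) (tr e (fun xi => - (nrm xi * (nrm xi * a xi)))).
Proof.
move=> na; exists (camp e a); split; first exact: has_fourier_tr.
have := has_fourier_tr (niceN (nice_nrm (nice_nrm na))); congr (has_fourier _ _).
apply/funext => xi; rewrite /camp -[enorm xi]/(nrm xi).
by case: e {na}; apply/eqP; rewrite eq_complex /= !mul0r !mulr0 ?subr0 ?addr0;
  rewrite ?eqxx/= ?andbT; apply/eqP; ring.
Qed.

Lemma partial_tr_even j a : nice false a ->
  @is_partial R E j (tr false a) (tr true (fun xi => co xi j * a xi)).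
Proof.
move=> na; exists (camp false a); split; first exact: has_fourier_tr.
have := has_fourier_tr (nice_co j na); congr (has_fourier _ _).
apply/funext => xi; rewrite /camp.
by apply/eqP; rewrite eq_complex /= !mul0r !mulr0 ?subr0 ?add0r !eqxx.
Qed.

Lemma partial_tr_odd j a : nice true a ->
  @is_partial R E j (tr true a) (tr false (fun xi => - (co xi j * a xi))).
Proof.
move=> na; exists (camp true a); split; first exact: has_fourier_tr.
have := has_fourier_tr (niceN (nice_co j na)); congr (has_fourier _ _).
apply/funext => xi; rewrite /camp.
by apply/eqP; rewrite eq_complex /= !mul0r !mulr0 ?sub0r ?add0r !eqxx.
Qed.

End Transform.

(** * The linear evolution and the Duhamel formula *)

Section Evolution.
Local Open Scope complex_scope.
Context {R : realType} (S : freq_space R) (g tau : R).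
Local Notation V := (freq S).
Local Notation RT := (measurableTypeR R).
Local Notation nrm := (@nrm R S).
Local Notation dt := (@dt R S).
Local Notation E := (euc S).
Local Notation leb1 := (@lebesgue_measure R).
Implicit Types (x y xi eta : V) (a b f : V -> R).

Definition om xi : R := @omega R E g tau xi.

(** The value at w = 0 is the limit of sin (t w) / w, as in [expL]. *)
Definition sinc (t w : R) : R := if w == 0 then t else sin (t * w) / w.

Definition ecos (t : R) xi : R := cos (t * om xi).
Definition eup (t : R) xi : R := sinc t (om xi) * nrm xi.
Definition elow (t : R) xi : R := - (sinc t (om xi) * (tau * nrm xi ^+ 2 + g)).

Lemma expL00 t xi : @expL R E g tau t xi 0 0 = ecos t xi.
Proof. by rewrite !mxE /= mulr1n mulr0 addr0. Qed.

Lemma expL01 t xi : @expL R E g tau t xi 0 1 = eup t xi.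
Proof. by rewrite !mxE /= mulr0n add0r. Qed.

Lemma expL10 t xi : @expL R E g tau t xi 1 0 = elow t xi.
Proof. by rewrite !mxE /= mulr0n add0r -opprD mulrN. Qed.

Lemma expL11 t xi : @expL R E g tau t xi 1 1 = ecos t xi.
Proof. by rewrite !mxE /= mulr1n mulr0 addr0. Qed.

Lemma sinc_le t w : `|sinc t w| <= `|t|.
Proof.
rewrite /sinc; case: eqVneq => // w0.
by rewrite normrM normfV ler_pdivrMr ?normr_gt0// -normrM abs_sin_le.
Qed.

Lemma om_neg xi : om (neg xi) = om xi.
Proof.
by rewrite /om /omega -[@enorm R E (neg xi)]/(nrm (neg xi)) nrm_neg.
Qed.

Lemma om_ge0 xi : 0 <= om xi. Proof. exact: sqrtr_ge0. Qed.

Lemma measurable_om : measurable_fun setT om.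
Proof.
apply: (@measurableT_comp _ _ _ _ _ _ (@Num.sqrt R)).
  by apply: continuous_measurable_fun; exact: sqrt_continuous.
have mn := measurable_nrm (S := S).
apply: measurable_funM; first exact: mn.
apply: measurable_funD; first exact: measurable_cst.
apply: measurable_funM; first exact: measurable_cst.
exact: measurable_funX.
Qed.

Lemma measurable_sinc : measurable_fun setT (fun q : RT * V => sinc q.1 (om q.2)).
Proof.
have mo : measurable_fun setT (fun q : RT * V => om q.2).
  by apply: (measurableT_comp measurable_om); exact: measurable_snd.
have m1 : measurable_fun setT (fun q : RT * V => q.1 : R) by exact: measurable_fst.
apply: measurable_fun_ifT => //.
- by apply: measurable_fun_eqr => //; exact: measurable_cst.
- apply: measurable_funM.
    apply: (@measurableT_comp _ _ _ _ _ _ (@sin R)).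
      by apply: continuous_measurable_fun; exact: continuous_sin.
    exact: measurable_funM.
  (* On nonnegative reals the inverse is the power -1, also at 0, and powers are measurable. *)
  have -> : (fun q : RT * V => (om q.2)^-1) =
      (fun w : R => w `^ (-1)) \o (fun q : RT * V => om q.2).
    by apply/funext => q /=; rewrite powR_inv1// om_ge0.
  by apply: measurableT_comp mo; exact: measurable_powR.
Qed.

Lemma mult_ecos T : mult T false ecos.
Proof.
split=> [|r|t xi]; last by rewrite expr0 mul1r /ecos om_neg.
- apply: (@measurableT_comp _ _ _ _ _ _ (@cos R)).
    by apply: continuous_measurable_fun; exact: continuous_cos.
  apply: measurable_funM; first exact: measurable_fst.
  by apply: (measurableT_comp measurable_om); exact: measurable_snd.
- by exists 1 => t xi _ _; exact: cos_max.
Qed.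

Lemma mult_sinc T : mult T false (fun t xi => sinc t (om xi)).
Proof.
split=> [|r|t xi]; last by rewrite expr0 mul1r om_neg.
- exact: measurable_sinc.
- exists T => t xi /andP[t0 tT] _; apply: le_trans (sinc_le _ _) _.
  by rewrite ger0_norm.
Qed.

Lemma mult_eup T : mult T false eup.
Proof. exact: multM (mult_sinc T) (mult_nrm S T). Qed.

Lemma mult_elow T : mult T false elow.
Proof.
have m2 := multM (mult_cst S T tau) (multM (mult_nrm S T) (mult_nrm S T)).
have := multM (mult_cst S T (-1)) (multM (mult_sinc T) (multD m2 (mult_cst S T g))).
congr (mult _ _ _); apply/funext => t; apply/funext => xi.
by rewrite /elow mulN1r expr2.
Qed.

Lemma niceM e a T (m : R -> V -> R) t : mult T false m -> 0 <= t <= T ->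
  nice e a -> nice e (fun xi => m t xi * a xi).
Proof. by move=> mm tT na; rewrite -[e]addFb; apply: fam_mult (mult_slice mm tT 0) na. Qed.

Lemma evolution_tr t a b : 0 <= t -> nice false a -> nice false b ->
  @is_evolution R E g tau t (tr false a) (tr false b)
    (tr false (fun xi => ecos t xi * a xi + eup t xi * b xi))
    (tr false (fun xi => elow t xi * a xi + ecos t xi * b xi)).
Proof.
move=> t0 na nb; exists (camp false a), (camp false b).
have tt : 0 <= t <= t by rewrite t0 lexx.
split; try exact: has_fourier_tr.
- have := has_fourier_tr (niceD (niceM (mult_ecos t) tt na) (niceM (mult_eup t) tt nb)).
  congr (has_fourier _ _); apply/funext => xi; rewrite expL00 expL01 /camp.
  by apply/eqP; rewrite eq_complex /= !mul0r !mulr0 !subr0 !addr0 !eqxx.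
- have := has_fourier_tr (niceD (niceM (mult_elow t) tt na) (niceM (mult_ecos t) tt nb)).
  congr (has_fourier _ _); apply/funext => xi; rewrite expL10 expL11 /camp.
  by apply/eqP; rewrite eq_complex /= !mul0r !mulr0 !subr0 !addr0 !eqxx.
Qed.

Lemma lebesgue_itv0 (t : R) : 0 <= t -> leb1 `[0, t] = t%:E.
Proof.
move=> t0; rewrite lebesgue_measure_itv/= lte_fin; case: ltP => [_|tle].
  by rewrite sube0.
by have -> : t = 0 by apply/eqP; rewrite eq_le t0 tle.
Qed.

Lemma lebesgue_itv0_fin (t : R) : (leb1 `[0%R, t]%classic < +oo)%E.
Proof.
have [t0|t0] := leP 0 t; first by rewrite lebesgue_itv0// ltry.
by rewrite set_itv_ge ?measure0// bnd_simp -ltNge.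
Qed.

(** Fubini between time and frequency: integrating the functions in time, point by point, amounts to
    integrating their amplitudes. *)
Lemma tr_integral e (G : RT * V -> R) M t r x :
  measurable_fun setT G -> 0 <= M ->
  (forall s xi, `|G (s, xi)| <= M * (\1_`[0, t]%classic s * \1_(cube r) xi)) ->
  leb1.-integrable setT (EFin \o (fun s => tr e (fun xi => G (s, xi)) x)) /\
  tr e (fun xi => \int[leb1]_s G (s, xi)) x = \int[leb1]_s tr e (fun xi => G (s, xi)) x.
Proof.
move=> mG M0 GM.
pose F (q : V * RT) := phase e (dt x q.1) * G (q.2, q.1).
have mF : measurable_fun setT F.
  apply: measurable_funM.
    apply: measurable_phase; apply: (measurableT_comp (measurable_dt x)).
    exact: measurable_fst.
  apply: (measurableT_comp mG (g := fun q : V * RT => (q.2, q.1))).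
  by apply: measurable_fun_pair; [exact: measurable_snd|exact: measurable_fst].
have FM xi s : `|F (xi, s)| <= M * (\1_(cube r) xi * \1_`[0, t]%classic s).
  rewrite /F /= normrM [leRHS](_ : _ = 1 * (M * (\1_`[0, t]%classic s * \1_(cube r) xi))); last by ring.
  by apply: ler_pM => //; exact: phase_le1.
have mF' : measurable_fun setT (fun q : RT * V => F (q.2, q.1)).
  apply: (measurableT_comp mF (g := fun q : RT * V => (q.2, q.1))).
  by apply: measurable_fun_pair; [exact: measurable_snd|exact: measurable_fst].
have fub := Rfubini mF (measurable_cube S r) (@mu_cube_fin R S r)
   (measurable_itv `[0, t]) (lebesgue_itv0_fin t) FM.
have tI xi : tame leb1 (fun s => G (s, xi)).
  apply: (@tame_of_bound R _ RT leb1 _ M `[0, t]%classic) => //.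
  - by apply: (measurableT_comp mG); exact: measurable_pair2.
  - exact: lebesgue_itv0_fin.
  - move=> s; apply: le_trans (GM s xi) _; apply: ler_wpM2l => //.
    by rewrite !indicE; case: (xi \in _); rewrite ?mulr1 ?mulr0.
have tc : tame (mu S) (\1_(cube r) : V -> R).
  apply: (@tame_of_bound _ _ _ _ _ 1 (cube r)).
  - by apply: measurable_indic; exact: measurable_cube.
  - exact: measurable_cube.
  - exact: mu_cube_fin.
  - by move=> eta; rewrite mul1r ger0_norm.
have tIF : tame leb1 (fun s => \int[mu S]_xi F (xi, s)).
  apply: (@tame_of_bound R _ RT leb1 _ (M * fine (mu S (cube r))) `[0, t]%classic) => //.
  - exact: (measurable_Rintegral (mu S) mF').
  - exact: lebesgue_itv0_fin.
  - move=> s; have -> : M * fine (mu S (cube r)) * \1_`[0, t]%classic s =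
        \int[mu S]_xi (M * \1_`[0, t]%classic s * \1_(cube r) xi).
      by rewrite integral_tameZ// integral_cube; ring.
    apply: le_norm_integral_tame => [||xi].
    + apply: (@tame_of_bound _ _ _ _ _ M (cube r)).
      * by apply: (measurableT_comp mF); exact: measurable_pair2.
      * exact: measurable_cube.
      * exact: mu_cube_fin.
      * move=> xi; apply: le_trans (FM xi s) _; apply: ler_wpM2l => //.
        by rewrite !indicE; case: (s \in _); rewrite ?mulr1 ?mulr0.
    + exact: tameZ.
    + by apply: le_trans (FM xi s) _; rewrite mulrA mulrAC.
split; first exact: tame_integrable (tameZ (fcst S) tIF).
rewrite [RHS](_ : _ = fcst S * \int[leb1]_s \int[mu S]_xi F (xi, s)); last first.
  by apply: RintegralZl => //; exact: tame_integrable.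
rewrite -fub /tr; congr (_ * _); apply: eq_Rintegral => xi _.
by rewrite -integral_tameZ.
Qed.

(** * The Duhamel integral at the level of amplitudes *)

Section Duhamel.
Local Open Scope complex_scope.
Variables (T : R) (K0 K1 F1 F2 : R -> V -> R).
Hypotheses (mK0 : mult T false K0) (mK1 : mult T false K1).
Hypotheses (fF1 : fam T false F1) (fF2 : fam T false F2).

(** The indicator is part of the integrand so that the domain of integration does not depend on t,
    and joint measurability in (t, xi) follows from that of one function. *)
Definition duh_integrand (t s : R) xi : R :=
  \1_`[0, t]%classic s * (K0 (t - s) xi * F1 s xi + K1 (t - s) xi * F2 s xi).

Definition duh (t : R) xi : R := \int[leb1]_s duh_integrand t s xi.

Lemma measurable_duh_integrand :
  measurable_fun setT (fun q : (RT * V) * RT => duh_integrand q.1.1 q.2 q.1.2).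
Proof.
have m11 : measurable_fun setT (fun q : (RT * V) * RT => q.1.1).
  by apply: measurableT_comp; exact: measurable_fst.
have m12 : measurable_fun setT (fun q : (RT * V) * RT => q.1.2).
  by apply: measurableT_comp; [exact: measurable_snd|exact: measurable_fst].
have m2 : measurable_fun setT (fun q : (RT * V) * RT => q.2).
  exact: measurable_snd.
have md : measurable_fun setT (fun q : (RT * V) * RT => q.1.1 - q.2 : RT).
  exact: (@measurable_funB _ _ R _ (fun q : (RT * V) * RT => q.1.1) (fun q => q.2)).
have comp (K : R -> V -> R) : mult T false K ->
    measurable_fun setT (fun q : (RT * V) * RT => K (q.1.1 - q.2) q.1.2).
  move=> [mK _ _].
  apply: (measurableT_comp mK (g := fun q : (RT * V) * RT => (q.1.1 - q.2 : RT, q.1.2))).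
  exact: measurable_fun_pair.
have comp' (F : R -> V -> R) : fam T false F ->
    measurable_fun setT (fun q : (RT * V) * RT => F q.2 q.1.2).
  move=> [mF _ _].
  apply: (measurableT_comp mF (g := fun q : (RT * V) * RT => (q.2, q.1.2))).
  exact: measurable_fun_pair.
apply: measurable_funM; last first.
  by apply: measurable_funD; apply: measurable_funM; auto.
pose A := [set q : (RT * V) * RT | q.2 \in `[0, q.1.1]].
have -> : (fun q : (RT * V) * RT => \1_`[0, q.1.1]%classic q.2 : R) = \1_A.
  by apply/funext => q; rewrite !indicE /A; congr (_%:R); congr (nat_of_bool _);
    apply/idP/idP => /set_mem; move=> h; apply/mem_set.
apply: measurable_indic.
have -> : A = (fun q : (RT * V) * RT => q.2 : R) @^-1` `[0, +oo[%classic `&`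
     (fun q : (RT * V) * RT => q.1.1 - q.2 : R) @^-1` `[0, +oo[%classic.
  apply/seteqP; split => q; rewrite /A /= !in_itv /= !andbT subr_ge0.
    by move=> /andP[].
  by move=> [-> ->].
apply: measurableI; rewrite -[X in measurable X]setTI.
- by apply: m2 => //; exact: measurable_itv.
- by apply: md => //; exact: measurable_itv.
Qed.

Lemma duh_integrand_bound : exists M r : R, 0 <= M /\
  forall t s xi, 0 <= t <= T ->
  `|duh_integrand t s xi| <= M * (\1_`[0, t]%classic s * \1_(cube r) xi).
Proof.
have [_ /bnd_normalize[M1 [r1 [M10 r10 H1]]] _] := fF1.
have [_ /bnd_normalize[M2 [r2 [M20 r20 H2]]] _] := fF2.
have [_ b0 _] := mK0; have [_ b1 _] := mK1.
have [k0 hk0] := b0 r1; have [k1 hk1] := b1 r2.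
exists (`|k0| * M1 + `|k1| * M2), (r1 + r2); split.
  by rewrite addr_ge0// mulr_ge0.
move=> t s xi /andP[t0 tT]; rewrite /duh_integrand normrM.
rewrite [`|\1_ _ _|]ger0_norm// [leRHS]mulrCA.
have [sI|nsI] := boolP (s \in (`[0, t]%classic : set R)); last first.
  by rewrite indicE (negbTE nsI) !mul0r.
apply: ler_wpM2l => //.
have : s \in `[0, t] by have := set_mem sI.
rewrite in_itv /= => /andP[s0 st].
have sT : 0 <= s <= T by rewrite s0 (le_trans st).
have tsT : 0 <= t - s <= T by rewrite subr_ge0 st /=; lra.
have [B1 [_ S1]] := H1 s xi sT; have [B2 [_ S2]] := H2 s xi sT.
have cub : F1 s xi != 0 \/ F2 s xi != 0 -> cube (r1 + r2) xi.
  by move=> [/S1|/S2] c j; have := c j; move: r10 r20; lra.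
have part1 : `|K0 (t - s) xi * F1 s xi| <= `|k0| * M1.
  have [->|/S1 c] := eqVneq (F1 s xi) 0; first by rewrite mulr0 normr0 mulr_ge0.
  by rewrite normrM; apply: ler_pM => //; exact: le_trans (hk0 _ _ tsT c) (ler_norm _).
have part2 : `|K1 (t - s) xi * F2 s xi| <= `|k1| * M2.
  have [->|/S2 c] := eqVneq (F2 s xi) 0; first by rewrite mulr0 normr0 mulr_ge0.
  by rewrite normrM; apply: ler_pM => //; exact: le_trans (hk1 _ _ tsT c) (ler_norm _).
have [F10|F10] := eqVneq (F1 s xi) 0; last first.
  rewrite indicE mem_set ?mulr1; last by apply: cub; left.
  by apply: le_trans (ler_normD _ _) _; exact: lerD.
have [F20|F20] := eqVneq (F2 s xi) 0; last first.
  rewrite indicE mem_set ?mulr1; last by apply: cub; right.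
  by apply: le_trans (ler_normD _ _) _; exact: lerD.
by rewrite F10 F20 !mulr0 addr0 normr0 mulr_ge0// addr_ge0// mulr_ge0.
Qed.

Lemma tame_duh_integrand t xi : 0 <= t <= T ->
  tame leb1 (fun s => duh_integrand t s xi).
Proof.
move=> tT; have [M [r [M0 H]]] := duh_integrand_bound.
apply: (@tame_of_bound R _ RT leb1 _ M `[0, t]%classic) => //.
- apply: (measurableT_comp measurable_duh_integrand (g := fun s : RT => ((t : RT, xi), s))).
  exact: measurable_pair1.
- exact: lebesgue_itv0_fin.
- move=> s; apply: le_trans (H t s xi tT) _; apply: ler_wpM2l => //.
  by rewrite !indicE; case: (xi \in _); rewrite ?mulr1 ?mulr0.
Qed.

Lemma tame_itv0 t : tame leb1 (\1_`[0, t]%classic : R -> R).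
Proof.
apply: (@tame_of_bound R _ RT leb1 _ 1 `[0, t]%classic) => //.
- exact: lebesgue_itv0_fin.
- by move=> s; rewrite mul1r ger0_norm.
Qed.

Lemma integral_itv0 t : 0 <= t -> \int[leb1]_s (\1_`[0, t]%classic s) = t.
Proof.
move=> t0; rewrite /Rintegral integral_indic.
- by rewrite setIT; exact: (congr1 fine (lebesgue_itv0 t0)).
- exact: measurableT.
- exact: measurable_itv.
Qed.

Lemma fam_duh : fam T false duh.
Proof.
have [M [r [M0 H]]] := duh_integrand_bound.
split=> [||t xi tT].
- exact: (measurable_Rintegral leb1 measurable_duh_integrand).
- exists (M * T), r => t xi tT.
  apply: (@le_trans _ _ (M * t * \1_(cube r) xi)); last first.
    by apply: ler_wpM2r => //; apply: ler_wpM2l => //; case/andP: tT.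
  have -> : M * t * \1_(cube r) xi =
      \int[leb1]_s (M * \1_(cube r) xi * \1_`[0, t]%classic s).
    rewrite integral_tameZ; last exact: tame_itv0.
    by rewrite integral_itv0; [ring|case/andP: tT].
  apply: le_norm_integral_tame => [||s].
  + exact: tame_duh_integrand.
  + by apply: tameZ; exact: tame_itv0.
  + by apply: le_trans (H t s xi tT) _; rewrite mulrA mulrAC.
- rewrite expr0 mul1r; apply: eq_Rintegral => s _; rewrite /duh_integrand.
  have [sI|nsI] := boolP (s \in (`[0, t]%classic : set R)); last first.
    by rewrite indicE (negbTE nsI) !mul0r.
  have : s \in `[0, t] by have := set_mem sI.
  rewrite in_itv /= => /andP[s0 st].
  have sT : 0 <= s <= T by rewrite s0 (le_trans st)//; case/andP: tT.
  rewrite (mult_par mK0) (mult_par mK1) (fam_par fF1)// (fam_par fF2)//.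
  by rewrite expr0 !mul1r.
Qed.

Lemma tr_duh t x : 0 <= t <= T ->
  let v s := tr false (fun xi => K0 (t - s) xi * F1 s xi + K1 (t - s) xi * F2 s xi) x in
  leb1.-integrable `[0, t] (EFin \o v) /\
  tr false (duh t) x = \int[leb1]_(s in `[0, t]) v s.
Proof.
move=> tT v; have [M [r [M0 H]]] := duh_integrand_bound.
pose G (q : RT * V) := duh_integrand t q.1 q.2.
have mG : measurable_fun setT G.
  apply: (measurableT_comp measurable_duh_integrand
            (g := fun q : RT * V => ((t : RT, q.2), q.1))).
  apply: measurable_fun_pair; last exact: measurable_fst.
  by apply: measurable_fun_pair; [exact: measurable_cst|exact: measurable_snd].
have HG s xi : `|G (s, xi)| <= M * (\1_`[0, t]%classic s * \1_(cube r) xi).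
  exact: H.
have [I1 I2] := tr_integral false x mG M0 HG.
have vG : (fun s => tr false (fun xi => G (s, xi)) x) = v \_ `[0, t].
  apply/funext => s; rewrite /G /duh_integrand /= patchE indicE.
  case: ifP => _; first by congr tr; apply/funext => xi; rewrite mul1r.
  by rewrite -[RHS]/(0 : R) -(tr0 false x); congr tr; apply/funext => xi; rewrite mul0r.
split.
  apply/integrable_mkcond; first exact: measurable_itv.
  by rewrite restrict_EFin -vG.
by rewrite Rintegral_mkcond -vG -I2.
Qed.

End Duhamel.

Lemma duhamel_tr T t (F1 F2 : R -> V -> R) : fam T false F1 -> fam T false F2 ->
  0 <= t <= T ->
  @is_duhamel R E g tau t (fun s => tr false (F1 s)) (fun s => tr false (F2 s))
    (tr false (duh ecos eup F1 F2 t)) (tr false (duh elow ecos F1 F2 t)).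
Proof.
move=> fF1 fF2 tT.
exists (fun s => tr false (fun xi => ecos (t - s) xi * F1 s xi + eup (t - s) xi * F2 s xi)).
exists (fun s => tr false (fun xi => elow (t - s) xi * F1 s xi + ecos (t - s) xi * F2 s xi)).
split=> [s /andP[s0 st]|x].
  have sT : 0 <= s <= T by rewrite s0 (le_trans st)//; case/andP: tT.
  apply: evolution_tr; first by rewrite subr_ge0.
    exact: nice_slice fF1 sT.
  exact: nice_slice fF2 sT.
have [I1 E1] := tr_duh (mult_ecos T) (mult_eup T) fF1 fF2 x tT.
have [I2 E2] := tr_duh (mult_elow T) (mult_ecos T) fF1 fF2 x tT.
split; [exact: I1|exact: I2|exact: E1|exact: E2].
Qed.

End Evolution.

(** * The third variation in terms of amplitudes *)

Section Variation.
Local Open Scope complex_scope.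
Context {R : realType} (S : freq_space R).
Local Notation V := (freq S).
Local Notation nrm := (@nrm R S).
Local Notation E := (euc S).
Local Notation J := 'I_(codim S).+1.
Implicit Types (x y xi eta : V) (a b h p : V -> R) (j k : J).

Definition mulN a : V -> R := fun xi => nrm xi * a xi.
Definition mulC j a : V -> R := fun xi => co xi j * a xi.

(** [ampQ], [ampE], [ampK], [ampG], [ampP] are the amplitudes of div(h grad p) + |D|(h |D|p), of
    |D|h |D|p - grad h . grad p, of div(grad h |grad h|^2), of Lap(h^2 |D|p) + |D|(h^2 Lap p) + 2
    |D|(h |D|(h |D|p)), and of |D|p (h Lap p + |D|(h |D|p)). Each partial derivative brings a factor
    i: two of them turn the sign in [ampQ] and [ampE], four of them leave a plus in [ampK]. *)
Definition ampQ h p : V -> R := fun xi =>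
  mulN (convolve h (mulN p)) xi - \sum_j mulC j (convolve h (mulC j p)) xi.

Definition ampE h p : V -> R := fun xi =>
  convolve (mulN h) (mulN p) xi + \sum_j convolve (mulC j h) (mulC j p) xi.

Definition ampK h : V -> R := fun xi =>
  \sum_j mulC j (convolve (mulC j h)
    (fun eta => \sum_k convolve (mulC k h) (mulC k h) eta)) xi.

Definition ampG h p : V -> R := fun xi =>
  2 * mulN (convolve h (mulN (convolve h (mulN p)))) xi
  - mulN (mulN (convolve h (convolve h (mulN p)))) xi
  - mulN (convolve h (convolve h (mulN (mulN p)))) xi.

Definition ampP h p : V -> R :=
  convolve (mulN p) (fun eta => mulN (convolve h (mulN p)) eta -
                                convolve h (mulN (mulN p)) eta).

Lemma nice_bounded e a : nice e a -> exists M, forall xi, `|a xi| <= M.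
Proof. by move=> /nice_bound[M [r [_ _ H _]]]; exists M. Qed.

Lemma nice_tame_conv e e' a b xi : nice e a -> nice e' b ->
  tame (mu S) (fun eta => a eta * b (sub xi eta)).
Proof.
move=> na nb; apply: tame_conv_integrand.
- exact: nice_tame na.
- exact: nice_tame nb.
- exact: nice_bounded nb.
Qed.

Lemma convolveNr e e' a b : nice e a -> nice e' b ->
  convolve a (fun eta => - b eta) = fun xi => - convolve a b xi.
Proof.
move=> na nb; apply/funext => xi; rewrite /convolve -mulrN; congr (_ * _).
rewrite -integral_tameN; last exact: nice_tame_conv na nb.
by apply: eq_Rintegral => eta _; rewrite mulrN.
Qed.

Lemma tr_mul_even e a b : nice false a -> nice e b ->
  tr false a \* tr e b = tr e (convolve a b).
Proof.
move=> na nb; apply/funext => x /=; rewrite (tr_mul x na nb) addFb.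
by congr tr; apply/funext => xi; rewrite mul1r.
Qed.

Lemma tr_mul_odd a b : nice true a -> nice true b ->
  tr true a \* tr true b = tr false (fun xi => - convolve a b xi).
Proof.
move=> na nb; apply/funext => x /=; rewrite (tr_mul x na nb).
by congr tr; apply/funext => xi; rewrite mulN1r.
Qed.

Lemma tr_mul_odd_even a b : nice true a -> nice false b ->
  tr true a \* tr false b = tr true (convolve a b).
Proof.
move=> na nb; apply/funext => x /=; rewrite (tr_mul x na nb).
by congr tr; apply/funext => xi; rewrite mul1r.
Qed.

Lemma nice_mulN e a : nice e a -> nice e (mulN a). Proof. exact: nice_nrm. Qed.

Lemma nice_mulC e j a : nice e a -> nice (~~ e) (mulC j a).
Proof. exact: nice_co. Qed.

Lemma niceB e a b : nice e a -> nice e b -> nice e (fun xi => a xi - b xi).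
Proof. by move=> na /niceN; exact: niceD. Qed.

Lemma niceC e a b : nice false a -> nice e b -> nice e (convolve a b).
Proof. by move=> na nb; rewrite -[e]addFb; exact: nice_conv. Qed.

Lemma niceC' a b : nice true a -> nice true b -> nice false (convolve a b).
Proof. by move=> na nb; exact: (nice_conv na nb). Qed.

Lemma nice_ampQ h p : nice false h -> nice false p -> nice false (ampQ h p).
Proof.
move=> nh np; apply: niceB; first by apply/nice_mulN/niceC => //; exact: nice_mulN.
apply: nice_sum => j; rewrite -[false]/(~~ true); apply: nice_mulC; apply: niceC => //.
exact: (nice_mulC j np).
Qed.

Lemma nice_ampE h p : nice false h -> nice false p -> nice false (ampE h p).
Proof.
move=> nh np; apply: niceD; first by apply: niceC; exact: nice_mulN.
apply: nice_sum => j; apply: niceC'; first exact: (nice_mulC j nh).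
exact: (nice_mulC j np).
Qed.

Lemma nice_grad2 h : nice false h ->
  nice false (fun eta => \sum_k convolve (mulC k h) (mulC k h) eta).
Proof. by move=> nh; apply: nice_sum => j; apply: niceC'; exact: (nice_mulC j nh). Qed.

Lemma nice_ampK h : nice false h -> nice false (ampK h).
Proof.
move=> nh; apply: nice_sum => j; rewrite -[false]/(~~ true); apply: nice_mulC.
exact: (nice_conv (nice_mulC j nh) (nice_grad2 nh)).
Qed.

Lemma nice_ampG h p : nice false h -> nice false p -> nice false (ampG h p).
Proof.
move=> nh np; apply: niceB; first apply: niceB; first apply: niceZ.
all: do ?[apply: nice_mulN => //|apply: niceC => //].
Qed.

Lemma nice_ampP h p : nice false h -> nice false p -> nice false (ampP h p).
Proof.
move=> nh np; apply: niceC; first exact: nice_mulN.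
by apply: niceB; do ?[apply: nice_mulN => //|apply: niceC => //].
Qed.

Lemma Q_tr h p : nice false h -> nice false p ->
  @is_Q R E (tr false h) (tr false p) (tr false (ampQ h p)).
Proof.
move=> nh np.
have nj j : nice true (convolve h (mulC j p)) by apply: niceC => //; exact: (nice_mulC j np).
have nq j : nice false (mulC j (convolve h (mulC j p))) by exact: (nice_mulC j (nj j)).
have nN : nice false (mulN (convolve h (mulN p))) by apply/nice_mulN/niceC => //; exact: nice_mulN.
exists (fun j => tr true (mulC j p)), (tr false (mulN p)).
exists (tr false (fun xi => - \sum_j mulC j (convolve h (mulC j p)) xi)).
exists (tr false (mulN (convolve h (mulN p)))).
split.
- by move=> j; exact: partial_tr_even.
- exact: absD_tr.
- exists (fun j => tr false (fun xi => - mulC j (convolve h (mulC j p)) xi)).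
    move=> j; rewrite tr_mul_even//; last exact: (nice_mulC j np).
    exact: partial_tr_odd.
  move=> x; rewrite trN; last exact: nice_sum.
  rewrite tr_sum// -sumrN; apply: eq_bigr => j _.
  by rewrite trN.
- rewrite tr_mul_even//; last exact: nice_mulN.
  by apply: absD_tr; apply: niceC => //; exact: nice_mulN.
- move=> x; rewrite -trD//; last by apply: niceN; exact: nice_sum.
  by congr tr; apply/funext => xi; rewrite addrC.
Qed.

Lemma tr_ampE h p x : nice false h -> nice false p ->
  tr false (ampE h p) x = tr false (mulN h) x * tr false (mulN p) x -
    \sum_j tr true (mulC j h) x * tr true (mulC j p) x.
Proof.
move=> nh np; rewrite trD; first last.
- by apply: nice_sum => j; apply: niceC'; [exact: (nice_mulC j nh)|exact: (nice_mulC j np)].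
- by apply: niceC; exact: nice_mulN.
congr (_ + _).
  by have /(congr1 (fun f => f x)) <- := tr_mul_even (nice_mulN nh) (nice_mulN np).
rewrite tr_sum; last first.
  by move=> j; apply: niceC'; [exact: (nice_mulC j nh)|exact: (nice_mulC j np)].
rewrite -sumrN; apply: eq_bigr => j _.
have /(congr1 (fun f => f x)) /= -> := tr_mul_odd (nice_mulC j nh) (nice_mulC j np).
by rewrite trN ?opprK//; apply: niceC'; [exact: (nice_mulC j nh)|exact: (nice_mulC j np)].
Qed.

Lemma quadratic_tr h p : nice false h -> nice false p ->
  @is_quadratic R E (tr false h) (tr false p)
    (tr false (fun xi => -2 * ampQ h p xi)) (tr false (ampE p p)).
Proof.
move=> nh np; exists (tr false (ampQ h p)), (tr false (mulN p)), (fun j => tr true (mulC j p)).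
split.
- exact: Q_tr.
- exact: absD_tr.
- by move=> j; exact: partial_tr_even.
- by move=> x; rewrite trZ//; exact: nice_ampQ.
- by move=> x; rewrite tr_ampE// expr2; congr (_ - _); apply: eq_bigr => j _; rewrite expr2.
Qed.

Definition ampM1 h1 p1 h2 p2 : V -> R := fun xi =>
  - 3 * ampQ h1 p2 xi - 3 * ampQ h2 p1 xi + 3 * ampG h1 p1 xi.

Definition ampM2 (tau : R) h1 p1 p2 : V -> R := fun xi =>
  - 3 * tau * ampK h1 xi - 6 * ampP h1 p1 xi + 3 * ampE p1 p2 xi.

Lemma cubic_h_tr h1 p1 h2 p2 : nice false h1 -> nice false p1 ->
  nice false h2 -> nice false p2 ->
  @is_cubic_h R E (tr false h1) (tr false p1) (tr false h2) (tr false p2)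
    (tr false (ampM1 h1 p1 h2 p2)).
Proof.
move=> n1 n2 n3 n4.
have nNp := nice_mulN n2.
have nhNp : nice false (convolve h1 (mulN p1)) by exact: niceC.
have nNNp := nice_mulN nNp.
have nhNNp : nice false (convolve h1 (mulN (mulN p1))) by exact: niceC.
have nhhNp : nice false (convolve h1 (convolve h1 (mulN p1))) by exact: niceC.
have nhhNNp : nice false (convolve h1 (convolve h1 (mulN (mulN p1)))) by exact: niceC.
exists (tr false (ampQ h1 p2)), (tr false (ampQ h2 p1)), (tr false (mulN p1)).
exists (tr false (fun xi => - mulN (mulN p1) xi)).
exists (tr false (mulN (convolve h1 (mulN p1)))).
exists (tr false (fun xi => - mulN (mulN (convolve h1 (convolve h1 (mulN p1)))) xi)).
exists (tr false (mulN (fun xi => - convolve h1 (convolve h1 (mulN (mulN p1))) xi))).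
exists (tr false (mulN (convolve h1 (mulN (convolve h1 (mulN p1)))))).
split; split.
- exact: Q_tr.
- exact: Q_tr.
- exact: absD_tr.
- exact: laplacian_tr.
- by rewrite tr_mul_even//; exact: absD_tr.
- have -> : (fun x => tr false h1 x ^+ 2 * tr false (mulN p1) x) =
     tr false (convolve h1 (convolve h1 (mulN p1))).
    by rewrite -tr_mul_even// -tr_mul_even//; apply/funext => x /=; ring.
  exact: laplacian_tr.
- have -> : (fun x => tr false h1 x ^+ 2 * tr false (fun xi => - mulN (mulN p1) xi) x) =
     tr false (fun xi => - convolve h1 (convolve h1 (mulN (mulN p1))) xi).
    rewrite -(convolveNr n1 nhNNp) -(convolveNr n1 nNNp).
    rewrite -tr_mul_even//; last by apply: niceC => //; exact: niceN.
    rewrite -tr_mul_even//; last exact: niceN.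
    by apply/funext => x /=; ring.
  by apply: absD_tr; exact: niceN.
- rewrite tr_mul_even//; last exact: nice_mulN.
  by apply: absD_tr; apply: niceC => //; exact: nice_mulN.
- move=> x.
  have nQ1 := nice_ampQ n1 n4; have nQ2 := nice_ampQ n3 n2.
  have nG := nice_ampG n1 n2.
  rewrite trD; [|by apply: niceB; exact: niceZ|exact: niceZ].
  rewrite trD; [|exact: niceZ|by apply: niceN; exact: niceZ].
  rewrite trN; last exact: niceZ.
  rewrite !trZ//; congr (_ - _ + 3 * _).
  have nF : nice false (mulN (convolve h1 (mulN (convolve h1 (mulN p1))))).
    by apply: nice_mulN; apply: niceC => //; exact: nice_mulN.
  rewrite -trZ// -trD; first last.
  - by apply: nice_mulN; exact: niceN.
  - by apply: niceN; do 2 apply: nice_mulN.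
  rewrite -trD; first last.
  - exact: niceZ.
  - apply: niceD; first by apply: niceN; do 2 apply: nice_mulN.
    by apply: nice_mulN; exact: niceN.
  congr tr; apply/funext => xi; rewrite /ampG /mulN; move: (nrm xi) => n.
  do 3! move: (convolve h1 _ xi) => ?; ring.
Qed.

Lemma cubic_psi_tr tau h1 p1 p2 : nice false h1 -> nice false p1 -> nice false p2 ->
  @is_cubic_psi R E tau (tr false h1) (tr false p1) (tr false p2)
    (tr false (ampM2 tau h1 p1 p2)).
Proof.
move=> n1 n2 n4.
have nNp := nice_mulN n2.
have nhNp : nice false (convolve h1 (mulN p1)) by exact: niceC.
have nNNp := nice_mulN nNp.
have nhNNp : nice false (convolve h1 (mulN (mulN p1))) by exact: niceC.
have ng := nice_grad2 n1.
exists (fun j => tr true (mulC j h1)), (fun j => tr true (mulC j p1)),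
  (fun j => tr true (mulC j p2)).
exists (tr false (mulN p1)), (tr false (mulN p2)), (tr false (fun xi => - mulN (mulN p1) xi)).
exists (tr false (mulN (convolve h1 (mulN p1)))), (tr false (ampK h1)).
split; [split|split; [split|split]].
- by move=> j; exact: partial_tr_even.
- by move=> j; exact: partial_tr_even.
- by move=> j; exact: partial_tr_even.
- exact: absD_tr.
- exact: absD_tr.
- exact: laplacian_tr.
- by rewrite tr_mul_even//; exact: absD_tr.
- pose G2 : V -> R := fun eta => \sum_k convolve (mulC k h1) (mulC k h1) eta.
  have njG j : nice true (convolve (mulC j h1) G2).
    exact: (nice_conv (nice_mulC j n1) ng).
  have sq : (fun x => \sum_k tr true (mulC k h1) x ^+ 2) = tr false (fun xi => - G2 xi).
    apply/funext => x; rewrite trN// tr_sum; last first.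
      by move=> k; apply: niceC'; exact: (nice_mulC k n1).
    rewrite -sumrN; apply: eq_bigr => k _.
    have := congr1 (fun f => f x) (tr_mul_odd (nice_mulC k n1) (nice_mulC k n1)).
    rewrite /= trN -?expr2//.
    by apply: niceC'; exact: (nice_mulC k n1).
  exists (fun j => tr false (mulC j (convolve (mulC j h1) G2))).
    move=> j.
    have -> : (fun x => tr true (mulC j h1) x * \sum_k tr true (mulC k h1) x ^+ 2) =
        tr true (fun xi => - convolve (mulC j h1) G2 xi).
      rewrite -(convolveNr (nice_mulC j n1) ng) -tr_mul_odd_even.
      + by rewrite -sq.
      + exact: (nice_mulC j n1).
      + exact: niceN.
    have := partial_tr_odd j (niceN (njG j)); congr (is_partial _ _ _).
    by congr tr; apply/funext => xi; rewrite mulrN opprK.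
  move=> x; rewrite -tr_sum// => j; exact: (nice_mulC j (njG j)).
- move=> x.
  have nK := nice_ampK n1; have nP := nice_ampP n1 n2; have nE := nice_ampE n2 n4.
  rewrite trD; [|by apply: niceB; exact: niceZ|exact: niceZ].
  rewrite trD; [|exact: niceZ|by apply: niceN; exact: niceZ].
  rewrite trN; last exact: niceZ.
  rewrite (trZ (- 3 * tau) x nK) (trZ 6 x nP) (trZ 3 x nE) tr_ampE//.
  congr (_ - _ + _).
  rewrite -mulrA; congr (_ * _).
  have nD : nice false (fun eta => mulN (convolve h1 (mulN p1)) eta -
       convolve h1 (mulN (mulN p1)) eta).
    by apply: niceB => //; exact: nice_mulN.
  have := congr1 (fun f => f x) (tr_mul_even nNp nD); rewrite /= => <-.
  congr (_ * _); rewrite trD; [|exact: nice_mulN|exact: niceN].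
  rewrite addrC; congr (_ + _).
  rewrite -(convolveNr n1 nNNp).
  by have := congr1 (fun f => f x) (tr_mul_even n1 (niceN nNNp)).
Qed.

(** * The iterated Duhamel formula for data (h0, 0) *)

Section ThirdVariation.
Variables (g tau T : R) (a0 : V -> R).

(** As psi0 = 0, only the first column of exp(tL) enters the linear solution. The definitions up to
    [third_psi] are the witnesses for [is_third_variation]. *)
Definition lin_h (t : R) : V -> R := fun xi => ecos g tau t xi * a0 xi.
Definition lin_psi (t : R) : V -> R := fun xi => elow g tau t xi * a0 xi.
Definition quad_h (t : R) : V -> R := fun xi => -2 * ampQ (lin_h t) (lin_psi t) xi.
Definition quad_psi (t : R) : V -> R := ampE (lin_psi t) (lin_psi t).
Definition second_h : R -> V -> R := duh (@ecos R S g tau) (@eup R S g tau) quad_h quad_psi.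
Definition second_psi : R -> V -> R := duh (@elow R S g tau) (@ecos R S g tau) quad_h quad_psi.
Definition cubic_h (t : R) : V -> R := ampM1 (lin_h t) (lin_psi t) (second_h t) (second_psi t).
Definition cubic_psi (t : R) : V -> R := ampM2 tau (lin_h t) (lin_psi t) (second_psi t).
Definition third_h : R -> V -> R := duh (@ecos R S g tau) (@eup R S g tau) cubic_h cubic_psi.
Definition third_psi : R -> V -> R := duh (@elow R S g tau) (@ecos R S g tau) cubic_h cubic_psi.

Hypothesis na0 : nice false a0.

Lemma fam_mulN e (a : R -> V -> R) : fam T e a -> fam T e (fun t => mulN (a t)).
Proof. by move=> fa; rewrite -[e]addFb; exact: fam_mult (mult_nrm S T) fa. Qed.

Lemma fam_mulC e j (a : R -> V -> R) : fam T e a -> fam T (~~ e) (fun t => mulC j (a t)).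
Proof. by move=> fa; rewrite -addTb; exact: fam_mult (mult_co T j) fa. Qed.

Lemma fam_convF e (a b : R -> V -> R) : fam T false a -> fam T e b ->
  fam T e (fun t => convolve (a t) (b t)).
Proof. by move=> fa fb; rewrite -[e]addFb; exact: fam_conv. Qed.

Lemma fam_convT (a b : R -> V -> R) : fam T true a -> fam T true b ->
  fam T false (fun t => convolve (a t) (b t)).
Proof. by move=> fa fb; exact: (fam_conv fa fb). Qed.

Lemma fam0 e : fam T e (fun _ (_ : V) => 0).
Proof. exact: fam_cst (nice0 S e). Qed.

Lemma fam_sum e (F : J -> R -> V -> R) :
  (forall j, fam T e (F j)) -> fam T e (fun t xi => \sum_j F j t xi).
Proof.
move=> fF; elim: (index_enum _) => [|i r IH].
  by under eq_fun do under eq_fun do rewrite big_nil; exact: fam0.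
by under eq_fun do under eq_fun do rewrite big_cons; exact: famD.
Qed.

Lemma famN e (a : R -> V -> R) : fam T e a -> fam T e (fun t xi => - a t xi).
Proof. by move=> /(famZ (-1)); under eq_fun do under eq_fun do rewrite mulN1r. Qed.

Lemma famB e (a b : R -> V -> R) : fam T e a -> fam T e b ->
  fam T e (fun t xi => a t xi - b t xi).
Proof. by move=> fa /famN; exact: famD. Qed.

Lemma fam_ampQ (h p : R -> V -> R) : fam T false h -> fam T false p ->
  fam T false (fun t => ampQ (h t) (p t)).
Proof.
move=> fh fp; apply: famB.
  exact: (fam_mulN (fam_convF fh (fam_mulN fp))).
apply: fam_sum => j; exact: (fam_mulC j (fam_convF fh (fam_mulC j fp))).
Qed.

Lemma fam_ampE (h p : R -> V -> R) : fam T false h -> fam T false p ->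
  fam T false (fun t => ampE (h t) (p t)).
Proof.
move=> fh fp; apply: famD; first exact: (fam_convF (fam_mulN fh) (fam_mulN fp)).
apply: fam_sum => j; exact: (fam_convT (fam_mulC j fh) (fam_mulC j fp)).
Qed.

Lemma fam_ampK (h : R -> V -> R) : fam T false h -> fam T false (fun t => ampK (h t)).
Proof.
move=> fh; have fs : fam T false
    (fun t eta => \sum_k convolve (mulC k (h t)) (mulC k (h t)) eta).
  by apply: fam_sum => k; exact: (fam_convT (fam_mulC k fh) (fam_mulC k fh)).
apply: fam_sum => j; exact: (fam_mulC j (fam_conv (fam_mulC j fh) fs)).
Qed.

Lemma fam_ampG (h p : R -> V -> R) : fam T false h -> fam T false p ->
  fam T false (fun t => ampG (h t) (p t)).
Proof.
move=> fh fp; have fNp := fam_mulN fp; apply: famB; first apply: famB.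
- exact: (famZ 2 (fam_mulN (fam_convF fh (fam_mulN (fam_convF fh fNp))))).
- exact: (fam_mulN (fam_mulN (fam_convF fh (fam_convF fh fNp)))).
- exact: (fam_mulN (fam_convF fh (fam_convF fh (fam_mulN fNp)))).
Qed.

Lemma fam_ampP (h p : R -> V -> R) : fam T false h -> fam T false p ->
  fam T false (fun t => ampP (h t) (p t)).
Proof.
move=> fh fp; have fNp := fam_mulN fp.
exact: (fam_convF fNp (famB (fam_mulN (fam_convF fh fNp)) (fam_convF fh (fam_mulN fNp)))).
Qed.

Lemma fam_lin_h : fam T false lin_h.
Proof. exact: fam_mult (mult_ecos S g tau T) (fam_cst T na0). Qed.

Lemma fam_lin_psi : fam T false lin_psi.
Proof. exact: fam_mult (mult_elow S g tau T) (fam_cst T na0). Qed.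

Lemma fam_quad_h : fam T false quad_h.
Proof. by apply: famZ; apply: fam_ampQ; [exact: fam_lin_h|exact: fam_lin_psi]. Qed.

Lemma fam_quad_psi : fam T false quad_psi.
Proof. by apply: fam_ampE; exact: fam_lin_psi. Qed.

Lemma fam_second_h : fam T false second_h.
Proof. exact: fam_duh (mult_ecos S g tau T) (mult_eup S g tau T) fam_quad_h fam_quad_psi. Qed.

Lemma fam_second_psi : fam T false second_psi.
Proof. exact: fam_duh (mult_elow S g tau T) (mult_ecos S g tau T) fam_quad_h fam_quad_psi. Qed.

Lemma fam_cubic_h : fam T false cubic_h.
Proof.
apply: famD; last by apply/famZ/fam_ampG; [exact: fam_lin_h|exact: fam_lin_psi].
apply: famB; apply/famZ/fam_ampQ.
- exact: fam_lin_h.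
- exact: fam_second_psi.
- exact: fam_second_h.
- exact: fam_lin_psi.
Qed.

Lemma fam_cubic_psi : fam T false cubic_psi.
Proof.
apply: famD; last by apply/famZ/fam_ampE; [exact: fam_lin_psi|exact: fam_second_psi].
apply: famB; apply: famZ; first by apply: fam_ampK; exact: fam_lin_h.
by apply: fam_ampP; [exact: fam_lin_h|exact: fam_lin_psi].
Qed.

Lemma fam_third_h : fam T false third_h.
Proof. exact: fam_duh (mult_ecos S g tau T) (mult_eup S g tau T) fam_cubic_h fam_cubic_psi. Qed.

Lemma fam_third_psi : fam T false third_psi.
Proof. exact: fam_duh (mult_elow S g tau T) (mult_ecos S g tau T) fam_cubic_h fam_cubic_psi. Qed.

Lemma third_variation :
  @is_third_variation R E g tau T (tr false a0) (tr false (fun=> 0))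
    (fun t => tr false (third_h t)) (fun t => tr false (third_psi t)).
Proof.
exists (fun t => tr false (lin_h t)), (fun t => tr false (lin_psi t)).
exists (fun t => tr false (second_h t)), (fun t => tr false (second_psi t)).
exists (fun t => tr false (quad_h t)), (fun t => tr false (quad_psi t)).
exists (fun t => tr false (cubic_h t)), (fun t => tr false (cubic_psi t)) => t tT.
have nH1 := nice_slice fam_lin_h tT; have nP1 := nice_slice fam_lin_psi tT.
have nH2 := nice_slice fam_second_h tT; have nP2 := nice_slice fam_second_psi tT.
split; split.
- have := evolution_tr g tau (proj1 (andP tT)) na0 (nice0 S false).
  congr (is_evolution _ _ _ _ _ _ _); congr tr; apply/funext => xi;
    by rewrite mulr0 addr0.
- exact: quadratic_tr.
- exact: duhamel_tr fam_quad_h fam_quad_psi tT.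
- exact: cubic_h_tr.
- exact: cubic_psi_tr.
- exact: duhamel_tr fam_cubic_h fam_cubic_psi tT.
Qed.

End ThirdVariation.

End Variation.

(** * The Lebesgue measure in dimensions one and two *)

Section Spaces.
Context {R : realType}.
Local Notation RT := (measurableTypeR R).
Local Notation leb1 := (@lebesgue_measure R).

Lemma measurable_reflect (x : RT) : measurable_fun setT ((fun y => x - y) : RT -> RT).
Proof.
exact: (@measurable_funB _ _ R _ (fun=> x) (fun y => y)
          (measurable_cst _) (@measurable_id _ _ _)).
Qed.

Lemma lebesgue_itvcc (a b : R) : a <= b -> leb1 `[a, b] = (b - a)%:E.
Proof.
move=> ab; rewrite lebesgue_measure_itv/= lte_fin; case: ltP => [_|ba]; first by rewrite EFinB.
by have -> : a = b by [apply/eqP; rewrite eq_le ab ba]; rewrite subrr.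
Qed.

(** The pushforward agrees with the Lebesgue measure on half-open intervals, which determine it; a
    reflection moves the closed end to the other side but keeps the length. *)
Lemma lebesgue_reflect (x : RT) (A : set RT) : measurable A ->
  leb1 ((fun y => x - y) @^-1` A) = leb1 A.
Proof.
move=> mA.
pose m := measure_function_pushforward__canonical__measure_function_Measure
  leb1 (measurable_reflect x).
rewrite -[LHS]/(m A); apply/esym.
apply: (@lebesgue_measure_unique R m) => // X [[a b] _ <-] /=.
rewrite /pushforward.
have -> : (fun y : R => x - y) @^-1` `]a, b] = `[x - b, x - a[%classic.
  by apply/seteqP; split => y /=; rewrite !in_itv /=; lra.
rewrite !lebesgue_measure_itv /= !lte_fin.
have -> : (x - b < x - a) = (a < b) by apply/idP/idP; lra.
case: ifP => // _.
by rewrite -!EFinB; congr (_%:E); ring.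
Qed.

Definition space1 : freq_space R.
Proof.
refine (@FreqSpace R 0 _ RT leb1 (fun x _ => x) (fun x y => x - y) _ _ _ _ _ _ _) => //.
- by move=> x y /(_ ord0).
- exact: (@measurable_funB _ _ R _ (fun p : RT * RT => p.1) (fun p => p.2)
    measurable_fst measurable_snd).
- exact: lebesgue_reflect.
- move=> p q r r0.
  have -> : [set xi : R | p <= xi <= p + r /\ forall j : 'I_1, j != ord0 -> q <= xi <= q + r]
      = `[p, p + r]%classic.
    apply/seteqP; split => y /=; rewrite in_itv /=; first by case.
    by move=> ->; split=> // j; rewrite ord1 eqxx.
  rewrite expr1; have H : p <= p + r by rewrite lerDl.
  by apply: etrans (lebesgue_itvcc H) _; rewrite [p + r]addrC addrK.
Defined.

Definition co2 (p : RT * RT) (j : 'I_2) : R := if j == ord0 then p.1 else p.2.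

Definition sub2 (p q : RT * RT) : RT * RT := (p.1 - q.1, p.2 - q.2).

Lemma measurable_sub2 :
  measurable_fun setT (fun p : (RT * RT) * (RT * RT) => sub2 p.1 p.2).
Proof.
apply: measurable_fun_pair.
- apply: (@measurable_funB _ _ R _ (fun p : (RT * RT) * (RT * RT) => p.1.1) (fun p => p.2.1)).
    by apply: measurableT_comp; exact: measurable_fst.
  by apply: measurableT_comp; [exact: measurable_fst|exact: measurable_snd].
- apply: (@measurable_funB _ _ R _ (fun p : (RT * RT) * (RT * RT) => p.1.2) (fun p => p.2.2)).
    by apply: measurableT_comp; [exact: measurable_snd|exact: measurable_fst].
  by apply: measurableT_comp; [exact: measurable_snd|exact: measurable_snd].
Qed.

Lemma measurable_reflect2 x : measurable_fun setT (sub2 x).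
Proof. exact: (measurableT_comp measurable_sub2 (measurable_pair1 x)). Qed.

(** A name for the product measure to which sigma-finiteness can be attached; it unfolds to the
    measure of [euclid2]. *)
Definition plane : set (RT * RT) -> \bar R := (leb1 \x leb1)%E.

HB.instance Definition _ := Measure.on plane.

Lemma plane_sigma_finite : sigma_finite setT plane.
Proof.
pose I (n : nat) : set RT := `[- n%:R, n%:R]%classic.
exists (fun n => I n `*` I n).
  apply/esym/seteqP; split=> // -[x y] _.
  pose m := maxn (Num.truncn `|x|).+1 (Num.truncn `|y|).+1.
  exists m => //; split; rewrite /I /= in_itv /= -ler_norml.
  - apply: (@le_trans _ _ (Num.truncn `|x|).+1%:R).
      by rewrite ltW// truncnS_gt.
    by rewrite ler_nat leq_maxl.
  - apply: (@le_trans _ _ (Num.truncn `|y|).+1%:R).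
      by rewrite ltW// truncnS_gt.
    by rewrite ler_nat leq_maxr.
move=> n; split; first by apply: measurableX; exact: measurable_itv.
rewrite /plane product_measure1E; [|exact: measurable_itv..].
have h : - n%:R <= n%:R :> R by rewrite ge0_cp.
apply: (@le_lt_trans _ _ ((n%:R - - n%:R)%:E * (n%:R - - n%:R)%:E)%E).
  by rewrite le_eqVlt; apply/orP; left; apply/eqP; congr (_ * _)%E; exact: lebesgue_itvcc.
by rewrite -EFinM ltry.
Qed.

HB.instance Definition _ := Measure_isSigmaFinite.Build _ _ _ plane plane_sigma_finite.

Lemma lebesgue2_reflect x (A : set (RT * RT)) : measurable A ->
  (leb1 \x leb1)%E (sub2 x @^-1` A) = (leb1 \x leb1)%E A.
Proof.
move=> mA.
pose m2 := [the {measure set (RT * RT) -> \bar R} of (leb1 \x leb1)%E].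
pose m := measure_function_pushforward__canonical__measure_function_Measure
  m2 (measurable_reflect2 x).
rewrite -[LHS]/(m A); apply/esym.
apply: (@product_measure_unique _ _ _ _ _ _ _ m) => // X Y mX mY /=.
rewrite /pushforward.
have -> : sub2 x @^-1` (X `*` Y) =
    ((fun y => x.1 - y) @^-1` X) `*` ((fun y => x.2 - y) @^-1` Y) by [].
rewrite product_measure1E.
- by congr (_ * _)%E; exact: lebesgue_reflect.
- by rewrite -[X in measurable X]setTI; exact: measurable_reflect.
- by rewrite -[X in measurable X]setTI; exact: measurable_reflect.
Qed.

Definition space2 : freq_space R.
Proof.
refine (@FreqSpace R 1 _ (RT * RT)%type
  plane co2 sub2 _ _ _ _ _ _ _) => //.
- move=> [x1 x2] [y1 y2] h; congr (_, _); first exact: (h ord0).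
  exact: (h ord_max).
- by move=> [x1 x2] [y1 y2] j; rewrite /co2 /sub2; case: ifP.
- move=> j; have [j0|j0] := boolP (j == ord0).
    by rewrite (_ : co2 ^~ j = fst); [exact: measurable_fst|apply/funext => p; rewrite /co2 j0].
  by rewrite (_ : co2 ^~ j = snd);
    [exact: measurable_snd|apply/funext => p; rewrite /co2 (negbTE j0)].
- exact: measurable_sub2.
- exact: lebesgue2_reflect.
- move=> p q r r0.
  have -> : [set xi : RT * RT | p <= co2 xi ord0 <= p + r /\
       forall j : 'I_2, j != ord0 -> q <= co2 xi j <= q + r]
      = `[p, p + r]%classic `*` `[q, q + r]%classic.
    apply/seteqP; split; case=> y1 y2 /=; rewrite !in_itv /=.
      by move=> [-> /(_ ord_max isT)].
    by move=> [-> h]; split=> // j; rewrite /co2 => /negbTE ->.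
  rewrite /= /plane product_measure1E; [|exact: measurable_itv..].
  have Hp : p <= p + r by rewrite lerDl.
  have Hq : q <= q + r by rewrite lerDl.
  transitivity ((p + r - p)%:E * (q + r - q)%:E)%E.
    by congr (_ * _)%E; exact: lebesgue_itvcc.
  by rewrite -EFinM expr2; congr (_%:E); ring.
Defined.

(** [space1] and [space2] are transparent, so that the spaces of the statement are recovered by
    conversion alone. *)
Lemma euc_space1 : euc space1 = euclid1 R. Proof. reflexivity. Qed.
Lemma euc_space2 : euc space2 = euclid2 R. Proof. reflexivity. Qed.

End Spaces.

(** * Nearly parallel frequencies *)

Section Windows.
Context {R : realType} (S : freq_space R).
Local Notation V := (freq S).
Local Notation nrm := (@nrm R S).
Local Notation dt := (@dt R S).
Local Notation J := 'I_(codim S).+1.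
Implicit Types (x y z xi eta : V) (a b f h : V -> R) (j k : J) (p q r B : R).

Definition X xi : R := co xi ord0.
(** The part of |xi| that is not linear in xi; it is tiny near the positive first axis and measures
    all defects from the one-dimensional, one-sided case. *)
Definition excess xi : R := nrm xi - X xi.

Lemma X_sub xi eta : X (sub xi eta) = X xi - X eta.
Proof. exact: co_sub. Qed.

Lemma codim_le1r : (codim S)%:R <= 1 :> R.
Proof. by rewrite (ler_nat _ _ 1) codim_le1. Qed.

(** There is at most one transverse coordinate, so the sum has at most one term. This treats d = 1
    and d = 2 together. *)
Lemma sum_tail_le (F : 'I_(codim S) -> R) B :
  0 <= B -> (forall i, F i <= B) -> \sum_i F i <= B.
Proof.
move=> B0 FB; apply: (@le_trans _ _ (\sum_(i < codim S) B)); first exact: ler_sum.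
rewrite sumr_const card_ord -mulr_natr; have := codim_le1r; have := ler0n R (codim S).
by move: (_%:R) => c; nra.
Qed.

Lemma sqr_nrmE xi : nrm xi ^+ 2 = X xi ^+ 2 + \sum_(i < codim S) co xi (lift ord0 i) ^+ 2.
Proof. by rewrite sqr_nrm big_ord_recl. Qed.

Lemma dtE0 xi eta : dt xi eta = X xi * X eta +
  \sum_(i < codim S) co xi (lift ord0 i) * co eta (lift ord0 i).
Proof. by rewrite dtE big_ord_recl. Qed.

Lemma box_X p r xi : box p 0 r xi -> p <= X xi <= p + r.
Proof. by case. Qed.

Lemma box_tail p r xi i : box p 0 r xi -> 0 <= co xi (lift ord0 i) <= r.
Proof. by case=> _ /(_ (lift ord0 i)); rewrite add0r; apply. Qed.

(** (|xi| - xi_1)(|xi| + xi_1) is the square of the transverse part, at most r ^ 2, and the second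
    factor is at least 2 p. *)
Lemma box_excess p r xi : 0 < p -> 0 <= r -> box p 0 r xi ->
  0 <= excess xi /\ excess xi * (2 * p) <= r ^+ 2.
Proof.
move=> p0 r0 b; have /andP[pX _] := box_X b.
have n0 := nrm_ge0 xi; have := co_le_nrm xi ord0; rewrite -/(X xi).
rewrite ger0_norm; last by lra.
move=> Xn; rewrite /excess; split; first lra.
have E := sqr_nrmE xi.
have : \sum_(i < codim S) co xi (lift ord0 i) ^+ 2 <= r ^+ 2.
  apply: sum_tail_le => [|i]; first exact: sqr_ge0.
  by have /andP[c0 cr] := box_tail i b; rewrite ler_sqr.
move: E; set s := \sum_(i < _) _; move: (nrm xi) (X xi) s n0 pX Xn => n x s n0 pX Xn E sr.
nra.
Qed.

Lemma box_nrm p r xi : 1 <= p -> 0 <= r <= 3 / 10 -> box p 0 r xi ->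
  p <= nrm xi <= p + 4 / 10.
Proof.
move=> p1 /andP[r0 r3] b; have /andP[pX Xp] := box_X b.
have [e0 er] := box_excess (lt_le_trans ltr01 p1) r0 b.
move: e0 er; rewrite /excess; move: (nrm xi) (X xi) pX Xp => n x pX Xp e0 er.
apply/andP; split; first lra.
nra.
Qed.

Lemma box_co p r xi j : 0 <= p -> 0 <= r -> box p 0 r xi -> 0 <= co xi j.
Proof.
move=> p0 r0 [/andP[b0 _] b]; have [->|j0] := eqVneq j ord0; first exact: le_trans b0.
by have /andP[] := b _ j0.
Qed.

(** One product of norms for each of the two coordinates; the constant 2 instead of the
    Cauchy-Schwarz constant is good enough for the error terms. *)
Lemma abs_dt_le xi eta : `|dt xi eta| <= 2 * (nrm xi * nrm eta).
Proof.
rewrite dtE0; apply: le_trans (ler_normD _ _) _.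
rewrite mulrDl mul1r; apply: lerD.
  by rewrite normrM; apply: ler_pM => //; exact: co_le_nrm.
apply: le_trans (ler_norm_sum _ _ _) _; apply: sum_tail_le => [|i].
  by rewrite mulr_ge0 ?nrm_ge0.
by rewrite normrM; apply: ler_pM => //; exact: co_le_nrm.
Qed.

Definition sigma xi eta : R := nrm xi * nrm eta - dt xi eta.

Lemma sigma_le xi eta : `|sigma xi eta| <= 3 * (nrm xi * nrm eta).
Proof.
apply: le_trans (ler_normB _ _) _.
rewrite ger0_norm; last by rewrite mulr_ge0 ?nrm_ge0.
have := abs_dt_le xi eta; lra.
Qed.

(** With |xi| = x + u and |eta| = y + v, where u and v are the excesses, the symbol is x v + y u + u
    v minus the transverse product. Each excess is at most r ^ 2 over twice the corner of its box,
    which compensates the size of the other frequency. *)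
Lemma sigma_high p q r xi eta : 1 <= p -> p <= q <= p + 2 -> 0 <= r <= 3 / 10 ->
  box p 0 r xi -> box q 0 r eta -> `|sigma xi eta| <= 1.
Proof.
move=> p1 /andP[pq qp] /andP[r0 r3] bx be.
have p0 : 0 < p by lra.
have q0 : 0 < q by lra.
have [e0 er] := box_excess p0 r0 bx; have [e0' er'] := box_excess q0 r0 be.
have /andP[h1 h2] := box_X bx; have /andP[h3 h4] := box_X be.
rewrite /sigma dtE0.
have s0 : 0 <= \sum_(i < codim S) co xi (lift ord0 i) * co eta (lift ord0 i).
  apply: sumr_ge0 => i _; have /andP[u _] := box_tail i bx; have /andP[v _] := box_tail i be.
  exact: mulr_ge0.
have s1 : \sum_(i < codim S) co xi (lift ord0 i) * co eta (lift ord0 i) <= r ^+ 2.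
  apply: sum_tail_le => [|i]; first exact: sqr_ge0.
  have /andP[u0 u] := box_tail i bx; have /andP[v0 v] := box_tail i be.
  by rewrite expr2; exact: ler_pM.
rewrite (_ : nrm xi = X xi + excess xi); last by rewrite /excess; ring.
rewrite (_ : nrm eta = X eta + excess eta); last by rewrite /excess; ring.
move: (X xi) (X eta) (excess xi) (excess eta) e0 er e0' er' h1 h2 h3 h4.
move=> x y u v u0 ur v0 vr px xp qy yq; move: s0 s1; set s := \sum_(_ < _) _ => s0 s1.
have r2 : r ^+ 2 <= 9 / 100 by nra.
have xv : x * v <= 18 / 100.
  apply: (@le_trans _ _ (2 * q * v)); first by apply: ler_wpM2r => //; lra.
  by move: vr; rewrite mulrC; lra.
have yu : y * u <= 36 / 100.
  apply: (@le_trans _ _ (4 * (2 * p) / 2 * u)); first by apply: ler_wpM2r => //; lra.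
  by move: ur; lra.
have uv : u * v <= 9 / 100.
  have u1 : u <= 9 / 200 by nra.
  have v1 : v <= 9 / 200 by nra.
  nra.
have xv0 : 0 <= x * v by apply: mulr_ge0 => //; lra.
have yu0 : 0 <= y * u by apply: mulr_ge0 => //; lra.
have uv0 : 0 <= u * v by exact: mulr_ge0.
rewrite ler_norml; lra.
Qed.

(** Reduces every upper bound to a pointwise bound of the symbol where the integrand does not
    vanish; the comparison convolution stays symbolic. *)
Lemma int_bound z (F q q' : V -> R) B : tame (mu S) F ->
  nice false q -> nice false q' -> 0 <= B ->
  (forall eta, 0 <= q eta) -> (forall eta, 0 <= q' eta) ->
  (forall eta, F eta != 0 -> `|F eta| <= B * (q eta * q' (sub z eta))) ->
  `|fcst S * \int[mu S]_eta F eta| <= B * convolve q q' z.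
Proof.
move=> tF nq nq' B0 q0 q0' FB; rewrite /convolve mulrCA normrM.
rewrite gtr0_norm ?fcst_gt0//; apply: ler_wpM2l; first exact: ltW (fcst_gt0 S).
have tc := nice_tame_conv z nq nq'.
rewrite -integral_tameZ//; apply: le_norm_integral_tame => //; first exact: tameZ.
move=> eta; have [->|/FB//] := eqVneq (F eta) 0.
by rewrite normr0 !mulr_ge0.
Qed.

Lemma int_lower z (F q q' : V -> R) B : tame (mu S) F ->
  nice false q -> nice false q' ->
  (forall eta, B * (q eta * q' (sub z eta)) <= F eta) ->
  B * convolve q q' z <= fcst S * \int[mu S]_eta F eta.
Proof.
move=> tF nq nq' FB; rewrite /convolve mulrCA.
apply: ler_wpM2l; first exact: ltW (fcst_gt0 S).
have tc := nice_tame_conv z nq nq'.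
by rewrite -integral_tameZ//; apply: le_integral_tame => //; exact: tameZ.
Qed.

Lemma convolve_ge0 (q q' : V -> R) z : (forall eta, 0 <= q eta) -> (forall eta, 0 <= q' eta) ->
  0 <= convolve q q' z.
Proof.
move=> q0 q0'; rewrite mulr_ge0 ?(ltW (fcst_gt0 S))// Rintegral_ge0// => eta _.
exact: mulr_ge0.
Qed.

Lemma convolveC e e' a b : nice e a -> nice e' b -> convolve a b = convolve b a.
Proof.
move=> na nb; apply/funext => z; rewrite /convolve; congr (_ * _).
rewrite -(integral_reflect z (nice_tame_conv z na nb)).
by apply: eq_Rintegral => eta _; rewrite sub_sub mulrC.
Qed.

Lemma mulX_convolve a b : nice false a -> nice false b ->
  (fun z => X z * convolve a b z) =
  (fun z => convolve (mulC ord0 a) b z + convolve a (mulC ord0 b) z).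
Proof.
move=> na nb; apply/funext => z.
have t1 := nice_tame_conv z (nice_mulC ord0 na) nb.
have t2 := nice_tame_conv z na (nice_mulC ord0 nb).
rewrite /convolve -mulrDr mulrCA; congr (_ * _).
rewrite -integral_tameD// -integral_tameZ; last exact: nice_tame_conv na nb.
by apply: eq_Rintegral => eta _; rewrite /mulC co_sub -/(X z); ring.
Qed.

(** Fubini, the two successive subtractions commuting. The parities are free because the lemma is
    used with one factor multiplied by the odd X. *)
Lemma convolve_left_comm e1 e2 e3 a b f : nice e1 a -> nice e2 b -> nice e3 f ->
  convolve a (convolve b f) = convolve b (convolve a f).
Proof.
move=> na nb nf; apply/funext => z; rewrite /convolve; congr (_ * _).
have [Ma [ra [Ma0 ra0 Ba Sa]]] := nice_bound na.
have [Mb [rb [Mb0 rb0 Bb Sb]]] := nice_bound nb.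
have [Mf [rf [Mf0 rf0 Bf _]]] := nice_bound nf.
pose F (q : V * V) := a q.1 * (b q.2 * f (sub (sub z q.1) q.2)).
have mF : measurable_fun setT F.
  apply: measurable_funM.
    by apply: (measurableT_comp (proj1 (nice_tame na))); exact: measurable_fst.
  apply: measurable_funM.
    by apply: (measurableT_comp (proj1 (nice_tame nb))); exact: measurable_snd.
  apply: (measurableT_comp (proj1 (nice_tame nf))).
  apply: (measurableT_comp (@measurable_sub R S)
    (g := fun q : V * V => (sub z q.1, q.2))).
  apply: measurable_fun_pair; last exact: measurable_snd.
  by apply: (measurableT_comp (measurable_subr z)); exact: measurable_fst.
have FM x y : `|F (x, y)| <= Ma * (Mb * Mf) * (\1_(cube ra) x * \1_(cube rb) y).
  rewrite /F /=.
  have [->|a0] := eqVneq (a x) 0; first by rewrite mul0r normr0 !mulr_ge0.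
  have [->|b0] := eqVneq (b y) 0; first by rewrite mul0r mulr0 normr0 !mulr_ge0.
  rewrite !indicE (mem_set (Sa _ a0)) (mem_set (Sb _ b0)) !mulr1 !normrM.
  by apply: ler_pM => //; apply: ler_pM.
have := Rfubini mF (measurable_cube S ra) (@mu_cube_fin R S ra)
   (measurable_cube S rb) (@mu_cube_fin R S rb) FM.
have tb x : tame (mu S) (fun y => b y * f (sub (sub z x) y)) by exact: nice_tame_conv nb nf.
have ta y : tame (mu S) (fun x => a x * f (sub (sub z y) x)) by exact: nice_tame_conv na nf.
have sw x y : sub (sub z x) y = sub (sub z y) x.
  by apply: co_inj => j; rewrite !co_sub; ring.
rewrite (_ : \int[mu S]_x _ = \int[mu S]_x (a x * \int[mu S]_y (b y * f (sub (sub z x) y)))); last first.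
  by apply: eq_Rintegral => x _; rewrite -integral_tameZ.
rewrite (_ : \int[mu S]_y \int[mu S]_x F (x, y) =
    \int[mu S]_y (b y * \int[mu S]_x (a x * f (sub (sub z y) x)))); last first.
  apply: eq_Rintegral => y _; rewrite -integral_tameZ//.
  by apply: eq_Rintegral => x _; rewrite /F /= sw; ring.
move=> E.
have tab : tame (mu S) (fun x => a x * convolve b f (sub z x)).
  exact: nice_tame_conv na (nice_conv nb nf).
have tba : tame (mu S) (fun x => b x * convolve a f (sub z x)).
  exact: nice_tame_conv nb (nice_conv na nf).
transitivity (fcst S * \int[mu S]_x (a x * \int[mu S]_y (b y * f (sub (sub z x) y)))).
  rewrite -RintegralZl; first by apply: eq_Rintegral => x _; ring.
    exact: measurableT.
  (* Integrability of the inner integral is that of the convolution, with its constant divided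
     out. *)
  have := tame_integrable (tameZ (fcst S)^-1 tab); congr (_.-integrable _ _).
  apply/funext => x /=; congr (_%:E); rewrite /convolve.
  by rewrite mulrCA; congr (_ * _); rewrite mulKf; [by []|by rewrite gt_eqF ?fcst_gt0].
rewrite E -RintegralZl; [by apply: eq_Rintegral => x _; ring|exact: measurableT|].
have := tame_integrable (tameZ (fcst S)^-1 tba); congr (_.-integrable _ _).
apply/funext => x /=; congr (_%:E); rewrite /convolve.
by rewrite mulrCA; congr (_ * _); rewrite mulKf; [by []|by rewrite gt_eqF ?fcst_gt0].
Qed.

(** Both terms of Q are put under one integral, where the cancellation shows in the symbol
    [sigma]. *)
Lemma ampQ_int h (p : V -> R) z : nice false h -> nice false p ->
  let F eta := sigma z (sub z eta) * (h eta * p (sub z eta)) in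
  tame (mu S) F /\ ampQ h p z = fcst S * \int[mu S]_eta F eta.
Proof.
move=> nh np F.
have tN := nice_tame_conv z nh (nice_mulN np).
have tC j := nice_tame_conv z nh (nice_mulC j np).
have FE : F = fun eta => nrm z * (h eta * mulN p (sub z eta)) -
    \sum_j co z j * (h eta * mulC j p (sub z eta)).
  apply/funext => eta; rewrite /F /sigma mulrBl dtE mulr_suml; congr (_ - _).
    by rewrite /mulN; ring.
  by apply: eq_bigr => j _; rewrite /mulC; ring.
have tS : tame (mu S) (fun eta => \sum_j co z j * (h eta * mulC j p (sub z eta))).
  by apply: tame_sum => j; exact: tameZ.
split; first by rewrite FE; exact: tameD (tameZ _ tN) (tameN tS).
rewrite FE integral_tameB//; last exact: tameZ.
rewrite integral_tameZ// integral_tame_sum; last by move=> j; exact: tameZ.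
rewrite mulrBr /ampQ; congr (_ - _); first by rewrite /mulN /convolve mulrCA.
rewrite mulr_sumr; apply: eq_bigr => j _.
by rewrite integral_tameZ// /mulC /convolve mulrCA.
Qed.

Lemma ampE_int h (p : V -> R) z : nice false h -> nice false p ->
  let F eta := (nrm eta * nrm (sub z eta) + dt eta (sub z eta)) *
     (h eta * p (sub z eta)) in
  tame (mu S) F /\ ampE h p z = fcst S * \int[mu S]_eta F eta.
Proof.
move=> nh np F.
have tN := nice_tame_conv z (nice_mulN nh) (nice_mulN np).
have tC j := nice_tame_conv z (nice_mulC j nh) (nice_mulC j np).
have FE : F = fun eta => mulN h eta * mulN p (sub z eta) +
    \sum_j mulC j h eta * mulC j p (sub z eta).
  apply/funext => eta; rewrite /F mulrDl dtE mulr_suml; congr (_ + _).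
    by rewrite /mulN; ring.
  by apply: eq_bigr => j _; rewrite /mulC; ring.
have tS : tame (mu S) (fun eta => \sum_j mulC j h eta * mulC j p (sub z eta)).
  exact: tame_sum.
split; first by rewrite FE; exact: tameD.
rewrite FE integral_tameD// integral_tame_sum// mulrDr; congr (_ + _).
by rewrite mulr_sumr.
Qed.

(** The commutator of |D| with multiplication by h. Its symbol |z| - |z - eta| stays bounded when
    the frequency eta of h is low. *)
Lemma commN_int h f z : nice false h -> nice false f ->
  let F eta := (nrm z - nrm (sub z eta)) * (h eta * f (sub z eta)) in
  tame (mu S) F /\
  mulN (convolve h f) z - convolve h (mulN f) z = fcst S * \int[mu S]_eta F eta.
Proof.
move=> nh nf F.
have t1 := nice_tame_conv z nh nf; have t2 := nice_tame_conv z nh (nice_mulN nf).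
have FE : F = fun eta => nrm z * (h eta * f (sub z eta)) - h eta * mulN f (sub z eta).
  by apply/funext => eta; rewrite /F /mulN; ring.
split; first by rewrite FE; exact: tameD (tameZ _ t1) (tameN t2).
rewrite FE integral_tameB//; last exact: tameZ.
by rewrite integral_tameZ// mulrBr /mulN /convolve mulrCA.
Qed.

End Windows.

(** * The packets *)

Section Packets.
Context {R : realType} (S : freq_space R).
Local Notation V := (freq S).
Local Notation nrm := (@nrm R S).
Local Notation X := (@X R S).
Implicit Types (x y z xi eta : V) (p q r : R).

Lemma X_neg xi : X (neg xi) = - X xi.
Proof. exact: co_neg. Qed.

Lemma box_sum p q r s z eta : box p 0 r eta -> box q 0 s (sub z eta) ->
  box (p + q) 0 (r + s) z.
Proof.
move=> [b1 b2] [d1 d2]; split; first by move: b1 d1; rewrite co_sub; lra.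
by move=> j j0; move: (b2 _ j0) (d2 _ j0); rewrite co_sub; lra.
Qed.

Lemma box_le p r s xi : r <= s -> box p 0 r xi -> box p 0 s xi.
Proof.
move=> rs [b1 b2]; split; first by move: b1; lra.
by move=> j /b2; lra.
Qed.

Variables (N kap : R).
Hypotheses (hN : 20 <= N) (hkap : 0 < kap).

(* The windows of one and two low frequencies, and of one high frequency plus
   zero, one or two low ones. *)
Definition bL : set V := box 1 0 (1 / 10).
Definition bH : set V := box N 0 (1 / 10).
Definition bLL : set V := box 2 0 (2 / 10).
Definition bLH : set V := box (N + 1) 0 (2 / 10).
Definition bW : set V := box (N + 2) 0 (3 / 10).

Definition packet xi : R :=
  \1_bL xi + \1_bL (neg xi) + kap * (\1_bH xi + \1_bH (neg xi)).

(** As the packet is nonnegative, its self-convolutions serve as the common density of upper and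
    lower bounds, two packets in [packet2] and three in [packet3]. *)
Definition packet2 : V -> R := convolve packet packet.
Definition packet3 : V -> R := convolve packet packet2.

Lemma packet_ge0 xi : 0 <= packet xi.
Proof. by rewrite addr_ge0 ?mulr_ge0 ?addr_ge0// ltW. Qed.

Lemma packet_case xi : packet xi != 0 -> [\/ bL xi, bL (neg xi), bH xi | bH (neg xi)].
Proof.
rewrite /packet !indicE.
have [h|_] := boolP (xi \in bL); first by move=> _; apply: Or41; exact: set_mem h.
have [h|_] := boolP (neg xi \in bL); first by move=> _; apply: Or42; exact: set_mem h.
have [h|_] := boolP (xi \in bH); first by move=> _; apply: Or43; exact: set_mem h.
have [h|_] := boolP (neg xi \in bH); first by move=> _; apply: Or44; exact: set_mem h.
by move=> /eqP[]; rewrite /= mulr0n !addr0 mulr0 addr0.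
Qed.

Lemma measurable_packet : measurable_fun setT packet.
Proof.
have mi (A : set V) : measurable A -> measurable_fun setT (\1_A : V -> R).
  by move=> mA; exact: measurable_indic.
have mn (A : set V) : measurable A -> measurable_fun setT (fun xi => \1_A (neg xi) : R).
  move=> mA; have mneg : measurable_fun setT (@neg R S).
    rewrite (_ : @neg R S = sub (sub point point)); first exact: measurable_subr.
    by apply/funext => xi; exact: neg_subE.
  exact: (measurableT_comp (mi A mA) mneg).
apply: measurable_funD.
  by apply: measurable_funD; [apply: mi|apply: mn]; exact: measurable_box.
apply: measurable_funM; first exact: measurable_cst.
by apply: measurable_funD; [apply: mi|apply: mn]; exact: measurable_box.
Qed.

Lemma nice_packet : nice false packet.
Proof.
split=> [||t xi _].
- by apply: (measurableT_comp measurable_packet); exact: measurable_snd.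
- exists (2 + 2 * kap), (N + 1) => t xi _.
  have [->|/packet_case a0n] := eqVneq (packet xi) 0.
    by rewrite normr0 mulr_ge0// addr_ge0// mulr_ge0// ltW.
  have c : cube (N + 1) xi.
    have h := hN.
    case: a0n => -[b1 b2] j; have [->|/b2] := eqVneq j ord0; rewrite ?co_neg ler_norml;
      move: b1; rewrite ?co_neg; lra.
  rewrite indicE mem_set// mulr1 ger0_norm ?packet_ge0// /packet !indicE.
  have le1 (b : bool) : b%:R <= 1 :> R by case: b.
  have ge0 (b : bool) : 0 <= b%:R :> R by case: b.
  move: (le1 (xi \in bL)) (le1 (neg xi \in bL)) (le1 (xi \in bH)) (le1 (neg xi \in bH)).
  move=> u1 u2 u3 u4; apply: lerD; first lra.
  by rewrite [2 * _]mulrC; apply: ler_wpM2l; [exact: ltW|lra].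
- by rewrite expr0 mul1r /packet negK [X in X + _]addrC [X in kap * X]addrC.
Qed.

Lemma nice_packet2 : nice false packet2.
Proof. by apply: niceC; exact: nice_packet. Qed.

Lemma packet2_ge0 xi : 0 <= packet2 xi.
Proof. by apply: convolve_ge0; exact: packet_ge0. Qed.

Lemma packet3_ge0 xi : 0 <= packet3 xi.
Proof. by apply: convolve_ge0; [exact: packet_ge0|exact: packet2_ge0]. Qed.

(** A pointwise substitute for the support of [packet2]: outside it the integrand of every quadratic
    interaction vanishes identically. *)
Definition supp2 z := exists2 eta, packet eta != 0 & packet (sub z eta) != 0.

(** Here and in the next lemmas the first coordinate decides: each frequency is near 1, -1, N or -N,
    and since [20 <= N] the sum leaves only the listed combinations. *)
Lemma split_LL z eta : bLL z -> packet eta != 0 -> packet (sub z eta) != 0 ->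
  bL eta /\ bL (sub z eta).
Proof.
have hN' := hN.
move=> /box_X bz /packet_case u /packet_case v.
by case: u => u; have := box_X u; case: v => v; have := box_X v => h1 h2 //; exfalso;
  move: h1 h2 bz; rewrite ?X_neg ?X_sub; lra.
Qed.

Lemma split_LH z eta : bLH z -> packet eta != 0 -> packet (sub z eta) != 0 ->
  (bL eta /\ bH (sub z eta)) \/ (bH eta /\ bL (sub z eta)).
Proof.
have hN' := hN.
move=> /box_X bz /packet_case u /packet_case v.
case: u => u; have := box_X u; case: v => v; have := box_X v => h1 h2;
  try (by left); try (by right); exfalso;
  move: h1 h2 bz; rewrite ?X_neg ?X_sub; lra.
Qed.

(** Three such frequencies with sum near N + 2 are two low ones and one high one; the alternative is
    whether the one split off is low or high. *)
Lemma split_W z eta : bW z -> packet eta != 0 -> supp2 (sub z eta) ->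
  (bL eta /\ bLH (sub z eta)) \/ (bH eta /\ bLL (sub z eta)).
Proof.
have hN' := hN.
move=> /box_X bz /packet_case u [e /packet_case v /packet_case w].
have e1 : 1 / 10 + 1 / 10 = 2 / 10 :> R by lra.
have LLs : bL e -> bL (sub (sub z eta) e) -> bLL (sub z eta).
  by move=> b1 b2; rewrite /bLL -e1; exact: (box_sum b1 b2).
have LHs : bL e -> bH (sub (sub z eta) e) -> bLH (sub z eta).
  by move=> b1 b2; rewrite /bLH -e1 addrC; exact: (box_sum b1 b2).
have HLs : bH e -> bL (sub (sub z eta) e) -> bLH (sub z eta).
  by move=> b1 b2; rewrite /bLH -e1; exact: (box_sum b1 b2).
case: u => u; case: v => v; case: w => w;
  try (by left; split=> //; auto); try (by right; split=> //; auto); exfalso;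
  have := box_X u; have := box_X v; have := box_X w => h1 h2 h3;
  move: h1 h2 h3 bz; rewrite ?X_neg ?X_sub; lra.
Qed.

Lemma split_W' z eta : bW z -> supp2 eta -> packet (sub z eta) != 0 ->
  (bLH eta /\ bL (sub z eta)) \/ (bLL eta /\ bH (sub z eta)).
Proof.
move=> bz s2 a0z; have := @split_W z (sub z eta) bz a0z; rewrite sub_sub.
by move=> /(_ s2) [[? ?]|[? ?]]; [left|right].
Qed.

Lemma nL xi : bL xi -> 1 <= nrm xi <= 14 / 10.
Proof. by move=> /(@box_nrm _ _ 1 (1 / 10)); lra. Qed.

Lemma nLL xi : bLL xi -> 2 <= nrm xi <= 24 / 10.
Proof. by move=> /(@box_nrm _ _ 2 (2 / 10)); lra. Qed.

Definition high xi := [\/ bH xi, bLH xi | bW xi].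

(** 24/10 is the offset 2 of the farthest window plus the spread 4/10 of [box_nrm], and 112/100 is
    (N + 24/10) / N at N = 20. *)
Lemma nHigh xi : high xi -> N <= nrm xi <= 112 / 100 * N /\ nrm xi <= N + 24 / 10.
Proof.
have hN' := hN.
have N1 : 1 <= N by lra.
have N2 : 1 <= N + 1 by lra.
have N3 : 1 <= N + 2 by lra.
case.
- by move=> /(box_nrm N1) H; have := H; lra.
- by move=> /(box_nrm N2) H; have := H; lra.
- by move=> /(box_nrm N3) H; have := H; lra.
Qed.

Lemma sigma_sym x y : sigma x y = sigma y x.
Proof.
rewrite /sigma mulrC; congr (_ - _); rewrite !dtE; apply: eq_bigr => j _.
by rewrite mulrC.
Qed.

Lemma sigma_LH_H x y : bLH x -> bH y -> `|sigma x y| <= 1.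
Proof.
have hN' := hN.
move=> bx bY; rewrite sigma_sym.
apply: (@sigma_high _ _ N (N + 1) (2 / 10)) => //; try lra.
by apply: (box_le _ bY); lra.
Qed.

Lemma sigma_W_LH x y : bW x -> bLH y -> `|sigma x y| <= 1.
Proof.
have hN' := hN.
move=> bx bY; rewrite sigma_sym.
apply: (@sigma_high _ _ (N + 1) (N + 2) (3 / 10)) => //; try lra.
by apply: (box_le _ bY); lra.
Qed.

Lemma sigma_W_H x y : bW x -> bH y -> `|sigma x y| <= 1.
Proof.
have hN' := hN.
move=> bx bY; rewrite sigma_sym.
apply: (@sigma_high _ _ N (N + 2) (3 / 10)) => //; try lra.
by apply: (box_le _ bY); lra.
Qed.

(** Here and below the constants are r ^ 2 / (2 p), for a box of side r with corner p; on the high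
    windows the excess is O(1/N), so its product with N is bounded. *)
Lemma exL xi : bL xi -> 0 <= excess xi <= 5 / 1000.
Proof. by move=> /box_excess; move/(_ ltr01) => H; have [|] := H _; lra. Qed.

Lemma exLL xi : bLL xi -> 0 <= excess xi <= 1 / 100.
Proof.
have p0 : 0 < 2 :> R by lra.
by move=> /(box_excess p0) H; have [|] := H _; lra.
Qed.

Lemma ex_high q r xi : N <= q -> 0 <= r -> box q 0 r xi ->
  0 <= excess xi /\ excess xi * N <= r ^+ 2 / 2.
Proof.
have hN' := hN.
move=> Nq r0 b; have q0 : 0 < q by lra.
have [e0 er] := box_excess q0 r0 b; split=> //.
have : excess xi * N <= excess xi * q by exact: ler_wpM2l.
lra.
Qed.

Lemma exH xi : bH xi -> 0 <= excess xi /\ excess xi * N <= 5 / 1000.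
Proof.
move=> b; have [||e0 e1] := ex_high _ _ b; rewrite ?lexx//.
split=> //; apply: le_trans e1 _; lra.
Qed.

Lemma exLH xi : bLH xi -> 0 <= excess xi /\ excess xi * N <= 2 / 100.
Proof.
have hN' := hN.
move=> b; have [||e0 e1] := ex_high _ _ b; [lra|lra|].
split=> //; apply: le_trans e1 _; lra.
Qed.

Lemma exW xi : bW xi -> 0 <= excess xi /\ excess xi * N <= 45 / 1000.
Proof.
have hN' := hN.
move=> b; have [||e0 e1] := ex_high _ _ b; [lra|lra|].
split=> //; apply: le_trans e1 _; lra.
Qed.

End Packets.

(** * Bounds on the contributions near the high frequency *)

Section DuhamelBound.
Context {R : realType} (S : freq_space R).
Local Notation V := (freq S).
Local Notation leb1 := (@lebesgue_measure R).

Lemma itv0P (s r : R) : r \in (`[0, s]%classic : set R) -> 0 <= r <= s.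
Proof. by move=> /set_mem /=; rewrite in_itv. Qed.

Lemma duh_bound T (K0 K1 F1 F2 : R -> V -> R) s xi B :
  mult T false K0 -> mult T false K1 -> fam T false F1 -> fam T false F2 ->
  0 <= s <= T ->
  (forall r, 0 <= r <= s -> `|K0 (s - r) xi * F1 r xi + K1 (s - r) xi * F2 r xi| <= B) ->
  `|duh K0 K1 F1 F2 s xi| <= s * B.
Proof.
move=> m0 m1 f1 f2 sT HB; have s0 : 0 <= s by case/andP: sT.
rewrite -[leRHS]mulrC -{2}(integral_itv0 s0).
rewrite -integral_tameZ; last exact: tame_itv0.
apply: le_norm_integral_tame; first exact: (tame_duh_integrand m0 m1 f1 f2 xi sT).
  by apply: tameZ; exact: tame_itv0.
move=> r; rewrite /duh_integrand normrM ger0_norm// mulrC.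
have [rs|nrs] := boolP (r \in (`[0, s]%classic : set R)); last first.
  by rewrite indicE (negbTE nrs) !mulr0.
apply: ler_wpM2r; first by [].
exact/HB/itv0P.
Qed.

Lemma duh_eq0 (K0 K1 F1 F2 : R -> V -> R) s xi :
  (forall r, 0 <= r <= s -> F1 r xi = 0 /\ F2 r xi = 0) -> duh K0 K1 F1 F2 s xi = 0.
Proof.
move=> F0; transitivity (\int[leb1]_r (0 : R)); last first.
  by rewrite Rintegral_cst ?mul0r//; exact: measurableT.
apply: eq_Rintegral => r _; rewrite /duh_integrand.
have [rs|nrs] := boolP (r \in (`[0, s]%classic : set R)); last first.
  by rewrite indicE (negbTE nrs) mul0r.
by have [-> ->] := F0 r (itv0P rs); rewrite !mulr0 addr0 mulr0.
Qed.

End DuhamelBound.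

(** * Pointwise products of weighted amplitudes *)

Section PointBound.
Context {R : realType}.
Implicit Types (x y u a b B : R).

Lemma norm_prod_le x y u a b B : 0 <= a -> 0 <= b -> `|x| * (`|y| * `|u|) <= B ->
  `|x * ((y * a) * (u * b))| <= B * (a * b).
Proof.
move=> a0 b0 H; rewrite !normrM (ger0_norm a0) (ger0_norm b0).
rewrite [leLHS](_ : _ = `|x| * (`|y| * `|u|) * (a * b)); last by ring.
by apply: ler_wpM2r => //; exact: mulr_ge0.
Qed.

Lemma nz_prod x y u a b : x * ((y * a) * (u * b)) != 0 -> a != 0 /\ b != 0.
Proof. by rewrite !mulf_eq0 !negb_or => /and3P[_ /andP[_ ->] /andP[_ ->]]. Qed.

Lemma nz_prod2 x y a b : x * ((y * a) * b) != 0 -> a != 0 /\ b != 0.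
Proof. by rewrite !mulf_eq0 !negb_or => /and3P[_ /andP[_ ->] ->]. Qed.

End PointBound.

(** * The cancellation in the cubic term of G *)

Section Cancellation.
Context {R : realType} (S : freq_space R).
Local Notation V := (freq S).
Local Notation nrm := (@nrm R S).
Local Notation X := (@X R S).
Implicit Types (z eta : V) (a b h f : V -> R).

Definition exc a : V -> R := fun z => excess z * a z.

(** The excess is the difference of an even and an odd function, so [exc a] has no parity and is not
    [nice]; tame and bounded is what convolution requires. *)
Definition tb a := tame (mu S) a /\ exists M, forall z, `|a z| <= M.

Lemma nice_tb e a : nice e a -> tb a.
Proof. by move=> na; split; [exact: nice_tame na|exact: nice_bounded na]. Qed.

Lemma tbB a b : tb a -> tb b -> tb (fun z => a z - b z).
Proof.
move=> [ta [M HM]] [tb [M' HM']]; split; first exact: tameD ta (tameN tb).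
by exists (M + M') => z; apply: le_trans (ler_normB _ _) _; exact: lerD.
Qed.

Lemma tb_exc e a : nice e a -> tb (exc a).
Proof.
move=> na; have := tbB (nice_tb (nice_mulN na)) (nice_tb (nice_mulC ord0 na)).
by congr tb; apply/funext => z; rewrite /exc /excess mulrBl.
Qed.

Lemma tb_conv a b z : tb a -> tb b -> tame (mu S) (fun eta => a eta * b (sub z eta)).
Proof. by move=> [ta _] [tb bb]; exact: tame_conv_integrand. Qed.

Lemma convolveDr a b f : tb a -> tb b -> tb f ->
  convolve a (fun z => b z + f z) = fun z => convolve a b z + convolve a f z.
Proof.
move=> ta tb tf; apply/funext => z; rewrite /convolve -mulrDr; congr (fcst S * _).
rewrite -integral_tameD; [|exact: tb_conv..].
by apply: eq_Rintegral => eta _; rewrite mulrDr.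
Qed.

Lemma mulN_excE a : mulN a = fun z => mulC ord0 a z + exc a z.
Proof. by apply/funext => z; rewrite /mulN /mulC /exc /excess -/(X z); ring. Qed.

Lemma convolve_mulN h a : nice false h -> nice false a ->
  convolve h (mulN a) = fun z => convolve h (mulC ord0 a) z + convolve h (exc a) z.
Proof.
move=> nh na; rewrite mulN_excE convolveDr//; first exact: nice_tb nh.
  exact: nice_tb (nice_mulC ord0 na).
exact: tb_exc na.
Qed.

(* Writing |xi| = xi_1 + excess, the terms with xi_1, a derivation for the
   convolution, cancel. *)
Lemma ampG_excess h p z : nice false h -> nice false p ->
  let f := mulN p in
  ampG h p z = nrm z * (2 * convolve h (exc (convolve h f)) z
    - excess z * convolve h (convolve h f) z - convolve h (convolve h (exc f)) z).
Proof.
move=> nh np f; have nf : nice false f by exact: nice_mulN.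
have nhf : nice false (convolve h f) by exact: niceC.
have nXh := nice_mulC ord0 nh; have nXf := nice_mulC ord0 nf.
have nhXf : nice true (convolve h (mulC ord0 f)) by exact: (nice_conv nh nXf).
have nXhf : nice true (convolve (mulC ord0 h) f) by exact: (nice_conv nXh nf).
have tbe : tb (convolve h (exc f)).
  have := tbB (nice_tb (niceC nh (nice_mulN nf))) (nice_tb nhXf).
  by congr tb; rewrite convolve_mulN//; apply/funext => y; ring.
rewrite /ampG -/f (convolve_mulN nh nhf) (convolve_mulN nh nf) convolveDr//; last 2 first.
- exact: nice_tb nh.
- exact: nice_tb nhXf.
have X1 : mulC ord0 (convolve h f) = fun y => convolve (mulC ord0 h) f y + convolve h (mulC ord0 f) y.
  exact: mulX_convolve.
have X2 := congr1 (fun k => k z) (mulX_convolve nh nhf).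
rewrite /= in X2.
have X3 : convolve h (mulC ord0 (convolve h f)) z =
   convolve h (convolve (mulC ord0 h) f) z + convolve h (convolve h (mulC ord0 f)) z.
  by rewrite X1 convolveDr//; [exact: nice_tb nh|exact: nice_tb nXhf|exact: nice_tb nhXf].
(* What remains of the terms with X is the difference between putting X on the inner and on the
   outer copy of h, which is zero. *)
have X4 : convolve h (convolve (mulC ord0 h) f) z = convolve (mulC ord0 h) (convolve h f) z.
  by rewrite (convolve_left_comm nh nXh nf).
rewrite /mulN X3 (_ : nrm z = X z + excess z); last by rewrite /excess; ring.
move: X2 X4; rewrite X3.
move: (convolve h (convolve h f) z) (convolve (mulC ord0 h) (convolve h f) z)
  (convolve h (convolve (mulC ord0 h) f) z) (convolve h (convolve h (mulC ord0 f)) z)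
  (convolve h (exc (convolve h f)) z) (convolve h (convolve h (exc f)) z) => q1 q2 q3 q4 q5 q6.
move: (X z) (excess z) => x e X2 X4.
transitivity ((x + e) * (2 * (q3 + q4 + q5) - (x + e) * q1 - (q4 + q6))); first by ring.
congr ((x + e) * _); rewrite [(x + e) * q1]mulrDl X2 X4; ring.
Qed.

End Cancellation.

(** * The second variation and the quadratic contributions to the third *)

Section Bounds.
Context {R : realType} (S : freq_space R).
Local Notation V := (freq S).
Local Notation nrm := (@nrm R S).
Variables (g tau P K c t kap : R).
Implicit Types (x y z xi eta : V) (s r B : R).

(* P ^ 2 is the high frequency, [t] the final time; [K], of the order of the
   number of periods, bounds t P ^ 3, and [c] absorbs [g] and [tau]. *)
Record setup : Prop := Setup {
  su_g : 0 <= g ; su_tau : 0 < tau ; su_P : 5 <= P ; su_K : 1 <= K ;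
  su_c : 1 <= c ; su_cg : 12 * g + 12 * tau <= c ; su_sig : Num.sqrt (2 * tau) <= c ;
  su_gP : 3 * g <= tau * P ^+ 4 ; su_t : 0 <= t ; su_tP : t * P ^+ 3 <= K ;
  su_kap : 0 < kap }.

Hypothesis HS : setup.
Local Notation N := (P ^+ 2).
Local Notation a0 := (@packet R S N kap).
Local Notation a2 := (@packet2 R S N kap).
Local Notation a3 := (@packet3 R S N kap).
Local Notation bL := (@bL R S).
Local Notation bLL := (@bLL R S).
Local Notation bH := (@bH R S N).
Local Notation bLH := (@bLH R S N).
Local Notation bW := (@bW R S N).
Local Notation high := (@high R S N).
Local Notation supp2 := (@supp2 R S N kap).
Local Notation ecos := (@ecos R S g tau).
Local Notation eup := (@eup R S g tau).
Local Notation elow := (@elow R S g tau).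
Local Notation om := (@om R S g tau).
Local Notation H1 := (@lin_h R S g tau a0).
Local Notation P1 := (@lin_psi R S g tau a0).
Local Notation N1 := (@quad_h R S g tau a0).
Local Notation N2 := (@quad_psi R S g tau a0).
Local Notation H2 := (@second_h R S g tau a0).
Local Notation P2 := (@second_psi R S g tau a0).

Lemma N20 : 20 <= N.
Proof. by have P5 := su_P HS; nra. Qed.

Lemma na0 : nice false a0. Proof. exact: nice_packet N20 (su_kap HS). Qed.
Lemma na2 : nice false a2. Proof. exact: nice_packet2 N20 (su_kap HS). Qed.
Lemma a0p xi : 0 <= a0 xi. Proof. exact: packet_ge0 (su_kap HS) xi. Qed.
Lemma a2p xi : 0 <= a2 xi. Proof. exact: packet2_ge0 (su_kap HS) xi. Qed.
Lemma a3p xi : 0 <= a3 xi. Proof. exact: packet3_ge0 (su_kap HS) xi. Qed.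

(** Bookkeeping for error monomials: by [su_tP] each factor t pays for three factors P at the price
    of one K; the other exponents may grow, all bases being at least 1. In each use the conditions
    on the exponents hold by computation. *)
Lemma scale_mono i j u m v w : (j <= 3 * i + w)%N -> (i <= m)%N -> (u <= v)%N ->
  t ^+ i * P ^+ j * c ^+ u <= K ^+ m * c ^+ v * P ^+ w.
Proof.
have [_ _ P5 K1 c1 _ _ _ t0 tP _] := HS => jw im uv.
have P1 : 1 <= P by lra.
apply: (@le_trans _ _ (K ^+ m * P ^+ w * c ^+ v)); last by rewrite mulrAC.
apply: ler_pM.
- by rewrite mulr_ge0// exprn_ge0//; lra.
- by rewrite exprn_ge0//; lra.
- apply: (@le_trans _ _ (t ^+ i * P ^+ (3 * i + w))).
    by apply: ler_wpM2l; [exact: exprn_ge0|exact: ler_weXn2l].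
  rewrite exprD mulrA; apply: ler_wpM2r; first by rewrite exprn_ge0//; lra.
  rewrite exprM -exprMn; apply: (@le_trans _ _ (K ^+ i)); last exact: ler_weXn2l.
  by apply: lerXn2r => //; rewrite nnegrE; [rewrite mulr_ge0// exprn_ge0//; lra|lra].
- exact: ler_weXn2l.
Qed.

Lemma om_sq xi : om xi ^+ 2 = nrm xi * (g + tau * nrm xi ^+ 2).
Proof.
have [g0 tau0 _ _ _ _ _ _ _ _ _] := HS.
rewrite sqr_sqrtr//; rewrite mulr_ge0//; first exact: nrm_ge0.
by rewrite addr_ge0// mulr_ge0 ?sqr_ge0// ltW.
Qed.

Lemma elow_le s xi : `|elow s xi| <= `|s| * (tau * nrm xi ^+ 2 + g).
Proof.
have [g0 tau0 _ _ _ _ _ _ _ _ _] := HS.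
rewrite /elow normrN normrM (@ger0_norm _ (_ + g)); last first.
  by rewrite addr_ge0// mulr_ge0 ?sqr_ge0// ltW.
apply: ler_wpM2r; last exact: sinc_le.
by rewrite addr_ge0// mulr_ge0 ?sqr_ge0// ltW.
Qed.

Lemma eup_le s xi : `|eup s xi| <= `|s| * nrm xi.
Proof.
rewrite /eup normrM (ger0_norm (nrm_ge0 xi)); apply: ler_wpM2r; first exact: nrm_ge0.
exact: sinc_le.
Qed.

(** The sine is bounded by 1 and om ^ 2 = |xi| (g + tau |xi| ^ 2), so no factor s appears: at high
    frequencies [elow] is of order om / |xi|, that is P, at all times. *)
Lemma elow_nrm s xi : `|elow s xi| * nrm xi <= om xi.
Proof.
have [g0 tau0 _ _ _ _ _ _ _ _ _] := HS.
have e0 : 0 <= tau * nrm xi ^+ 2 + g.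
  by rewrite addr_ge0// mulr_ge0 ?sqr_ge0// ltW.
rewrite /elow normrN normrM (ger0_norm e0) -mulrA [_ * nrm xi]mulrC.
rewrite [tau * _ + g]addrC -om_sq /sinc; case: eqVneq => [->|w0].
  by rewrite expr0n mulr0.
have wp : 0 < om xi by rewrite lt_neqAle eq_sym w0 om_ge0.
rewrite normrM normfV (gtr0_norm wp) expr2 mulrA mulfVK//.
by rewrite ler_piMl ?om_ge0// sin_max.
Qed.

(** At low frequencies the bound of [sinc] by the time is the better one: psi1 starts from 0 and is
    O(t). The margin in [su_cg] covers |xi| ^ 2 <= 6, which also suits [bLL]. *)
Lemma elow_bL s xi : 0 <= s <= t -> bL xi -> `|elow s xi| <= c * t.
Proof.
have [g0 tau0 _ _ c1 cg _ _ t0 _ _] := HS => /andP[s0 st] /nL nn.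
apply: le_trans (elow_le s xi) _; rewrite ger0_norm// mulrC.
apply: ler_pM => //; first by rewrite addr_ge0// mulr_ge0 ?sqr_ge0// ltW.
have n2 : nrm xi ^+ 2 <= 6 by nra.
have := ler_wpM2l (ltW tau0) n2; lra.
Qed.

Lemma elow_bLL s xi : 0 <= s <= t -> bLL xi -> `|elow s xi| <= c * t.
Proof.
have [g0 tau0 _ _ c1 cg _ _ t0 _ _] := HS => /andP[s0 st] /nLL nn.
apply: le_trans (elow_le s xi) _; rewrite ger0_norm// mulrC.
apply: ler_pM => //; first by rewrite addr_ge0// mulr_ge0 ?sqr_ge0// ltW.
have n2 : nrm xi ^+ 2 <= 6 by nra.
have := ler_wpM2l (ltW tau0) n2; lra.
Qed.

(** The factor 2 absorbs gravity, at most a third of tau P ^ 4 by [su_gP], and the spread of |xi|,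
    since 112/100 (126/100 + 1/3) < 2. *)
Lemma om_high xi : high xi -> om xi <= Num.sqrt (2 * tau) * P ^+ 3.
Proof.
have [g0 tau0 P5 _ _ _ _ gP _ _ _] := HS => /(nHigh N20)[/andP[n1 n2] _].
have P0 : 0 < P by lra.
have sq0 : 0 <= 2 * tau by lra.
rewrite -ler_sqr ?nnegrE ?om_ge0//; last by rewrite mulr_ge0 ?sqrtr_ge0// exprn_ge0// ltW.
rewrite om_sq exprMn (sqr_sqrtr sq0).
have nn : nrm xi ^+ 2 <= 126 / 100 * P ^+ 4.
  have -> : 126 / 100 * P ^+ 4 = 126 / 100 * N ^+ 2 by ring.
  have := N20; move: n1 n2; move: (nrm xi) (N) => n M n1 n2 M20; nra.
have gn : g + tau * nrm xi ^+ 2 <= 16 / 10 * (tau * P ^+ 4).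
  have := ler_wpM2l (ltW tau0) nn; lra.
apply: (@le_trans _ _ (112 / 100 * N * (16 / 10 * (tau * P ^+ 4)))).
  apply: ler_pM => //; first exact: nrm_ge0.
  by rewrite addr_ge0// mulr_ge0 ?sqr_ge0// ltW.
have P6 : 0 <= tau * P ^+ 6 by rewrite mulr_ge0 ?exprn_ge0// ltW.
rewrite [leLHS](_ : _ = 112 / 100 * (16 / 10) * (tau * P ^+ 6)); last by ring.
rewrite [leRHS](_ : _ = 2 * (tau * P ^+ 6)); last by ring.
lra.
Qed.

Lemma om_high_c xi : high xi -> om xi <= c * P ^+ 3.
Proof.
have [g0 tau0 P5 _ _ _ sig _ _ _ _] := HS => /om_high h.
by apply: le_trans h _; apply: ler_wpM2r => //; rewrite exprn_ge0//; lra.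
Qed.

Lemma elow_high s xi : high xi -> `|elow s xi| <= c * P.
Proof.
have [g0 tau0 P5 _ c1 _ sig _ _ _ _] := HS => h.
have [/andP[n1 _] _] := nHigh N20 h.
have P0 : 0 < P by lra.
have N0 : 0 < N by rewrite exprn_gt0.
rewrite -(ler_pM2r N0); apply: (@le_trans _ _ (`|elow s xi| * nrm xi)).
  exact: ler_wpM2l.
apply: le_trans (elow_nrm s xi) _; apply: le_trans (om_high_c h) _.
by rewrite [leLHS](_ : _ = c * P * N)//; ring.
Qed.

Lemma ecos_le s xi : `|ecos s xi| <= 1.
Proof. exact: cos_max. Qed.

(** This lemma and the next three are templates: a window admits few decompositions into packets,
    and it suffices to bound the symbol times the multipliers on each of them. *)
Lemma lin_LL (m y u : V -> R) z B : bLL z -> 0 <= B ->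
  tame (mu S) (fun eta => m eta * ((y eta * a0 eta) * (u (sub z eta) * a0 (sub z eta)))) ->
  (forall eta, bL eta -> bL (sub z eta) -> `|m eta| * (`|y eta| * `|u (sub z eta)|) <= B) ->
  `|fcst S * \int[mu S]_eta
     (m eta * ((y eta * a0 eta) * (u (sub z eta) * a0 (sub z eta))))| <= B * a2 z.
Proof.
move=> bz B0 tF H; apply: int_bound tF na0 na0 B0 a0p a0p _ => eta /nz_prod[n1 n2].
have [l1 l2] := split_LL N20 bz n1 n2.
by apply: norm_prod_le; [exact: a0p|exact: a0p|exact: H].
Qed.

Lemma lin_LH (m y u : V -> R) z B : bLH z -> 0 <= B ->
  tame (mu S) (fun eta => m eta * ((y eta * a0 eta) * (u (sub z eta) * a0 (sub z eta)))) ->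
  (forall eta, bL eta -> bH (sub z eta) -> `|m eta| * (`|y eta| * `|u (sub z eta)|) <= B) ->
  (forall eta, bH eta -> bL (sub z eta) -> `|m eta| * (`|y eta| * `|u (sub z eta)|) <= B) ->
  `|fcst S * \int[mu S]_eta
     (m eta * ((y eta * a0 eta) * (u (sub z eta) * a0 (sub z eta))))| <= B * a2 z.
Proof.
move=> bz B0 tF H H'; apply: int_bound tF na0 na0 B0 a0p a0p _ => eta /nz_prod[n1 n2].
apply: norm_prod_le; [exact: a0p|exact: a0p|].
by have [[? ?]|[? ?]] := split_LH N20 bz n1 n2; [exact: H|exact: H'].
Qed.

Lemma quad_W (m y q : V -> R) z B : bW z -> 0 <= B ->
  tame (mu S) (fun eta => m eta * ((y eta * a0 eta) * q (sub z eta))) ->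
  (forall w, q w != 0 -> supp2 w) ->
  (forall eta, bL eta -> bLH (sub z eta) ->
     `|m eta| * (`|y eta| * `|q (sub z eta)|) <= B * a2 (sub z eta)) ->
  (forall eta, bH eta -> bLL (sub z eta) ->
     `|m eta| * (`|y eta| * `|q (sub z eta)|) <= B * a2 (sub z eta)) ->
  `|fcst S * \int[mu S]_eta (m eta * ((y eta * a0 eta) * q (sub z eta)))| <= B * a3 z.
Proof.
move=> bz B0 tF sq H H'; apply: int_bound tF na0 na2 B0 a0p a2p _ => eta /nz_prod2[n1 /sq n2].
rewrite !normrM (ger0_norm (a0p _)).
rewrite [leLHS](_ : _ = `|m eta| * (`|y eta| * `|q (sub z eta)|) * a0 eta); last by ring.
rewrite [leRHS](_ : _ = B * a2 (sub z eta) * a0 eta); last by ring.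
apply: ler_wpM2r; first exact: a0p.
by have [[? ?]|[? ?]] := split_W N20 bz n1 n2; [exact: H|exact: H'].
Qed.

Lemma quad_W' (m u q : V -> R) z B : bW z -> 0 <= B ->
  tame (mu S) (fun eta => m eta * (q eta * (u (sub z eta) * a0 (sub z eta)))) ->
  (forall w, q w != 0 -> supp2 w) ->
  (forall eta, bLH eta -> bL (sub z eta) ->
     `|m eta| * (`|q eta| * `|u (sub z eta)|) <= B * a2 eta) ->
  (forall eta, bLL eta -> bH (sub z eta) ->
     `|m eta| * (`|q eta| * `|u (sub z eta)|) <= B * a2 eta) ->
  `|fcst S * \int[mu S]_eta (m eta * (q eta * (u (sub z eta) * a0 (sub z eta))))| <= B * a3 z.
Proof.
move=> bz B0 tF sq H H'; rewrite /packet3 (convolveC na0 na2).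
apply: int_bound tF na2 na0 B0 a2p a0p _ => eta.
rewrite !mulf_eq0 !negb_or => /and3P[_ /sq n1 /andP[_ n2]].
rewrite !normrM (ger0_norm (a0p _)).
rewrite [leLHS](_ : _ = `|m eta| * (`|q eta| * `|u (sub z eta)|) * a0 (sub z eta)); last by ring.
rewrite [leRHS]mulrA; apply: ler_wpM2r; first exact: a0p.
by have [[? ?]|[? ?]] := split_W' N20 bz n1 n2; [exact: H|exact: H'].
Qed.

Lemma fH1 : fam t false H1. Proof. exact: fam_lin_h na0. Qed.
Lemma fP1 : fam t false P1. Proof. exact: fam_lin_psi na0. Qed.
Lemma fN1 : fam t false N1. Proof. exact: fam_quad_h na0. Qed.
Lemma fN2 : fam t false N2. Proof. exact: fam_quad_psi na0. Qed.
Lemma fH2 : fam t false H2. Proof. exact: fam_second_h na0. Qed.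
Lemma fP2 : fam t false P2. Proof. exact: fam_second_psi na0. Qed.

Lemma ct_ge0 : 0 <= c * t.
Proof. by have [_ _ _ _ c1 _ _ _ t0 _ _] := HS; rewrite mulr_ge0//; lra. Qed.

Lemma symE_le x y : `|nrm x * nrm y + dt x y| <= 3 * (nrm x * nrm y).
Proof.
apply: le_trans (ler_normD _ _) _; have := abs_dt_le x y.
rewrite (@ger0_norm _ (nrm x * nrm y)) ?mulr_ge0 ?nrm_ge0//; lra.
Qed.

Lemma nrm_prod_le x y (p q : R) : nrm x <= p -> nrm y <= q -> nrm x * nrm y <= p * q.
Proof. by move=> xp yq; apply: ler_pM; rewrite ?nrm_ge0. Qed.

Lemma N1_LL s z : 0 <= s <= t -> bLL z -> `|N1 s z| <= 22 * (c * t) * a2 z.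
Proof.
move=> st bz; have ct0 := ct_ge0.
have [tF E] := ampQ_int z (nice_slice fH1 st) (nice_slice fP1 st).
rewrite /quad_h normrM normrN (ger0_norm (ler0n R 2)) E.
rewrite [leRHS](_ : _ = 2 * (11 * (c * t) * a2 z)); last by ring.
apply: ler_wpM2l => //; apply: (lin_LL bz) tF _; first lra.
move=> eta le lz; have nz := nLL bz; have nn := nL lz.
apply: (@le_trans _ _ (3 * (24 / 10 * (14 / 10)) * (1 * (c * t)))); last lra.
apply: ler_pM; rewrite ?mulr_ge0//; last first.
  by apply: ler_pM => //; [exact: ecos_le|exact: elow_bL].
apply: le_trans (sigma_le _ _) _; apply: ler_wpM2l => //.
by apply: ler_pM; rewrite ?nrm_ge0//; lra.
Qed.

Lemma N2_LL s z : 0 <= s <= t -> bLL z -> `|N2 s z| <= 6 * (c * t) ^+ 2 * a2 z.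
Proof.
move=> st bz; have ct0 := ct_ge0.
have [tF E] := ampE_int z (nice_slice fP1 st) (nice_slice fP1 st).
rewrite /quad_psi E; apply: (lin_LL bz) tF _; first by rewrite mulr_ge0// sqr_ge0.
move=> eta le lz; have ne := nL le; have nn := nL lz.
apply: (@le_trans _ _ (3 * (14 / 10 * (14 / 10)) * ((c * t) * (c * t)))); last first.
  by rewrite -expr2; apply: ler_wpM2r; [exact: sqr_ge0|lra].
apply: ler_pM; rewrite ?mulr_ge0//; last by apply: ler_pM => //; exact: elow_bL.
apply: le_trans (symE_le _ _) _; apply: ler_wpM2l => //.
by apply: nrm_prod_le; lra.
Qed.

(** Two mechanisms. When psi1 is at the high frequency, of size c P, the symbol of two nearly
    parallel high frequencies is at most 1. When psi1 is low, the symbol is O(N) but psi1 is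
    O(t). *)
Lemma N1_LH s z : 0 <= s <= t -> bLH z -> `|N1 s z| <= 10 * (c * K * P) * a2 z.
Proof.
move=> st bz; have ct0 := ct_ge0; have [g0 tau0 P5 K1 c1 _ sig _ t0 tP _] := HS.
have cKP : 0 <= c * K * P by rewrite !mulr_ge0//; lra.
have [tF E] := ampQ_int z (nice_slice fH1 st) (nice_slice fP1 st).
rewrite /quad_h normrM normrN (ger0_norm (ler0n R 2)) E.
rewrite [leRHS](_ : _ = 2 * (5 * (c * K * P) * a2 z)); last by ring.
apply: ler_wpM2l => //; apply: (lin_LH bz) tF _ _; first lra.
- move=> eta le hz.
  apply: (@le_trans _ _ (1 * (1 * (c * P)))); last first.
    have : 1 * (c * P) <= K * (c * P) by apply: ler_wpM2r => //; rewrite mulr_ge0//; lra.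
    lra.
  apply: ler_pM; rewrite ?mulr_ge0//; first exact: (sigma_LH_H N20).
  by apply: ler_pM => //; [exact: ecos_le|apply: elow_high; exact: Or31].
- move=> eta he lz; have [/andP[_ nz] _] := nHigh N20 (Or32 _ _ bz); have nn := nL lz.
  apply: (@le_trans _ _ (3 * (112 / 100 * N * (14 / 10)) * (1 * (c * t)))).
    apply: ler_pM; rewrite ?mulr_ge0//.
      apply: le_trans (sigma_le _ _) _; apply: ler_wpM2l => //.
      by apply: nrm_prod_le => //; lra.
    by apply: ler_pM => //; [exact: ecos_le|exact: elow_bL].
  have := @scale_mono 1 2 1 1 1 1 isT isT isT; rewrite !expr1; lra.
Qed.

(** The symbol |xi| |eta| + xi . eta has no cancellation and is O(N), but one factor psi1 is low,
    hence O(t), and t N P <= K. *)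
Lemma N2_LH s z : 0 <= s <= t -> bLH z -> `|N2 s z| <= 5 * (c ^+ 2 * K) * a2 z.
Proof.
move=> st bz; have ct0 := ct_ge0; have [g0 tau0 P5 K1 c1 _ sig _ t0 tP _] := HS.
have cP : 0 <= c * P by rewrite mulr_ge0//; lra.
have [tF E] := ampE_int z (nice_slice fP1 st) (nice_slice fP1 st).
have fin : 3 * (112 / 100 * N * (14 / 10)) * ((c * t) * (c * P)) <= 5 * (c ^+ 2 * K).
  have c2K : 0 <= c ^+ 2 * K by rewrite mulr_ge0 ?sqr_ge0//; lra.
  by have := @scale_mono 1 3 2 1 2 0 isT isT isT; rewrite !expr1 expr0; lra.
rewrite /quad_psi E; apply: (lin_LH bz) tF _ _.
- by rewrite mulr_ge0// mulr_ge0 ?sqr_ge0//; lra.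
- move=> eta le hz; have ne := nL le; have [/andP[_ nz] _] := nHigh N20 (Or31 _ _ hz).
  apply: le_trans fin; apply: ler_pM; rewrite ?mulr_ge0//.
    apply: le_trans (symE_le _ _) _; apply: ler_wpM2l => //.
    by rewrite mulrC; apply: nrm_prod_le => //; lra.
  by apply: ler_pM => //; [exact: elow_bL|apply: elow_high; exact: Or31].
- move=> eta he lz; have nz := nL lz; have [/andP[_ ne] _] := nHigh N20 (Or31 _ _ he).
  apply: le_trans fin; apply: ler_pM; rewrite ?mulr_ge0//.
    apply: le_trans (symE_le _ _) _; apply: ler_wpM2l => //.
    by apply: nrm_prod_le => //; lra.
  rewrite mulrC; apply: ler_pM => //; [exact: elow_bL|apply: elow_high; exact: Or31].
Qed.

Lemma N_supp s z : 0 <= s <= t -> ~ supp2 z -> N1 s z = 0 /\ N2 s z = 0.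
Proof.
move=> st ns.
have z0 (m y u : V -> R) :
   fcst S * \int[mu S]_eta
     (m eta * ((y eta * a0 eta) * (u (sub z eta) * a0 (sub z eta)))) = 0.
  rewrite (_ : Rintegral _ _ _ = 0) ?mulr0//.
  under eq_Rintegral => eta _.
    rewrite (_ : _ * _ = 0); first over.
    apply/eqP; apply: contra_notT ns => /nz_prod[n1 n2]; by exists eta.
  by rewrite Rintegral_cst ?mul0r//; exact: measurableT.
have [_ E1] := ampQ_int z (nice_slice fH1 st) (nice_slice fP1 st).
have [_ E2] := ampE_int z (nice_slice fP1 st) (nice_slice fP1 st).
by rewrite /quad_h /quad_psi E1 E2; split; [rewrite (z0 (fun eta => sigma z (sub z eta))) mulr0|exact: z0].
Qed.

Lemma sub_itv s r : 0 <= s <= t -> 0 <= r <= s -> 0 <= r <= t /\ 0 <= s - r <= t.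
Proof. lra. Qed.

Lemma HP2_supp s z : 0 <= s <= t -> H2 s z != 0 \/ P2 s z != 0 -> supp2 z.
Proof.
move=> st HP; apply: contrapT => ns.
have N0 r : 0 <= r <= s -> N1 r z = 0 /\ N2 r z = 0.
  by move=> rs; apply: N_supp => //; have [] := sub_itv st rs.
by case: HP => /eqP; apply; exact: duh_eq0.
Qed.

Lemma H2_LL s z : 0 <= s <= t -> bLL z ->
  `|H2 s z| <= 37 * (c ^+ 2 * K ^+ 2 * t ^+ 2) * a2 z.
Proof.
move=> st bz; have [g0 tau0 P5 K1 c1 _ sig _ t0 tP _] := HS.
have ct0 := ct_ge0; have A := a2p z.
(* 22 is the constant of [N1_LL]; 15 exceeds 6 times 24/10, the constant of [N2_LL] times the bound
   of |z|. *)
apply: (@le_trans _ _ (s * ((22 * (c * t) + 15 * (t * (c * t) ^+ 2)) * a2 z))).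
  apply: (duh_bound (mult_ecos S g tau t) (mult_eup S g tau t) fN1 fN2) => // r rs.
  have [rt /andP[sr0 srt]] := sub_itv st rs.
  apply: le_trans (ler_normD _ _) _; rewrite (normrM (ecos (s - r) z)) (normrM (eup (s - r) z)) mulrDl; apply: lerD.
    rewrite -[leRHS]mul1r; apply: ler_pM => //; [exact: ecos_le|exact: N1_LL].
  have e1 : `|eup (s - r) z| <= t * (24 / 10).
    apply: le_trans (eup_le _ _) _; rewrite ger0_norm//.
    by apply: ler_pM; rewrite ?nrm_ge0//; have := nLL bz; lra.
  apply: (@le_trans _ _ (t * (24 / 10) * (6 * (c * t) ^+ 2 * a2 z))).
    by apply: ler_pM => //; exact: N2_LL.
  have : 0 <= t * (c * t) ^+ 2 * a2 z.
    by apply: mulr_ge0 => //; apply: mulr_ge0 => //; exact: sqr_ge0.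
  lra.
rewrite mulrA; apply: ler_wpM2r => //.
apply: (@le_trans _ _ (t * (22 * (c * t) + 15 * (t * (c * t) ^+ 2)))).
  apply: ler_wpM2r; last by case/andP: st.
  by apply: addr_ge0; [lra|have := mulr_ge0 t0 (sqr_ge0 (c * t)); lra].
have m1 := @scale_mono 2 0 2 2 2 0 isT isT isT.
have m2 : 1 * c <= K ^+ 2 * c ^+ 2.
  by apply: ler_pM => //; [lra|nra|nra].
have m3 := ler_wpM2r (sqr_ge0 t) m1; have m4 := ler_wpM2r (sqr_ge0 t) m2.
move: m3 m4; rewrite !expr0; lra.
Qed.

Lemma P2_LL s z : 0 <= s <= t -> bLL z -> `|P2 s z| <= 28 * (c ^+ 2 * t ^+ 3) * a2 z.
Proof.
move=> st bz; have [g0 tau0 P5 K1 c1 _ sig _ t0 tP _] := HS.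
have ct0 := ct_ge0; have A := a2p z.
apply: (@le_trans _ _ (s * (28 * (c * t) ^+ 2 * a2 z))).
  apply: (duh_bound (mult_elow S g tau t) (mult_ecos S g tau t) fN1 fN2) => // r rs.
  have [rt srt] := sub_itv st rs.
  apply: le_trans (ler_normD _ _) _.
  rewrite (normrM (elow (s - r) z)) (normrM (ecos (s - r) z)).
  have u1 : `|elow (s - r) z| * `|N1 r z| <= c * t * (22 * (c * t) * a2 z).
    by apply: ler_pM => //; [exact: elow_bLL|exact: N1_LL].
  have u2 : `|ecos (s - r) z| * `|N2 r z| <= 1 * (6 * (c * t) ^+ 2 * a2 z).
    by apply: ler_pM => //; [exact: ecos_le|exact: N2_LL].
  lra.
rewrite mulrA; apply: ler_wpM2r => //.
apply: (@le_trans _ _ (t * (28 * (c * t) ^+ 2))); last by rewrite le_eqVlt; apply/orP; left; apply/eqP; ring.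
apply: ler_wpM2r; last by case/andP: st.
by rewrite mulr_ge0// exprn_ge0.
Qed.

Lemma H2_LH s z : 0 <= s <= t -> bLH z ->
  `|H2 s z| <= 20 * (c ^+ 2 * K ^+ 2 * P * t) * a2 z.
Proof.
move=> st bz; have [g0 tau0 P5 K1 c1 _ sig _ t0 tP _] := HS.
have ct0 := ct_ge0; have A := a2p z.
have cKP : 0 <= c * K * P by rewrite !mulr_ge0//; lra.
have c2K : 0 <= c ^+ 2 * K by rewrite mulr_ge0 ?sqr_ge0//; lra.
apply: (@le_trans _ _ (s * ((10 * (c * K * P) + 112 / 100 * K * (5 * (c ^+ 2 * K))) * a2 z))).
  apply: (duh_bound (mult_ecos S g tau t) (mult_eup S g tau t) fN1 fN2) => // r rs.
  have [rt /andP[sr0 srt]] := sub_itv st rs.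
  apply: le_trans (ler_normD _ _) _; rewrite (normrM (ecos (s - r) z)) (normrM (eup (s - r) z)) mulrDl; apply: lerD.
    rewrite -[leRHS]mul1r; apply: ler_pM => //; [exact: ecos_le|exact: N1_LH].
  have e1 : `|eup (s - r) z| <= 112 / 100 * K.
    apply: le_trans (eup_le _ _) _; rewrite ger0_norm//.
    have [/andP[_ nz] _] := nHigh N20 (Or32 _ _ bz).
    apply: (@le_trans _ _ (t * (112 / 100 * N))).
      by apply: ler_pM; rewrite ?nrm_ge0.
    have := @scale_mono 1 2 0 1 0 0 isT isT isT; rewrite !expr0 !expr1; lra.
  rewrite -[leRHS]mulrA; apply: ler_pM => //; exact: N2_LH.
rewrite mulrA; apply: ler_wpM2r => //.
apply: (@le_trans _ _ (t * (16 * (c ^+ 2 * K ^+ 2 * P)))); last first.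
  have : 0 <= c ^+ 2 * K ^+ 2 * P * t.
    by rewrite !mulr_ge0// ?exprn_ge0//; lra.
  lra.
have k1 : 0 <= 112 / 100 * K by lra.
apply: ler_pM; [by case/andP: st|apply: addr_ge0; [lra|apply: mulr_ge0 => //; lra]|by case/andP: st|].
have h1 : 1 * (c * K * P) <= (c * K) * (c * K * P).
  by apply: ler_wpM2r => //; nra.
have h2 : (c ^+ 2 * K ^+ 2) * 1 <= (c ^+ 2 * K ^+ 2) * P.
  by apply: ler_wpM2l; [rewrite mulr_ge0 ?sqr_ge0|lra].
lra.
Qed.

Lemma P2_LH s z : 0 <= s <= t -> bLH z ->
  `|P2 s z| <= 15 * (c ^+ 2 * K * N * t) * a2 z.
Proof.
move=> st bz; have [g0 tau0 P5 K1 c1 _ sig _ t0 tP _] := HS.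
have ct0 := ct_ge0; have A := a2p z.
have cP : 0 <= c * P by rewrite mulr_ge0//; lra.
have cKP : 0 <= c * K * P by rewrite !mulr_ge0//; lra.
have c2K : 0 <= c ^+ 2 * K by rewrite mulr_ge0 ?sqr_ge0//; lra.
apply: (@le_trans _ _ (s * (15 * (c ^+ 2 * K * N) * a2 z))).
  apply: (duh_bound (mult_elow S g tau t) (mult_ecos S g tau t) fN1 fN2) => // r rs.
  have [rt srt] := sub_itv st rs.
  apply: le_trans (ler_normD _ _) _.
  rewrite (normrM (elow (s - r) z)) (normrM (ecos (s - r) z)).
  have u1 : `|elow (s - r) z| * `|N1 r z| <= c * P * (10 * (c * K * P) * a2 z).
    by apply: ler_pM => //; [apply: elow_high; exact: Or32|exact: N1_LH].
  have u2 : `|ecos (s - r) z| * `|N2 r z| <= 1 * (5 * (c ^+ 2 * K) * a2 z).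
    by apply: ler_pM => //; [exact: ecos_le|exact: N2_LH].
  have u3 : (c ^+ 2 * K * a2 z) * 1 <= (c ^+ 2 * K * a2 z) * N.
    by apply: ler_wpM2l; [rewrite mulr_ge0|have := N20; lra].
  lra.
rewrite mulrA; apply: ler_wpM2r => //.
apply: (@le_trans _ _ (t * (15 * (c ^+ 2 * K * N)))); last by rewrite le_eqVlt; apply/orP; left; apply/eqP; ring.
apply: ler_wpM2r; last by case/andP: st.
by have := mulr_ge0 c2K (sqr_ge0 P); lra.
Qed.

(** As in [N1_LH]: beside a low h1 the symbol is at most 1, and beside a high h1 the factor N is
    compensated by psi2 = O(t ^ 3). *)
Lemma ampQ_H1P2 s z : 0 <= s <= t -> bW z ->
  `|ampQ (H1 s) (P2 s) z| <= 252 * (c ^+ 2 * K ^+ 3) * a3 z.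
Proof.
move=> st bz; have [g0 tau0 P5 K1 c1 _ sig _ t0 tP _] := HS.
have c2 : 0 <= c ^+ 2 by exact: sqr_ge0.
have [tF ->] := ampQ_int z (nice_slice fH1 st) (nice_slice fP2 st).
have [/andP[_ nz] _] := nHigh N20 (Or33 _ _ bz).
apply: (quad_W (m := fun eta => sigma z (sub z eta)) (y := ecos s) bz) tF _ _ _.
- by have : 0 <= c ^+ 2 * K ^+ 3 by [rewrite mulr_ge0// exprn_ge0//; lra]; lra.
- by move=> w Pw; apply: (@HP2_supp s) => //; right.
- move=> eta le lh.
  apply: (@le_trans _ _ (1 * (1 * (15 * (c ^+ 2 * K * N * t) * a2 (sub z eta))))).
    apply: ler_pM; rewrite ?mulr_ge0//; first exact: (sigma_W_LH N20).
    by apply: ler_pM => //; [exact: ecos_le|exact: P2_LH].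
  rewrite !mul1r; apply: ler_wpM2r; first exact: a2p.
  have m1 := @scale_mono 1 2 2 2 2 0 isT isT isT.
  have m2 := ler_wpM2r (le_trans ler01 K1) m1.
  have : 0 <= c ^+ 2 * K ^+ 3 by rewrite mulr_ge0// exprn_ge0//; lra.
  move: m2; rewrite !expr0 !expr1; lra.
- move=> eta he ll.
  apply: (@le_trans _ _ (3 * (112 / 100 * N * (24 / 10)) * (1 * (28 * (c ^+ 2 * t ^+ 3) * a2 (sub z eta))))).
    apply: ler_pM; rewrite ?mulr_ge0//.
      apply: le_trans (sigma_le _ _) _; apply: ler_wpM2l => //.
      by apply: nrm_prod_le => //; have := nLL ll; lra.
    by apply: ler_pM => //; [exact: ecos_le|exact: P2_LL].
  rewrite mul1r [leLHS]mulrA; apply: ler_wpM2r; first exact: a2p.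
  have m1 := @scale_mono 3 2 2 3 2 0 isT isT isT.
  have : 0 <= c ^+ 2 * K ^+ 3 by rewrite mulr_ge0// exprn_ge0//; lra.
  move: m1; rewrite !expr0; lra.
Qed.

Lemma ampQ_H2P1 s z : 0 <= s <= t -> bW z ->
  `|ampQ (H2 s) (P1 s) z| <= 100 * (c ^+ 3 * K ^+ 4) * a3 z.
Proof.
move=> st bz; have [g0 tau0 P5 K1 c1 _ sig _ t0 tP _] := HS.
have c3 : 0 <= c ^+ 3 by rewrite exprn_ge0//; lra.
have c3K : 0 <= c ^+ 3 * K ^+ 4 by rewrite mulr_ge0// exprn_ge0//; lra.
have [tF ->] := ampQ_int z (nice_slice fH2 st) (nice_slice fP1 st).
have [/andP[_ nz] _] := nHigh N20 (Or33 _ _ bz).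
apply: (quad_W' (m := fun eta => sigma z (sub z eta)) (u := elow s) bz) tF _ _ _.
- lra.
- by move=> w Pw; apply: (@HP2_supp s) => //; left.
- move=> eta lh le.
  apply: (@le_trans _ _ (3 * (112 / 100 * N * (14 / 10)) *
     (20 * (c ^+ 2 * K ^+ 2 * P * t) * a2 eta * (c * t)))).
    apply: ler_pM; rewrite ?mulr_ge0//.
      apply: le_trans (sigma_le _ _) _; apply: ler_wpM2l => //.
      by apply: nrm_prod_le => //; have := nL le; lra.
    by apply: ler_pM => //; [exact: H2_LH|exact: elow_bL].
  rewrite [leLHS](_ : _ = 3 * (112 / 100 * N * (14 / 10)) *
     (20 * (c ^+ 2 * K ^+ 2 * P * t) * (c * t)) * a2 eta); last by ring.
  apply: ler_wpM2r; first exact: a2p.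
  have m1 := @scale_mono 2 3 3 2 3 0 isT isT isT.
  have m2 := ler_wpM2r (sqr_ge0 K) m1.
  move: m2; rewrite !expr0; lra.
- move=> eta ll he.
  apply: (@le_trans _ _ (1 * (37 * (c ^+ 2 * K ^+ 2 * t ^+ 2) * a2 eta * (c * P)))).
    apply: ler_pM; rewrite ?mulr_ge0//; first exact: (sigma_W_H N20).
    by apply: ler_pM => //; [exact: H2_LL|apply: elow_high; exact: Or31].
  rewrite [leLHS](_ : _ = 37 * (c ^+ 2 * K ^+ 2 * t ^+ 2) * (c * P) * a2 eta); last by ring.
  apply: ler_wpM2r; first exact: a2p.
  have m1 := @scale_mono 2 1 3 2 3 0 isT isT isT.
  have m2 := ler_wpM2r (sqr_ge0 K) m1.
  move: m2; rewrite !expr0 !expr1; lra.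
Qed.

Lemma ampE_P1P2 s z : 0 <= s <= t -> bW z ->
  `|ampE (P1 s) (P2 s) z| <= 252 * (c ^+ 3 * K ^+ 3) * a3 z.
Proof.
move=> st bz; have [g0 tau0 P5 K1 c1 _ sig _ t0 tP _] := HS.
have c3 : 0 <= c ^+ 3 by rewrite exprn_ge0//; lra.
have c3K : 0 <= c ^+ 3 * K ^+ 3 by rewrite mulr_ge0// exprn_ge0//; lra.
have [tF ->] := ampE_int z (nice_slice fP1 st) (nice_slice fP2 st).
apply: (quad_W (m := fun eta => nrm eta * nrm (sub z eta) + dt eta (sub z eta))
  (y := elow s) bz) tF _ _ _.
- lra.
- by move=> w Pw; apply: (@HP2_supp s) => //; right.
- move=> eta le lh.
  apply: (@le_trans _ _ (3 * (14 / 10 * (112 / 100 * N)) *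
     (c * t * (15 * (c ^+ 2 * K * N * t) * a2 (sub z eta))))).
    apply: ler_pM; rewrite ?mulr_ge0//.
      apply: le_trans (symE_le _ _) _; apply: ler_wpM2l => //.
      have [/andP[_ nh] _] := nHigh N20 (Or32 _ _ lh).
      by apply: nrm_prod_le => //; have := nL le; lra.
    by apply: ler_pM => //; [exact: elow_bL|exact: P2_LH].
  rewrite [leLHS](_ : _ = 3 * (14 / 10 * (112 / 100 * N)) *
     (c * t * (15 * (c ^+ 2 * K * N * t))) * a2 (sub z eta)); last by ring.
  apply: ler_wpM2r; first exact: a2p.
  have m1 := @scale_mono 2 4 3 2 3 0 isT isT isT.
  have m2 := ler_wpM2r (le_trans ler01 K1) m1.
  move: m2; rewrite !expr0; lra.
- move=> eta he ll.
  apply: (@le_trans _ _ (3 * (112 / 100 * N * (24 / 10)) *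
     (c * P * (28 * (c ^+ 2 * t ^+ 3) * a2 (sub z eta))))).
    apply: ler_pM; rewrite ?mulr_ge0//.
      apply: le_trans (symE_le _ _) _; apply: ler_wpM2l => //.
      have [/andP[_ nh] _] := nHigh N20 (Or31 _ _ he).
      by apply: nrm_prod_le => //; have := nLL ll; lra.
    by apply: ler_pM => //; [apply: elow_high; exact: Or31|exact: P2_LL].
  rewrite [leLHS](_ : _ = 3 * (112 / 100 * N * (24 / 10)) *
     (c * P * (28 * (c ^+ 2 * t ^+ 3))) * a2 (sub z eta)); last by ring.
  apply: ler_wpM2r; first exact: a2p.
  have m1 := @scale_mono 3 3 3 3 3 0 isT isT isT.
  move: m1; rewrite !expr0; lra.
Qed.

End Bounds.

Lemma add_excess_bounds (R : realType) (q r a : R) : 0 <= r * a ->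
  2 * ((2 / 100 * q + 2 / 100 * r) * a) + (45 / 1000 * q + 1 / 100 * r) * a +
  (5 / 1000 * q + 7 / 1000 * r) * a <= (9 / 100 * q + 6 / 100 * r) * a.
Proof. lra. Qed.

Lemma small_excess_mul (R : realType) (x u N q r : R) : 0 <= x -> x * N <= u ->
  20 <= N -> 0 <= q -> 0 <= r -> x * (q * N + 14 / 10 * r) <= u * (q + 7 / 100 * r).
Proof.
move=> x0 xu N20 q0 r0; have xN := ler_wpM2l x0 N20.
have h1 := ler_wpM2r q0 xu; have h2 := ler_wpM2r r0 (le_trans xN xu); lra.
Qed.

(** * The cubic terms coming from the expansion of the Dirichlet-Neumann operator *)

Section Cubic.
Context {R : realType} (S : freq_space R).
Local Notation V := (freq S).
Local Notation nrm := (@nrm R S).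
Variables (g tau P K c t kap : R).
Implicit Types (x y z xi eta : V) (s r B : R).

Hypothesis HS : setup g tau P K c t kap.
Local Notation N := (P ^+ 2).
Local Notation a0 := (@packet R S N kap).
Local Notation a2 := (@packet2 R S N kap).
Local Notation a3 := (@packet3 R S N kap).
Local Notation bL := (@bL R S).
Local Notation bLL := (@bLL R S).
Local Notation bH := (@bH R S N).
Local Notation bLH := (@bLH R S N).
Local Notation bW := (@bW R S N).
Local Notation high := (@high R S N).
Local Notation supp2 := (@supp2 R S N kap).
Local Notation ecos := (@ecos R S g tau).
Local Notation elow := (@elow R S g tau).
Local Notation H1 := (@lin_h R S g tau a0).
Local Notation P1 := (@lin_psi R S g tau a0).

Lemma mulN_P1E s : mulN (P1 s) = fun xi => nrm xi * elow s xi * a0 xi.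
Proof. by apply/funext => xi; rewrite /mulN /lin_psi mulrA. Qed.

Lemma conv_LL (y u : V -> R) z B : bLL z -> 0 <= B ->
  tame (mu S) (fun eta => y eta * a0 eta * (u (sub z eta) * a0 (sub z eta))) ->
  (forall eta, bL eta -> bL (sub z eta) -> `|y eta| * `|u (sub z eta)| <= B) ->
  `|convolve (fun xi => y xi * a0 xi) (fun xi => u xi * a0 xi) z| <= B * a2 z.
Proof.
move=> bz B0 tF H.
have E1 (F : V -> R) : (fun eta => 1 * F eta) = F by apply/funext => eta; rewrite mul1r.
have := @lin_LL _ _ _ _ _ _ _ _ _ HS (fun=> 1) y u z B bz B0; rewrite E1.
by apply=> // eta b1 b2; rewrite normr1 mul1r; exact: H.
Qed.

Lemma conv_LH (y u : V -> R) z B : bLH z -> 0 <= B ->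
  tame (mu S) (fun eta => y eta * a0 eta * (u (sub z eta) * a0 (sub z eta))) ->
  (forall eta, bL eta -> bH (sub z eta) -> `|y eta| * `|u (sub z eta)| <= B) ->
  (forall eta, bH eta -> bL (sub z eta) -> `|y eta| * `|u (sub z eta)| <= B) ->
  `|convolve (fun xi => y xi * a0 xi) (fun xi => u xi * a0 xi) z| <= B * a2 z.
Proof.
move=> bz B0 tF H H'.
have E1 (F : V -> R) : (fun eta => 1 * F eta) = F by apply/funext => eta; rewrite mul1r.
have := @lin_LH _ _ _ _ _ _ _ _ _ HS (fun=> 1) y u z B bz B0; rewrite E1.
by apply=> // eta b1 b2; rewrite normr1 mul1r; [exact: H|exact: H'].
Qed.

Lemma conv_W (y q : V -> R) z B : bW z -> 0 <= B ->
  tame (mu S) (fun eta => y eta * a0 eta * q (sub z eta)) ->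
  (forall xi, q xi != 0 -> supp2 xi) ->
  (forall eta, bL eta -> bLH (sub z eta) ->
     `|y eta| * `|q (sub z eta)| <= B * a2 (sub z eta)) ->
  (forall eta, bH eta -> bLL (sub z eta) ->
     `|y eta| * `|q (sub z eta)| <= B * a2 (sub z eta)) ->
  `|convolve (fun xi => y xi * a0 xi) q z| <= B * a3 z.
Proof.
move=> bz B0 tF sq H H'.
have E1 (F : V -> R) : (fun eta => 1 * F eta) = F by apply/funext => eta; rewrite mul1r.
have := @quad_W _ _ _ _ _ _ _ _ _ HS (fun=> 1) y q z B bz B0; rewrite E1.
by apply=> // eta b1 b2; rewrite normr1 mul1r; [exact: H|exact: H'].
Qed.

Lemma int_supp (m y u : V -> R) z :
  fcst S * \int[mu S]_eta
     (m eta * ((y eta * a0 eta) * (u (sub z eta) * a0 (sub z eta)))) != 0 -> supp2 z.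
Proof.
move=> H; apply: contrapT => ns; move/eqP: H; apply.
rewrite (_ : Rintegral _ _ _ = 0) ?mulr0//.
under eq_Rintegral => eta _.
  rewrite (_ : _ * _ = 0); first over.
  apply/eqP; apply: contra_notT ns => /nz_prod[n1 n2]; by exists eta.
by rewrite Rintegral_cst ?mul0r//; exact: measurableT.
Qed.

Lemma conv_supp (y u : V -> R) z :
  convolve (fun xi => y xi * a0 xi) (fun xi => u xi * a0 xi) z != 0 -> supp2 z.
Proof.
have E1 (F : V -> R) : (fun eta => 1 * F eta) = F by apply/funext => eta; rewrite mul1r.
by have := @int_supp (fun=> 1) y u z; rewrite E1.
Qed.

Lemma w_L s xi : 0 <= s <= t -> bL xi -> `|nrm xi * elow s xi| <= 14 / 10 * (c * t).
Proof.
move=> st b; rewrite normrM (ger0_norm (nrm_ge0 _)).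
by apply: ler_pM; rewrite ?nrm_ge0//; [have := nL b; lra|exact: (elow_bL HS)].
Qed.

Lemma w_high s xi : high xi -> `|nrm xi * elow s xi| <= Num.sqrt (2 * tau) * P * N.
Proof.
move=> b; rewrite normrM (ger0_norm (nrm_ge0 _)) mulrC.
apply: le_trans (elow_nrm HS s xi) _.
by rewrite -mulrA -exprS; exact: (om_high HS).
Qed.

Lemma w_high_c s xi : high xi -> `|nrm xi * elow s xi| <= c * P ^+ 3.
Proof.
move=> b; rewrite normrM (ger0_norm (nrm_ge0 _)) mulrC.
apply: le_trans (elow_nrm HS s xi) _; exact: (om_high_c HS).
Qed.

Lemma nw s : 0 <= s <= t -> nice false (fun xi => nrm xi * elow s xi * a0 xi).
Proof. by move=> st; rewrite -mulN_P1E; apply/nice_mulN/(nice_slice (fP1 S HS) st). Qed.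

Lemma nH1 s : 0 <= s <= t -> nice false (H1 s).
Proof. exact: nice_slice (fH1 S HS). Qed.

Lemma nP1 s : 0 <= s <= t -> nice false (P1 s).
Proof. exact: nice_slice (fP1 S HS). Qed.

(** h Lap psi + |D|(h |D| psi) is the commutator of |D| and h applied to |D| psi, so a difference of
    norms replaces |xi|. When the outer |D| psi1 is low it is O(t), and when it is high the
    commutator is O(t); either way P ^ 3 is absorbed. *)
Lemma ampP_bound s z : 0 <= s <= t -> bW z ->
  `|ampP (H1 s) (P1 s) z| <= 5 * (c ^+ 2 * K ^+ 2) * a3 z.
Proof.
move=> st bz; have [g0 tau0 P5 K1 c1 _ sig _ t0 tP _] := HS.
have ct0 := ct_ge0 HS; have N20 := N20 HS.
have h1 := nH1 st; have hw := nw st.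
have c2K : 0 <= c ^+ 2 * K ^+ 2 by rewrite mulr_ge0 ?sqr_ge0.
set u := fun xi => mulN (convolve (H1 s) (mulN (P1 s))) xi -
   convolve (H1 s) (mulN (mulN (P1 s))) xi.
have uE xi : let F eta := (nrm xi - nrm (sub xi eta)) *
    ((ecos s eta * a0 eta) * ((nrm (sub xi eta) * elow s (sub xi eta)) * a0 (sub xi eta))) in
    tame (mu S) F /\ u xi = fcst S * \int[mu S]_eta F eta.
  by have := commN_int xi h1 hw; rewrite -mulN_P1E; apply.
have usupp xi : u xi != 0 -> supp2 xi.
  by have [_ ->] := uE xi; apply: (@int_supp _ _ (fun xi => nrm xi * elow s xi)).
have uLL xi : bLL xi -> `|u xi| <= 34 / 10 * (c * t) * a2 xi.
  move=> b; have [tF ->] := uE xi.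
  apply: (@lin_LL _ _ _ _ _ _ _ _ _ HS _ _ (fun xi => nrm xi * elow s xi)) tF _ => //; first lra.
  move=> eta b1 b2; have n1 := nLL b; have n2 := nL b2.
  have d : `|nrm xi - nrm (sub xi eta)| <= 24 / 10 by rewrite ler_norml; lra.
  apply: (@le_trans _ _ (24 / 10 * (1 * (14 / 10 * (c * t))))); last lra.
  by apply: ler_pM; rewrite ?mulr_ge0//; apply: ler_pM => //; [exact: ecos_le|exact: w_L].
have uLH xi : bLH xi -> `|u xi| <= 3 * (c * K * P ^+ 3) * a2 xi.
  move=> b; have [tF ->] := uE xi.
  have cP : 0 <= c * P ^+ 3 by rewrite mulr_ge0 ?exprn_ge0//; lra.
  have cK : 1 * (c * P ^+ 3) <= K * (c * P ^+ 3) by exact: ler_wpM2r.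
  have [/andP[nx1 nx2] nx3] := nHigh N20 (Or32 _ _ b).
  apply: (@lin_LH _ _ _ _ _ _ _ _ _ HS _ _ (fun xi => nrm xi * elow s xi)) tF _ _ => //; first lra.
  - move=> eta b1 b2; have [/andP[n1 n2] n3] := nHigh N20 (Or31 _ _ b2).
    have d : `|nrm xi - nrm (sub xi eta)| <= 24 / 10 by rewrite ler_norml; lra.
    apply: (@le_trans _ _ (24 / 10 * (1 * (c * P ^+ 3)))); last lra.
    apply: ler_pM; rewrite ?mulr_ge0//; apply: ler_pM => //; first exact: ecos_le.
    by apply: w_high_c; exact: Or31.
  - move=> eta b1 b2; have n2 := nL b2.
    have d : `|nrm xi - nrm (sub xi eta)| <= 112 / 100 * N by rewrite ler_norml; lra.
    apply: (@le_trans _ _ (112 / 100 * N * (1 * (14 / 10 * (c * t))))).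
      by apply: ler_pM; rewrite ?mulr_ge0//; apply: ler_pM => //; [exact: ecos_le|exact: w_L].
    have m1 := @scale_mono _ _ _ _ _ _ _ _ HS 1 2 1 1 1 3 isT isT isT.
    by move: m1; rewrite !expr1; lra.
have nu : nice false u.
  by apply: niceB; do ?[apply: nice_mulN => //|apply: niceC => //|exact: nP1].
rewrite /ampP -/u mulN_P1E; apply: conv_W => //.
- lra.
- exact: nice_tame_conv z hw nu.
- move=> eta b1 b2.
  apply: (@le_trans _ _ (14 / 10 * (c * t) * (3 * (c * K * P ^+ 3) * a2 (sub z eta)))).
    by apply: ler_pM => //; [exact: w_L|exact: uLH].
  rewrite [leLHS]mulrA; apply: ler_wpM2r; first exact: (a2p HS).
  have m1 := @scale_mono _ _ _ _ _ _ _ _ HS 1 3 2 1 2 0 isT isT isT.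
  have m2 := ler_wpM2r (le_trans ler01 K1) m1.
  by move: m2; rewrite !expr0 !expr1; lra.
- move=> eta b1 b2.
  apply: (@le_trans _ _ (c * P ^+ 3 * (34 / 10 * (c * t) * a2 (sub z eta)))).
    by apply: ler_pM => //; [apply: w_high_c; exact: Or31|exact: uLL].
  rewrite [leLHS]mulrA; apply: ler_wpM2r; first exact: (a2p HS).
  have m1 := @scale_mono _ _ _ _ _ _ _ _ HS 1 3 2 2 2 0 isT isT isT.
  by move: m1; rewrite !expr0 !expr1; lra.
Qed.

Local Notation rho := (Num.sqrt (2 * tau) * P).

Lemma rho_ge0 : 0 <= rho.
Proof. by have [_ _ P5 _ _ _ _ _ _ _ _] := HS; rewrite mulr_ge0 ?sqrtr_ge0//; lra. Qed.

Lemma excE (u : V -> R) : exc (fun xi => u xi * a0 xi) = fun xi => excess xi * u xi * a0 xi.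
Proof. by apply/funext => xi; rewrite /exc mulrA. Qed.

(** Each of the three pieces in [ampG_excess] carries one excess. At high frequencies it is O(1/N)
    against |D| psi1 of size rho N, so rho survives with the coefficient 2 (2/100) + 45/1000 +
    5/1000 = 9/100, and no power of P is gained over the secular term. *)
Lemma ampG_bound s z : 0 <= s <= t -> bW z ->
  `|ampG (H1 s) (P1 s) z| <= nrm z * (9 / 100 * rho + 6 / 100 * (c * t)) * a3 z.
Proof.
move=> st bz.
have ct0 := ct_ge0 HS; have N20 := N20 HS; have r0 := rho_ge0.
have N0 : 0 < N by lra.
have h1 := nH1 st; have hw := nw st.
rewrite ampG_excess; [|exact: nH1|exact: nP1].
rewrite mulN_P1E; set f := fun xi => _; set F := convolve (H1 s) f.
set e := convolve (H1 s) (exc f).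
have FLL xi : bLL xi -> `|F xi| <= 14 / 10 * (c * t) * a2 xi.
  move=> b; apply: (conv_LL b _ (nice_tame_conv xi h1 hw)); first lra.
  move=> eta b1 b2; rewrite -[leRHS]mul1r.
  by apply: ler_pM => //; [exact: ecos_le|exact: w_L].
have FLH xi : bLH xi -> `|F xi| <= (rho * N + 14 / 10 * (c * t)) * a2 xi.
  move=> b; have rN : 0 <= rho * N by rewrite mulr_ge0 // ltW.
  apply: (conv_LH b _ (nice_tame_conv xi h1 hw)); first lra.
    move=> eta b1 b2; rewrite -[leRHS]mul1r.
    apply: ler_pM => //; first exact: ecos_le.
    by apply: (le_trans (w_high _ (Or31 _ _ b2))); lra.
  move=> eta b1 b2; rewrite -[leRHS]mul1r.
  apply: ler_pM => //; first exact: ecos_le.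
  by apply: (le_trans (w_L st b2)); lra.
have tex : tb (exc f) by exact: tb_exc hw.
have tc xi := tb_conv xi (nice_tb h1) tex; rewrite /f excE in tc.
have te : tb e.
  have := tbB (nice_tb (niceC h1 (nice_mulN hw)))
     (nice_tb (nice_conv h1 (nice_mulC ord0 hw))).
  by congr tb; rewrite /e convolve_mulN//; apply/funext => y; ring.
have exN (x y u : R) : 0 <= x -> x * N <= u -> 0 <= y -> x * (y * N) <= u * y.
  by move=> x0 xu y0; rewrite [leLHS](_ : _ = x * N * y); [exact: ler_wpM2r|ring].
have eLL xi : bLL xi -> `|e xi| <= 7 / 1000 * (c * t) * a2 xi.
  move=> b; rewrite /e excE; apply: (conv_LL b _ (tc xi)); first lra.
  move=> eta b1 b2; have /andP[x0 x1] := exL b2.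
  rewrite normrM (ger0_norm x0).
  apply: (@le_trans _ _ (1 * (5 / 1000 * (14 / 10 * (c * t))))); last lra.
  by apply: ler_pM; rewrite ?mulr_ge0//; [exact: ecos_le|apply: ler_pM => //; exact: w_L].
have eLH xi : bLH xi -> `|e xi| <= (5 / 1000 * rho + 7 / 1000 * (c * t)) * a2 xi.
  move=> b; rewrite /e excE; apply: (conv_LH b _ (tc xi)); first lra.
  - move=> eta b1 b2; have [x0 x1] := exH N20 b2.
    rewrite normrM (ger0_norm x0).
    apply: (@le_trans _ _ (1 * (5 / 1000 * rho))); last lra.
    apply: ler_pM; rewrite ?mulr_ge0//; first exact: ecos_le.
    apply: le_trans (exN _ _ _ x0 x1 r0); apply: ler_wpM2l => //.
    exact: w_high (Or31 _ _ b2).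
  - move=> eta b1 b2; have /andP[x0 x1] := exL b2.
    rewrite normrM (ger0_norm x0).
    apply: (@le_trans _ _ (1 * (5 / 1000 * (14 / 10 * (c * t))))); last lra.
    by apply: ler_pM; rewrite ?mulr_ge0//; [exact: ecos_le|apply: ler_pM => //; exact: w_L].
have nF := niceC h1 hw; rewrite -/f -/F in nF.
have Fs xi : F xi != 0 -> supp2 xi by exact: conv_supp.
have es xi : e xi != 0 -> supp2 xi by rewrite /e excE; exact: conv_supp.
have a3z : 0 <= a3 z by exact: (a3p HS).
clearbody e F.
have tcW (q : V -> R) : tb q -> tame (mu S) (fun eta => ecos s eta * a0 eta * q (sub z eta)).
  by move=> tq; have := tb_conv z (nice_tb h1) tq; rewrite /lin_h; apply.
have B1 : `|convolve (H1 s) (exc F) z| <= (2 / 100 * rho + 2 / 100 * (c * t)) * a3 z.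
  apply: (conv_W bz _ (tcW _ (tb_exc nF))); first lra.
  - by move=> xi; rewrite /exc mulf_eq0 negb_or => /andP[_ /Fs].
  - move=> eta b1 b2; have [x0 x1] := exLH N20 b2; have A := a2p HS (sub z eta).
    rewrite /exc normrM (ger0_norm x0).
    apply: (@le_trans _ _ (1 * (excess (sub z eta) * ((rho * N + 14 / 10 * (c * t)) * a2 (sub z eta))))).
      apply: ler_pM; rewrite ?mulr_ge0//; first exact: ecos_le.
      by apply: ler_wpM2l => //; exact: FLH.
    rewrite mul1r mulrA; apply: ler_wpM2r => //.
    by apply: le_trans (small_excess_mul x0 x1 N20 r0 ct0) _; lra.
  - move=> eta b1 b2; have /andP[x0 x1] := exLL b2; have A := a2p HS (sub z eta).
    rewrite /exc normrM (ger0_norm x0).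
    apply: (@le_trans _ _ (1 * (1 / 100 * (14 / 10 * (c * t) * a2 (sub z eta))))).
      apply: ler_pM; rewrite ?mulr_ge0//; first exact: ecos_le.
      by apply: ler_pM => //; exact: FLL.
    rewrite mul1r mulrA; apply: ler_wpM2r => //; lra.
have B2 : `|convolve (H1 s) F z| <= (rho * N + 14 / 10 * (c * t)) * a3 z.
  have rN : 0 <= rho * N by rewrite mulr_ge0 // ltW.
  apply: (conv_W bz _ (tcW _ (nice_tb nF)) Fs); first lra.
  - move=> eta b1 b2; rewrite -[leRHS]mul1r.
    by apply: ler_pM => //; [exact: ecos_le|exact: FLH].
  - move=> eta b1 b2; rewrite -[leRHS]mul1r.
    apply: ler_pM => //; first exact: ecos_le.
    apply: (le_trans (FLL _ b2)); apply: ler_wpM2r; [exact: (a2p HS)|lra].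
have B3 : `|convolve (H1 s) e z| <= (5 / 1000 * rho + 7 / 1000 * (c * t)) * a3 z.
  apply: (conv_W bz _ (tcW _ te) es); first lra.
  - move=> eta b1 b2; rewrite -[leRHS]mul1r.
    by apply: ler_pM => //; [exact: ecos_le|exact: eLH].
  - move=> eta b1 b2; rewrite -[leRHS]mul1r.
    apply: ler_pM => //; first exact: ecos_le.
    apply: (le_trans (eLL _ b2)); apply: ler_wpM2r; [exact: (a2p HS)|lra].
have [x0 x1] := exW N20 bz.
have B4 : `|excess z * convolve (H1 s) F z| <= (45 / 1000 * rho + 1 / 100 * (c * t)) * a3 z.
  rewrite normrM (ger0_norm x0).
  apply: (le_trans (ler_wpM2l x0 B2)); rewrite mulrA; apply: ler_wpM2r => //.
  by apply: le_trans (small_excess_mul x0 x1 N20 r0 ct0) _; lra.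
rewrite normrM (ger0_norm (nrm_ge0 _)) -mulrA; apply: ler_wpM2l; first exact: nrm_ge0.
have tri (q1 q3 q4 : R) : `|2 * q1 - q4 - q3| <= 2 * `|q1| + `|q4| + `|q3|.
  apply: le_trans (ler_normB _ _) _; rewrite lerD2r.
  by apply: le_trans (ler_normB _ _) _; rewrite lerD2r normrM ger0_norm.
apply: le_trans (tri _ _ _) _.
have ca := mulr_ge0 ct0 a3z.
have := lerD (lerD (ler_wpM2l (ler0n R 2) B1) B4) B3; move/le_trans; apply.
exact: add_excess_bounds.
Qed.

End Cubic.

(** * The mean of a squared cosine over whole periods *)

Section CosineSquare.
Context {R : realType}.
Local Notation leb1 := (@lebesgue_measure R).
Implicit Types (r s t w : R).

(** Because t w is a multiple of 2 pi, the propagator over the remaining time t - s is in phase with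
    the linear solution at time s. *)
Lemma cos_reflect t w (k : nat) s : t * w = pi *+ 2 *+ k ->
  cos ((t - s) * w) = cos (s * w).
Proof.
move=> tw; rewrite mulrBl tw addrC periodicn ?cosN//; exact: cosD2pi.
Qed.

Lemma is_derive_cos_sqr_prim w r : w != 0 ->
  is_derive r (1 : R) (fun r => r / 2 + sin (r * w) * cos (r * w) / (2 * w))
    (cos (r * w) ^+ 2).
Proof.
move=> w0.
have wP : is_derive r (1 : R) (fun r : R => r * w) w.
  by apply: is_derive_eq; rewrite scaler0 add0r /GRing.scale/= mulr1.
have cP := @is_derive1_comp _ cos ( *%R^~ w) r _ _ (is_derive_cos _) wP.
have sP := @is_derive1_comp _ sin ( *%R^~ w) r _ _ (is_derive_sin _) wP.
have dP := is_deriveD (is_deriveZ 2^-1 (is_derive_id r (1 : R)))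
  (is_deriveZ (2 * w)^-1 (is_deriveM sP cP)).
rewrite (_ : (fun r => _) = 2^-1 *: id + (2 * w)^-1 *: ((sin \o *%R^~ w) * (cos \o *%R^~ w))); last first.
  by apply/funext => x; rewrite [x / 2]mulrC [_ / (2 * w)]mulrC.
apply: (is_derive_eq dP); rewrite /GRing.scale/=.
have := cos2Dsin2 (r * w); move: (cos _) (sin _) => c s cs.
have -> : 2^-1 * 1 + (2 * w)^-1 * (s * (- s * w) + c * (c * w)) =
   2^-1 + (c ^+ 2 - s ^+ 2) / 2 :> R by field.
lra.
Qed.

Lemma integral_cos_sqr t w (k : nat) : 0 < t -> w != 0 -> t * w = pi *+ 2 *+ k ->
  \int[leb1]_r (\1_`[0, t]%classic r * cos (r * w) ^+ 2) = t / 2.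
Proof.
move=> t0 w0 tw.
pose F r : R := r / 2 + sin (r * w) * cos (r * w) / (2 * w).
have dF r := is_derive_cos_sqr_prim r w0; rewrite -/F in dF.
have cF : continuous F.
  move=> x; apply: differentiable_continuous; apply/derivable1_diffP.
  by have [] := dF x.
have cc : continuous (fun r : R => cos (r * w) ^+ 2).
  have c1 : continuous (fun r : R => cos (r * w)).
    rewrite -[X in continuous X]/(cos \o *%R^~ w) => x; apply: continuous_comp.
      exact: mulrr_continuous.
    exact: continuous_cos.
  rewrite (_ : (fun r => _) = fun r : R => cos (r * w) * cos (r * w)).
    by move=> x; apply: continuousM; exact: c1.
  by apply/funext => r; rewrite expr2.
have := @continuous_FTC2 R (fun r => cos (r * w) ^+ 2) F 0 t t0.
have E : F t - F 0 = t / 2.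
  have s0 : sin (t * w) = 0.
    by rewrite tw -[_ *+ k]add0r periodicn ?sin0//; exact: sinD2pi.
  by rewrite /F s0 !mul0r sin0 !mul0r !addr0 subr0.
rewrite -EFinB E => H.
have {}H := H (continuous_subspaceT cc).
rewrite /Rintegral; transitivity (fine (\int[leb1]_(x in `[0%R, t]) (cos (x * w) ^+ 2)%:E)%E).
  congr fine; rewrite [RHS]integral_mkcond; apply: eq_integral => x _.
  rewrite patchE indicE; case: ifPn => _; by rewrite ?mul1r ?mul0r.
rewrite H//.
- split; [by move=> x _; have [] := dF x| |].
  + exact: cvg_at_right_filter (cF 0).
  + exact: cvg_at_left_filter (cF t).
- by move=> x _; rewrite derive1E; have [] := dF x.
Qed.

End CosineSquare.

Lemma prod_near (R : realType) (x y k k0 e a b : R) : `|x| <= 1 -> `|y| <= 1 ->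
  `|x - y| <= e -> `|k - y * k0| <= a -> `|k0| <= b ->
  `|x * k - y ^+ 2 * k0| <= a + e * b.
Proof.
move=> x1 y1 xy ka kb.
rewrite (_ : _ - _ = x * (k - y * k0) + (x - y) * (y * k0)); last by ring.
apply: le_trans (ler_normD _ _) _; rewrite !normrM; apply: lerD.
  by rewrite -[leRHS]mul1r; exact: ler_pM.
by apply: ler_pM => //; rewrite -[leRHS]mul1r; exact: ler_pM.
Qed.

(** * The secular term *)

Section Secular.
Context {R : realType} (S : freq_space R).
Local Notation V := (freq S).
Local Notation nrm := (@nrm R S).
Local Notation X := (@X R S).
Variables (g tau P K c t kap : R).
Implicit Types (x y z xi eta : V) (s r B : R).

Hypothesis HS : setup g tau P K c t kap.
Local Notation N := (P ^+ 2).
Local Notation a0 := (@packet R S N kap).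
Local Notation a2 := (@packet2 R S N kap).
Local Notation a3 := (@packet3 R S N kap).
Local Notation bL := (@bL R S).
Local Notation bLL := (@bLL R S).
Local Notation bH := (@bH R S N).
Local Notation bLH := (@bLH R S N).
Local Notation bW := (@bW R S N).
Local Notation high := (@high R S N).
Local Notation supp2 := (@supp2 R S N kap).
Local Notation ecos := (@ecos R S g tau).
Local Notation eup := (@eup R S g tau).
Local Notation elow := (@elow R S g tau).
Local Notation om := (@om R S g tau).
Local Notation H1 := (@lin_h R S g tau a0).
Local Notation P1 := (@lin_psi R S g tau a0).
Local Notation H2 := (@second_h R S g tau a0).
Local Notation P2 := (@second_psi R S g tau a0).
Local Notation w s := (fun xi => nrm xi * elow s xi).


Definition grad2 (h : V -> R) : V -> R :=
  fun eta => \sum_k convolve (mulC k h) (mulC k h) eta.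

Lemma grad2_int h z : nice false h ->
  let F eta := dt eta (sub z eta) * (h eta * h (sub z eta)) in
  tame (mu S) F /\ grad2 h z = fcst S * \int[mu S]_eta F eta.
Proof.
move=> nh F.
have tC j := nice_tame_conv z (nice_mulC j nh) (nice_mulC j nh).
have FE : F = fun eta => \sum_j mulC j h eta * mulC j h (sub z eta).
  apply/funext => eta; rewrite /F dtE mulr_suml.
  by apply: eq_bigr => j _; rewrite /mulC; ring.
split; first by rewrite FE; exact: tame_sum.
by rewrite FE integral_tame_sum// mulr_sumr.
Qed.

Lemma nice_grad2' h : nice false h -> nice false (grad2 h).
Proof. exact: nice_grad2. Qed.

Lemma ampK_int h z : nice false h ->
  let F eta := dt z eta * (h eta * grad2 h (sub z eta)) in
  tame (mu S) F /\ ampK h z = fcst S * \int[mu S]_eta F eta.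
Proof.
move=> nh F; have ng := nice_grad2' nh.
have tC j := nice_tame_conv z (nice_mulC j nh) ng.
have FE : F = fun eta => \sum_j co z j * (mulC j h eta * grad2 h (sub z eta)).
  apply/funext => eta; rewrite /F dtE mulr_suml.
  by apply: eq_bigr => j _; rewrite /mulC; ring.
have tZ j : tame (mu S) (fun eta => co z j * (mulC j h eta * grad2 h (sub z eta))).
  exact: tameZ.
split; first by rewrite FE; exact: tame_sum.
rewrite FE integral_tame_sum// mulr_sumr; apply: eq_bigr => j _.
by rewrite integral_tameZ// /mulC /convolve mulrCA.
Qed.

(** With nonnegative coordinates the transverse products can only increase the scalar product; this
    is why the boxes have their corner on the axis. *)
Lemma dt_low p q xi eta : 0 <= p -> 0 <= q ->
  (forall j, 0 <= co xi j) -> (forall j, 0 <= co eta j) ->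
  p <= X xi -> q <= X eta -> p * q <= dt xi eta.
Proof.
move=> p0 q0 x0 e0 px qe; rewrite dtE0 -[leLHS]addr0; apply: lerD.
  exact: ler_pM.
by apply: sumr_ge0 => i _; exact: mulr_ge0.
Qed.

Lemma abs_dt_prod xi eta (p q : R) : nrm xi <= p -> nrm eta <= q ->
  `|dt xi eta| <= 2 * (p * q).
Proof.
move=> xp eq; apply: le_trans (abs_dt_le _ _) _; apply: ler_wpM2l => //.
exact: nrm_prod_le.
Qed.

Lemma coL xi j : bL xi -> 0 <= co xi j. Proof. by apply: box_co; lra. Qed.
Lemma coH xi j : bH xi -> 0 <= co xi j.
Proof. by have h := N20 HS; apply: box_co; lra. Qed.
Lemma coW xi j : bW xi -> 0 <= co xi j.
Proof. by have h := N20 HS; apply: box_co; lra. Qed.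


Lemma mul1a0 : (fun xi => 1 * a0 xi) = a0.
Proof. by apply/funext => xi; rewrite mul1r. Qed.

Lemma grad2_supp (y : V -> R) xi : nice false (fun xi => y xi * a0 xi) ->
  grad2 (fun xi => y xi * a0 xi) xi != 0 -> supp2 xi.
Proof. by move=> ny; have [_ ->] := grad2_int xi ny; exact: (@int_supp _ _ _ _ _ y y). Qed.

Lemma lin_LL1 (m : V -> R) z B : bLL z -> 0 <= B ->
  tame (mu S) (fun eta => m eta * (a0 eta * a0 (sub z eta))) ->
  (forall eta, bL eta -> bL (sub z eta) -> `|m eta| <= B) ->
  `|fcst S * \int[mu S]_eta (m eta * (a0 eta * a0 (sub z eta)))| <= B * a2 z.
Proof.
move=> bz B0 tF H; apply: int_bound tF (na0 S HS) (na0 S HS) B0 (a0p HS) (a0p HS) _ => eta.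
rewrite !mulf_eq0 !negb_or => /and3P[_ n1 n2].
have [l1 l2] := split_LL (N20 HS) bz n1 n2.
rewrite !normrM (ger0_norm (a0p HS eta)) (ger0_norm (a0p HS (sub z eta))).
by apply: ler_wpM2r; [rewrite mulr_ge0// (a0p HS)|exact: H].
Qed.

Lemma lin_LH1 (m : V -> R) z B : bLH z -> 0 <= B ->
  tame (mu S) (fun eta => m eta * (a0 eta * a0 (sub z eta))) ->
  (forall eta, bL eta -> bH (sub z eta) -> `|m eta| <= B) ->
  (forall eta, bH eta -> bL (sub z eta) -> `|m eta| <= B) ->
  `|fcst S * \int[mu S]_eta (m eta * (a0 eta * a0 (sub z eta)))| <= B * a2 z.
Proof.
move=> bz B0 tF H H'; apply: int_bound tF (na0 S HS) (na0 S HS) B0 (a0p HS) (a0p HS) _ => eta.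
rewrite !mulf_eq0 !negb_or => /and3P[_ n1 n2].
rewrite !normrM (ger0_norm (a0p HS eta)) (ger0_norm (a0p HS (sub z eta))).
apply: ler_wpM2r; first by rewrite mulr_ge0// (a0p HS).
by have [[? ?]|[? ?]] := split_LH (N20 HS) bz n1 n2; [exact: H|exact: H'].
Qed.

Lemma grad2_diff (y : V -> R) (k : R) z : nice false (fun xi => y xi * a0 xi) ->
  let F eta := dt eta (sub z eta) * (y eta * y (sub z eta) - k) *
     (a0 eta * a0 (sub z eta)) in
  tame (mu S) F /\
  grad2 (fun xi => y xi * a0 xi) z - k * grad2 a0 z = fcst S * \int[mu S]_eta F eta.
Proof.
move=> ny F; have [t1 E1] := grad2_int z ny; have [t2 E2] := grad2_int z (na0 S HS).
have FE : F = fun eta => dt eta (sub z eta) *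
    ((y eta * a0 eta) * (y (sub z eta) * a0 (sub z eta))) -
    k * (dt eta (sub z eta) * (a0 eta * a0 (sub z eta))).
  by apply/funext => eta; rewrite /F; ring.
split; first by rewrite FE; exact: tameD t1 (tameN (tameZ k t2)).
rewrite E1 E2 FE integral_tameB//; last exact: tameZ.
by rewrite integral_tameZ// mulrBr [k * (_ * _)]mulrCA.
Qed.

(** * Replacing the cosines by constants on the two boxes *)

Section Perturbation.
Variables (y : V -> R) (chi eps : R).
Hypotheses (ny : nice false (fun xi => y xi * a0 xi)) (y1 : forall xi, `|y xi| <= 1)
  (chi1 : `|chi| <= 1) (yL : forall xi, bL xi -> `|y xi - 1| <= eps)
  (yH : forall xi, bH xi -> `|y xi - chi| <= eps) (eps0 : 0 <= eps).
Local Notation h := (fun xi => y xi * a0 xi).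

Lemma prod_LL (p q : R) : `|p| <= 1 -> `|q - 1| <= eps -> `|p - 1| <= eps ->
  `|p * q - 1| <= 2 * eps.
Proof.
move=> p1 qe pe; rewrite (_ : p * q - 1 = p * (q - 1) + (p - 1)); last by ring.
apply: le_trans (ler_normD _ _) _; rewrite normrM mulr2n mulrDl !mul1r; apply: lerD => //.
by rewrite -[leRHS]mul1r; exact: ler_pM.
Qed.

Lemma prod_LH (p q : R) : `|q| <= 1 -> `|p - 1| <= eps -> `|q - chi| <= eps ->
  `|p * q - chi| <= 2 * eps.
Proof.
move=> q1 pe qe; rewrite (_ : p * q - chi = (p - 1) * q + (q - chi)); last by ring.
apply: le_trans (ler_normD _ _) _; rewrite normrM mulr2n mulrDl !mul1r; apply: lerD => //.
by rewrite -[leRHS]mulr1; exact: ler_pM.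
Qed.

Lemma grad2_bd_LL z : bLL z -> `|grad2 h z| <= 4 * a2 z.
Proof.
move=> bz; have [tF ->] := grad2_int z ny.
apply: (lin_LL HS (y := y) (u := y) bz) tF _ => // eta b1 b2.
have n1 := nL b1; have n2 := nL b2.
apply: (@le_trans _ _ (2 * (14 / 10 * (14 / 10)) * (1 * 1))); last lra.
apply: ler_pM; rewrite ?mulr_ge0//; last exact: ler_pM.
by apply: abs_dt_prod; lra.
Qed.

Lemma grad2_bd_LH z : bLH z -> `|grad2 h z| <= 32 / 10 * N * a2 z.
Proof.
move=> bz; have [tF ->] := grad2_int z ny; have N20 := N20 HS.
apply: (lin_LH HS (y := y) (u := y) bz) tF _ _ => [||]; first lra.
  move=> eta b1 b2; have n1 := nL b1; have [/andP[_ n2] _] := nHigh N20 (Or31 _ _ b2).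
  apply: (@le_trans _ _ (2 * (14 / 10 * (112 / 100 * N)) * (1 * 1))); last lra.
  apply: ler_pM; rewrite ?mulr_ge0//; last exact: ler_pM.
  by apply: abs_dt_prod => //; lra.
move=> eta b1 b2; have n1 := nL b2; have [/andP[_ n2] _] := nHigh N20 (Or31 _ _ b1).
apply: (@le_trans _ _ (2 * (112 / 100 * N * (14 / 10)) * (1 * 1))); last lra.
apply: ler_pM; rewrite ?mulr_ge0//; last exact: ler_pM.
by apply: abs_dt_prod => //; lra.
Qed.

Lemma grad2_near_LL z : bLL z -> `|grad2 h z - grad2 a0 z| <= 8 * eps * a2 z.
Proof.
move=> bz; have [tF E] := grad2_diff 1 z ny; rewrite mul1r in E; rewrite E.
have e0 := eps0; apply: (lin_LL1 bz) tF _ => [|eta b1 b2]; first lra.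
have n1 := nL b1; have n2 := nL b2.
rewrite normrM; apply: (@le_trans _ _ (2 * (14 / 10 * (14 / 10)) * (2 * eps))); last lra.
apply: ler_pM => //; first by apply: abs_dt_prod; lra.
by apply: prod_LL => //; exact: yL.
Qed.

Lemma grad2_near_LH z : bLH z -> `|grad2 h z - chi * grad2 a0 z| <= 7 * N * eps * a2 z.
Proof.
move=> bz; have [tF ->] := grad2_diff chi z ny; have N20 := N20 HS.
have Ne : 0 <= N * eps by rewrite mulr_ge0//; lra.
apply: (lin_LH1 bz) tF _ _ => [||]; first lra.
  move=> eta b1 b2; have n1 := nL b1; have [/andP[_ n2] _] := nHigh N20 (Or31 _ _ b2).
  rewrite normrM; apply: (@le_trans _ _ (2 * (14 / 10 * (112 / 100 * N)) * (2 * eps))); last lra.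
  apply: ler_pM => //; first by apply: abs_dt_prod; lra.
  by apply: prod_LH => //; [exact: yL|exact: yH].
move=> eta b1 b2; have n1 := nL b2; have [/andP[_ n2] _] := nHigh N20 (Or31 _ _ b1).
rewrite normrM; apply: (@le_trans _ _ (2 * (112 / 100 * N * (14 / 10)) * (2 * eps))); last lra.
apply: ler_pM => //; first by apply: abs_dt_prod; lra.
by rewrite mulrC; apply: prod_LH => //; [exact: yL|exact: yH].
Qed.

End Perturbation.

Lemma nice1a0 : nice false (fun xi => 1 * a0 xi).
Proof. by rewrite mul1a0; exact: (na0 S HS). Qed.

Lemma normr1_le (xi : V) : `|1 : R| <= 1. Proof. by rewrite normr1. Qed.

Lemma ga0_LL z : bLL z -> `|grad2 a0 z| <= 4 * a2 z.
Proof. by have := @grad2_bd_LL _ nice1a0 normr1_le z; rewrite mul1a0. Qed.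

Lemma ga0_LH z : bLH z -> `|grad2 a0 z| <= 32 / 10 * N * a2 z.
Proof. by have := @grad2_bd_LH _ nice1a0 normr1_le z; rewrite mul1a0. Qed.

Lemma ga0_supp z : grad2 a0 z != 0 -> supp2 z.
Proof. by have := @grad2_supp _ z nice1a0; rewrite mul1a0. Qed.

Lemma ampKa0_le z : bW z -> `|ampK a0 z| <= 11 * N ^+ 2 * a3 z.
Proof.
move=> bz; have [tF ->] := ampK_int z (na0 S HS); have N20 := N20 HS.
have N2 : 0 <= N ^+ 2 by exact: sqr_ge0.
have [/andP[_ nz] _] := nHigh N20 (Or33 _ _ bz).
have E : (fun eta => dt z eta * (a0 eta * grad2 a0 (sub z eta))) =
    fun eta => dt z eta * ((1 * a0 eta) * grad2 a0 (sub z eta)).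
  by apply/funext => eta; rewrite mul1r.
rewrite E in tF *.
apply: (quad_W HS (y := fun=> 1) bz) tF ga0_supp _ _; first lra.
- move=> eta b1 b2; have n1 := nL b1.
  apply: (@le_trans _ _ (2 * (112 / 100 * N * (14 / 10)) * (1 * (32 / 10 * N * a2 (sub z eta))))).
    apply: ler_pM; rewrite ?mulr_ge0 ?normr1//; first by apply: abs_dt_prod => //; lra.
    by rewrite !mul1r; exact: ga0_LH.
  have := mulr_ge0 N2 (a2p HS (sub z eta)); lra.
- move=> eta b1 b2; have [/andP[_ n1] _] := nHigh N20 (Or31 _ _ b1).
  apply: (@le_trans _ _ (2 * (112 / 100 * N * (112 / 100 * N)) * (1 * (4 * a2 (sub z eta))))).
    apply: ler_pM; rewrite ?mulr_ge0 ?normr1//; first by apply: abs_dt_prod => //; lra.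
    by rewrite !mul1r; exact: ga0_LL.
  have := mulr_ge0 N2 (a2p HS (sub z eta)); lra.
Qed.

(** Amplitudes and coordinates are nonnegative, so nothing cancels. The two scalar products are at
    least N and N if the outer factor is low, at least N ^ 2 and 1 if it is high. *)
Lemma ampKa0_ge z : bW z -> N ^+ 2 * a3 z <= ampK a0 z.
Proof.
move=> bz; have [tF ->] := ampK_int z (na0 S HS); have N20 := N20 HS.
have N2 : 0 <= N ^+ 2 by exact: sqr_ge0.
apply: (int_lower tF (na0 S HS) (na2 S HS)) => eta.
have [->|n1] := eqVneq (a0 eta) 0; first by rewrite !(mul0r, mulr0).
have A := a0p HS eta.
rewrite [leLHS]mulrCA [leRHS]mulrCA; apply: ler_wpM2l => //.
have gint := grad2_int (sub z eta) (na0 S HS).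
have glow (B : R) : (forall xi, a0 xi != 0 -> a0 (sub (sub z eta) xi) != 0 ->
      B <= dt xi (sub (sub z eta) xi)) -> B * a2 (sub z eta) <= grad2 a0 (sub z eta).
  move=> H; have [tG ->] := gint.
  apply: (int_lower tG (na0 S HS) (na0 S HS)) => xi.
  have [->|m1] := eqVneq (a0 xi) 0; first by rewrite !(mul0r, mulr0).
  have [->|m2] := eqVneq (a0 (sub (sub z eta) xi)) 0; first by rewrite !mulr0.
  by apply: ler_wpM2r; [rewrite mulr_ge0 ?(a0p HS)|exact: H].
have [s2|ns2] := pselect (supp2 (sub z eta)); last first.
  have -> : a2 (sub z eta) = 0.
    apply/eqP; apply: contra_notT ns2; rewrite /packet2 -mul1a0; exact: conv_supp.
  have -> : grad2 a0 (sub z eta) = 0.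
    by apply/eqP; apply: contra_notT ns2; exact: ga0_supp.
  by rewrite !mulr0.
have [Nz _] := andP (box_X bz).
have a2z := a2p HS (sub z eta).
have [[l lh]|[hh ll]] := split_W N20 bz n1 s2.
- have d : N * 1 <= dt z eta.
    apply: dt_low => //; [lra|by move=> j; exact: coW|by move=> j; exact: coL|lra|].
    by have /andP[] := box_X l.
  have gN : N * a2 (sub z eta) <= grad2 a0 (sub z eta).
    apply: glow => xi m1 m2; have [[u v]|[u v]] := split_LH N20 lh m1 m2.
    + rewrite -[leLHS]mul1r; apply: dt_low => //; first lra.
      * by move=> j; exact: coL.
      * by move=> j; exact: coH.
      * by have /andP[] := box_X u.
      * by have /andP[] := box_X v.
    + rewrite -[leLHS]mulr1; apply: dt_low => //; first lra.
      * by move=> j; exact: coH.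
      * by move=> j; exact: coL.
      * by have /andP[] := box_X u.
      * by have /andP[] := box_X v.
  rewrite expr2 -mulrA; apply: ler_pM => //; [lra|by apply: mulr_ge0 => //; lra|lra].
- have d : N * N <= dt z eta.
    apply: dt_low => //; [lra|lra|by move=> j; exact: coW|by move=> j; exact: coH|lra|].
    by have /andP[] := box_X hh.
  have gN : 1 * a2 (sub z eta) <= grad2 a0 (sub z eta).
    apply: glow => xi m1 m2; have [u v] := split_LL N20 ll m1 m2.
    rewrite -[leLHS]mul1r; apply: dt_low => //.
    + by move=> j; exact: coL.
    + by move=> j; exact: coL.
    + by have /andP[] := box_X u.
    + by have /andP[] := box_X v.
  rewrite mul1r in gN; rewrite expr2; apply: ler_pM => //.
Qed.

(** K is trilinear and each interaction reaching [bW] contains exactly one high factor, so replacing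
    y by 1 on [bL] and by chi on [bH] multiplies K by chi. The factors are replaced one at a time,
    each at the cost of one eps. *)
Lemma ampK_near (y : V -> R) (chi eps : R) z : bW z -> 0 <= eps ->
  nice false (fun xi => y xi * a0 xi) -> (forall xi, `|y xi| <= 1) ->
  `|chi| <= 1 -> (forall xi, bL xi -> `|y xi - 1| <= eps) ->
  (forall xi, bH xi -> `|y xi - chi| <= eps) ->
  `|ampK (fun xi => y xi * a0 xi) z - chi * ampK a0 z| <= 34 * N ^+ 2 * eps * a3 z.
Proof.
move=> bz eps0 ny y1 chi1 yL yH; have N20 := N20 HS.
have N2 : 0 <= N ^+ 2 * eps by rewrite mulr_ge0 ?sqr_ge0.
have [t1 ->] := ampK_int z ny; have [t2 ->] := ampK_int z (na0 S HS).
set g1 := grad2 _ in t1 *; set g0 := grad2 _ in t2 *.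
have [/andP[_ nz] _] := nHigh N20 (Or33 _ _ bz).
rewrite mulrCA -mulrBr -integral_tameZ// -integral_tameB//; last exact: tameZ.
apply: (int_bound (tameD t1 (tameN (tameZ chi t2))) (na0 S HS) (na2 S HS) _ (a0p HS) (a2p HS)).
  lra.
move=> eta.
rewrite (_ : _ - _ = a0 eta * (dt z eta * (y eta * g1 (sub z eta) - chi * g0 (sub z eta)))); last by ring.
rewrite mulf_eq0 negb_or => /andP[n1 nd].
have A := a0p HS eta; rewrite normrM (ger0_norm A) [leRHS]mulrCA.
apply: ler_wpM2l => //.
have s2 : supp2 (sub z eta).
  apply: contrapT => ns; move/eqP: nd; apply.
  rewrite (_ : g1 _ = 0); last by apply/eqP; apply: contra_notT ns; exact: grad2_supp.
  rewrite (_ : g0 _ = 0); last by apply/eqP; apply: contra_notT ns; exact: ga0_supp.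
  by rewrite !mulr0 subr0 mulr0.
have a2z := a2p HS (sub z eta).
have ea := mulr_ge0 N2 a2z.
have [[l lh]|[hh ll]] := split_W N20 bz n1 s2.
- have nl := nL l.
  rewrite normrM; apply: (@le_trans _ _ (2 * (112 / 100 * N * (14 / 10)) *
     (eps * (32 / 10 * N * a2 (sub z eta)) + 7 * N * eps * a2 (sub z eta)))); last lra.
  apply: ler_pM => //; first by apply: abs_dt_prod => //; lra.
  rewrite (_ : _ - _ = (y eta - 1) * g1 (sub z eta) +
     (g1 (sub z eta) - chi * g0 (sub z eta))); last by ring.
  apply: le_trans (ler_normD _ _) _; apply: lerD.
    by rewrite normrM; apply: ler_pM => //; [exact: yL|exact: grad2_bd_LH].
  exact: grad2_near_LH.
- have [/andP[_ nh] _] := nHigh N20 (Or31 _ _ hh).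
  rewrite normrM; apply: (@le_trans _ _ (2 * (112 / 100 * N * (112 / 100 * N)) *
     (eps * (4 * a2 (sub z eta)) + 1 * (8 * eps * a2 (sub z eta))))); last lra.
  apply: ler_pM => //; first by apply: abs_dt_prod.
  rewrite (_ : _ - _ = (y eta - chi) * g1 (sub z eta) +
     chi * (g1 (sub z eta) - g0 (sub z eta))); last by ring.
  apply: le_trans (ler_normD _ _) _; rewrite !normrM; apply: lerD.
    by apply: ler_pM => //; [exact: yH|exact: grad2_bd_LL].
  by apply: ler_pM => //; exact: grad2_near_LL.
Qed.

(** The value of [om] at N e_1 exactly, with which all high phases are compared. *)
Definition wstar : R := Num.sqrt (N * (g + tau * N ^+ 2)).
(** The time t <= K / P ^ 3 multiplied by 5 c P, the spread of [om] over the high windows. *)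
Definition eps : R := 5 * (c * K) / N.

Lemma om_L xi : bL xi -> om xi <= c.
Proof.
have [g0 tau0 _ _ c1 cg _ _ _ _ _] := HS => b; have n1 := nL b.
have c0 : 0 <= c by lra.
rewrite -ler_sqr ?nnegrE ?om_ge0// (om_sq HS).
have e1 : g + tau * nrm xi ^+ 2 <= 1 * g + 2 * tau.
  have : nrm xi ^+ 2 <= 2 by nra.
  by move=> /(ler_wpM2l (ltW tau0)); lra.
apply: (@le_trans _ _ (14 / 10 * (1 * g + 2 * tau))).
  apply: ler_pM; rewrite ?nrm_ge0//; last by lra.
  by rewrite addr_ge0// mulr_ge0 ?sqr_ge0// ltW.
nra.
Qed.

(** [om] varies at a rate of order P in |xi| while the windows have bounded width. The difference of
    squares is estimated and divided by om + wstar, at least sqrt(2 tau) P ^ 3. *)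
Lemma om_near xi : high xi -> `|om xi - wstar| <= 5 * (c * P).
Proof.
have [g0 tau0 P5 _ c1 _ sig gP _ _ _] := HS => b.
have N20 := N20 HS; have [/andP[n1 n2] n3] := nHigh N20 b.
have P4 : N ^+ 2 = P ^+ 4 by ring.
have w2 : wstar ^+ 2 = N * (g + tau * N ^+ 2).
  by rewrite sqr_sqrtr// mulr_ge0 ?sqr_ge0// addr_ge0// mulr_ge0 ?sqr_ge0// ltW.
have w0 : 0 <= wstar := sqrtr_ge0 _.
have o0 := om_ge0 g tau xi.
set sg := Num.sqrt (2 * tau) in sig.
have sg2 : sg ^+ 2 = 2 * tau by rewrite sqr_sqrtr//; lra.
have sg0 : 0 < sg by rewrite sqrtr_gt0; lra.
have P0 : 0 < P by lra.
have o2 := om_sq HS xi.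
have N2 : 0 <= N ^+ 2 by exact: sqr_ge0.
have wl : sg / 2 * P ^+ 3 <= wstar.
  rewrite -ler_sqr ?nnegrE//; last by rewrite mulr_ge0 ?exprn_ge0//; lra.
  rewrite w2 exprMn expr_div_n sg2.
  have := mulr_ge0 (ltW tau0) (exprn_ge0 6 (ltW P0)); have := mulr_ge0 g0 (sqr_ge0 P); lra.
have [d0 dd] : 0 <= om xi ^+ 2 - wstar ^+ 2 /\ om xi ^+ 2 - wstar ^+ 2 <= 9 * tau * P ^+ 4.
  have -> : om xi ^+ 2 - wstar ^+ 2 =
      (nrm xi - N) * (g + tau * (nrm xi ^+ 2 + nrm xi * N + N ^+ 2)).
    by rewrite o2 w2; ring.
  have nn : nrm xi ^+ 2 <= 126 / 100 * N ^+ 2 by nra.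
  have nN : nrm xi * N <= 112 / 100 * N ^+ 2 by nra.
  have q0 : 0 <= nrm xi ^+ 2 + nrm xi * N + N ^+ 2.
    by rewrite !addr_ge0 ?sqr_ge0// mulr_ge0 ?sqr_ge0// nrm_ge0.
  have gq0 : 0 <= g + tau * (nrm xi ^+ 2 + nrm xi * N + N ^+ 2).
    by rewrite addr_ge0// mulr_ge0// ltW.
  split; first by apply: mulr_ge0 => //; lra.
  (* 24/10 bounds |xi| - N, 1/3 accounts for gravity, and 338/100 = 126/100 + 112/100 + 1. *)
  apply: (@le_trans _ _ (24 / 10 * (1 / 3 * (tau * N ^+ 2) + tau * (338 / 100 * N ^+ 2)))).
    apply: ler_pM => //; [lra|lra|apply: lerD; first by rewrite P4; lra].
    by apply: ler_wpM2l; [exact: ltW|lra].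
  rewrite -P4; have := mulr_ge0 (ltW tau0) N2; lra.
have wo : wstar <= om xi by rewrite -ler_sqr ?nnegrE// -subr_ge0.
have dge : 0 <= om xi - wstar by lra.
rewrite ger0_norm//.
have k0 : 0 < sg * P ^+ 3 by rewrite mulr_gt0// exprn_gt0.
rewrite -(ler_pM2r k0); apply: (@le_trans _ _ (om xi ^+ 2 - wstar ^+ 2)).
  rewrite (_ : om xi ^+ 2 - wstar ^+ 2 = (om xi - wstar) * (om xi + wstar)); last by ring.
  by apply: ler_wpM2l => //; lra.
apply: le_trans dd _; rewrite [leRHS](_ : _ = 5 * (c * sg) * P ^+ 4); last by ring.
apply: ler_wpM2r; first by rewrite -P4.
have : sg * sg <= c * sg by apply: ler_wpM2r => //; exact: ltW.
by rewrite -expr2 sg2; lra.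
Qed.

Lemma eps_ge0 : 0 <= eps.
Proof.
have [_ _ _ K1 c1 _ _ _ _ _ _] := HS; have N20 := N20 HS.
by rewrite /eps !mulr_ge0 ?invr_ge0//; lra.
Qed.

Lemma time_le_eps s (q : R) : 0 <= s <= t -> `|q| <= 5 * (c * P) -> `|s * q| <= eps.
Proof.
have [_ _ P5 K1 c1 _ _ _ t0 tP _] := HS; have N20 := N20 HS.
move=> /andP[s0 st] qP; have N0 : 0 < N by lra.
rewrite /eps ler_pdivlMr// normrM ger0_norm//.
apply: (@le_trans _ _ (t * (5 * (c * P)) * N)).
  by apply: ler_wpM2r; [exact: ltW|exact: ler_pM].
rewrite [leLHS](_ : _ = 5 * (c * (t * P ^+ 3))); last by ring.
by do 2?[apply: ler_wpM2l; first by lra].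
Qed.

Lemma ecos_L s xi : 0 <= s <= t -> bL xi -> `|ecos s xi - 1| <= eps.
Proof.
have [_ _ P5 K1 c1 _ _ _ t0 tP _] := HS.
move=> st b; rewrite -cos0; apply: le_trans (cos_lipschitz _ _) _.
rewrite subr0; apply: time_le_eps => //; rewrite ger0_norm ?om_ge0//.
by apply: le_trans (om_L b) _; nra.
Qed.

Lemma ecos_high s xi : 0 <= s <= t -> high xi -> `|ecos s xi - cos (s * wstar)| <= eps.
Proof.
move=> st b; apply: le_trans (cos_lipschitz _ _) _.
by rewrite -mulrBr; apply: time_le_eps => //; exact: om_near.
Qed.

Local Notation M1 := (@cubic_h R S g tau a0).
Local Notation M2 := (@cubic_psi R S g tau a0).
Local Notation P3 := (@third_psi R S g tau a0).
Local Notation leb1 := (@lebesgue_measure R).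

(** 1056 = 3 (252 + 100). The bounds on [ampQ] are free of P and the propagator adds a single power,
    against P ^ 4 in the secular term. *)
Lemma quadratic_errors s z : 0 <= s <= t -> bW z ->
  `|elow (t - s) z * (3 * ampQ (H1 s) (P2 s) z + 3 * ampQ (H2 s) (P1 s) z)|
    <= 1056 * (c ^+ 4 * K ^+ 4) * P * a3 z.
Proof.
move=> st bz; have [_ _ P5 K1 c1 _ _ _ _ _ _] := HS; have A := a3p HS z.
have q1 := ampQ_H1P2 HS st bz; have q2 := ampQ_H2P1 HS st bz.
rewrite normrM.
apply: (@le_trans _ _ (c * P * (1056 * (c ^+ 3 * K ^+ 4) * a3 z))); last first.
  by rewrite le_eqVlt; apply/orP; left; apply/eqP; ring.
apply: ler_pM => //; first by apply: (elow_high HS); exact: Or33.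
apply: le_trans (ler_normD _ _) _; rewrite !normrM !(ger0_norm (ler0n R 3)).
have m : (c ^+ 2 * K ^+ 3 * a3 z) * 1 <= (c ^+ 2 * K ^+ 3 * a3 z) * (c * K).
  apply: ler_wpM2l; last by nra.
  have c0 : 0 <= c by lra.
  have K0 : 0 <= K by lra.
  by apply: mulr_ge0 => //; apply: mulr_ge0; exact: exprn_ge0.
lra.
Qed.

(** The propagator times |z| is at most rho N with rho ^ 2 = 2 tau N, so 3 (9/100) rho ^ 2 N gives
    54/100 tau N ^ 2, the only error of the order of the secular term. *)
Lemma cubic_error s z : 0 <= s <= t -> bW z ->
  `|elow (t - s) z * (3 * ampG (H1 s) (P1 s) z)|
    <= (54 / 100 * (tau * N ^+ 2) + 18 / 100 * (c ^+ 2 * K)) * a3 z.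
Proof.
move=> st bz; have [g0 tau0 P5 K1 c1 _ sig _ t0 tP _] := HS; have A := a3p HS z.
have ct0 := ct_ge0 HS; have r0 := rho_ge0 HS.
set rho := (Num.sqrt _ * P) in r0 *.
have tau20 : 0 <= 2 * tau by lra.
have rho2 : rho * rho = 2 * tau * N.
  by rewrite -expr2 /rho exprMn sqr_sqrtr.
have rc : rho * N <= c * P ^+ 3.
  rewrite /rho -mulrA -exprS; apply: ler_wpM2r => //; rewrite exprn_ge0//; lra.
rewrite mulrCA normrM (ger0_norm (ler0n R 3)) normrM.
have G := ampG_bound HS st bz; rewrite -/rho in G.
have e := elow_nrm HS (t - s) z.
have h := om_high HS (Or33 _ _ bz).
have e2 : `|elow (t - s) z| * nrm z <= rho * N.
  by apply: le_trans e _; apply: le_trans h _; rewrite /rho -mulrA -exprS.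
have q0 : 0 <= 9 / 100 * rho + 6 / 100 * (c * t) by lra.
apply: (@le_trans _ _ (3 * (rho * N * ((9 / 100 * rho + 6 / 100 * (c * t)) * a3 z)))).
  apply: ler_wpM2l => //.
  apply: le_trans (ler_wpM2l _ G) _ => //.
  rewrite -[nrm z * _ * _]mulrA [leLHS]mulrA; apply: ler_wpM2r => //; exact: mulr_ge0.
rewrite [X in 3 * X]mulrA [leLHS]mulrA; apply: ler_wpM2r => //.
rewrite (_ : 3 * _ = 27 / 100 * (rho * rho) * N + 18 / 100 * (c * t * (rho * N))); last by ring.
rewrite rho2; have := ler_wpM2l ct0 rc.
have := @scale_mono _ _ _ _ _ _ _ _ HS 1 3 2 1 2 0 isT isT isT.
rewrite !expr1 !expr0; lra.
Qed.

(** The two low cosines are replaced by 1, the high one and the propagator by cos (s wstar), whence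
    the square. 45 = 34 + 11, from [ampK_near] and from [ampKa0_le] for the propagator. *)
Lemma secular_term s z : 0 <= s <= t -> bW z ->
  cos ((t - s) * wstar) = cos (s * wstar) ->
  `|ecos (t - s) z * ampK (H1 s) z - cos (s * wstar) ^+ 2 * ampK a0 z|
    <= 45 * N ^+ 2 * eps * a3 z.
Proof.
move=> st bz per; have A := a3p HS z; have e0 := eps_ge0.
have ts : 0 <= t - s <= t by have := su_t HS; lra.
have h := ecos_high ts (Or33 _ _ bz); rewrite per in h.
have near : `|ampK (H1 s) z - cos (s * wstar) * ampK a0 z| <= 34 * N ^+ 2 * eps * a3 z.
  apply: (ampK_near bz e0 (nH1 S HS st)); [by move=> xi; exact: ecos_le|exact: cos_max| |].
    by move=> xi; exact: ecos_L.
  by move=> xi b; apply: ecos_high => //; exact: Or31.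
apply: le_trans (prod_near (ecos_le _ _ _ _) (cos_max _) h near (ampKa0_le bz)) _.
lra.
Qed.

Lemma exponent_mono (m n : nat) : (m <= 4)%N -> (n <= 4)%N ->
  c ^+ m * K ^+ n <= c ^+ 4 * K ^+ 4.
Proof.
have [_ _ _ K1 c1 _ _ _ _ _ _] := HS => m4 n4.
have c0 := le_trans ler01 c1; have K0 := le_trans ler01 K1.
by apply: ler_pM; [exact: exprn_ge0|exact: exprn_ge0|exact: ler_weXn2l|exact: ler_weXn2l].
Qed.

Lemma secular_error : 3 * tau * (45 * N ^+ 2 * eps) <= 57 * (c ^+ 4 * K ^+ 4) * N.
Proof.
have [g0 tau0 P5 K1 c1 cg _ _ _ _ _] := HS.
have P0 : P != 0 by rewrite gt_eqF//; lra.
have -> : 3 * tau * (45 * N ^+ 2 * eps) = 675 * (tau * (c * K)) * N.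
  by rewrite /eps; field.
apply: ler_wpM2r; first exact: sqr_ge0.
have c0 := le_trans ler01 c1; have K0 := le_trans ler01 K1.
(* c bounds 12 tau by [su_cg], and 675 / 12 < 57. *)
have u : tau * (c * K) <= c / 12 * (c * K).
  by apply: ler_wpM2r; [exact: mulr_ge0|lra].
have := @exponent_mono 2 1 isT isT; have := mulr_ge0 (exprn_ge0 4 c0) (exprn_ge0 4 K0).
move: u; rewrite expr1; move: (tau * _) (c ^+ 4 * _) => x y; lra.
Qed.

(** All errors together consume at most one unit tau n a, while the main term y4 provides 3 ch of
    them. Abstract reals keep the arithmetic linear. *)
Lemma combine_errors (a ch y1 y2 y3 y4 y5 y6 b1 b2 b3 b5 b6 n : R) :
  `|y1| <= b1 * a -> `|y2| <= b2 * a -> `|y3| <= b3 * a -> `|y5| <= b5 * a ->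
  `|y6| <= b6 * a -> 3 * tau * (ch * (n * a)) <= y4 ->
  (b1 + b2 + b3 + b5 + b6) * a <= tau * n * a ->
  (3 * ch - 1) * (tau * n * a) <= y1 - y2 + y3 + y4 + y5 - y6.
Proof.
rewrite !ler_norml => /andP[e1 _] /andP[_ e2] /andP[e3 _] /andP[e5 _] /andP[_ e6] low err.
lra.
Qed.

Hypothesis big : 1000 * (c ^+ 4 * K ^+ 4) <= tau * N.

(** 54/100 of the budget is taken by the cubic term of G; by [big] the others, which are of lower
    order in P, fit into the remaining 46/100. *)
Lemma error_budget :
  1056 * (c ^+ 4 * K ^+ 4) * P + (54 / 100 * (tau * N ^+ 2) + 18 / 100 * (c ^+ 2 * K)) +
    57 * (c ^+ 4 * K ^+ 4) * N + 30 * (c ^+ 2 * K ^+ 2) + 756 * (c ^+ 3 * K ^+ 3) <= tau * N ^+ 2.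
Proof.
have [_ _ P5 K1 c1 _ _ _ _ _ _] := HS; have N20 := N20 HS.
have c0 := le_trans ler01 c1; have K0 := le_trans ler01 K1.
have Z0 := mulr_ge0 (exprn_ge0 4 c0) (exprn_ge0 4 K0).
have z1 := @exponent_mono 2 1 isT isT; have z2 := @exponent_mono 2 2 isT isT.
have z3 := @exponent_mono 3 3 isT isT.
have P0 : 0 <= P by lra.
have NN := ler_wpM2l (sqr_ge0 P) big.
have ZP := ler_wpM2l (mulr_ge0 Z0 P0) P5.
have ZN := ler_wpM2l Z0 N20.
rewrite expr1 in z1; lra.
Qed.

Lemma integrand_lower s z : 0 <= s <= t -> bW z ->
  cos ((t - s) * wstar) = cos (s * wstar) ->
  (3 * cos (s * wstar) ^+ 2 - 1) * (tau * N ^+ 2 * a3 z) <=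
  - (elow (t - s) z * M1 s z + ecos (t - s) z * M2 s z).
Proof.
move=> st bz per; have A := a3p HS z.
have e1 := quadratic_errors st bz.
have e2 := cubic_error st bz.
have e3 : `|3 * tau * (ecos (t - s) z * ampK (H1 s) z - cos (s * wstar) ^+ 2 * ampK a0 z)|
    <= 57 * (c ^+ 4 * K ^+ 4) * N * a3 z.
  have tau3 : 0 <= 3 * tau by rewrite mulr_ge0// ltW// (su_tau HS).
  rewrite normrM (ger0_norm tau3).
  apply: le_trans (ler_wpM2l tau3 (secular_term st bz per)) _.
  rewrite [leLHS]mulrA; apply: ler_wpM2r => //; exact: secular_error.
have e4 : `|ecos (t - s) z * (6 * ampP (H1 s) (P1 s) z)| <= 30 * (c ^+ 2 * K ^+ 2) * a3 z.
  rewrite mulrCA normrM (ger0_norm (ler0n R 6)) normrM.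
  rewrite [leRHS](_ : _ = 6 * (1 * (5 * (c ^+ 2 * K ^+ 2) * a3 z))); last by ring.
  by apply: ler_wpM2l => //; apply: ler_pM => //; [exact: ecos_le|exact: (ampP_bound HS)].
have e5 : `|ecos (t - s) z * (3 * ampE (P1 s) (P2 s) z)| <= 756 * (c ^+ 3 * K ^+ 3) * a3 z.
  rewrite mulrCA normrM (ger0_norm (ler0n R 3)) normrM.
  rewrite [leRHS](_ : _ = 3 * (1 * (252 * (c ^+ 3 * K ^+ 3) * a3 z))); last by ring.
  by apply: ler_wpM2l => //; apply: ler_pM => //; [exact: ecos_le|exact: (ampE_P1P2 HS)].
have low : 3 * tau * (cos (s * wstar) ^+ 2 * (N ^+ 2 * a3 z)) <=
    3 * tau * (cos (s * wstar) ^+ 2 * ampK a0 z).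
  have tau3 : 0 <= 3 * tau by rewrite mulr_ge0// ltW// (su_tau HS).
  by do 2?[apply: ler_wpM2l; rewrite ?sqr_ge0//]; exact: ampKa0_ge.
have err := ler_wpM2r A error_budget.
rewrite /cubic_h /cubic_psi /ampM1 /ampM2.
move: e1 e2 e3 e4 e5 low err.
move: (elow _ z) (ecos _ z) (ampK (H1 s) z) (ampK a0 z) (ampQ (H1 s) _ z) (ampQ (H2 s) _ z)
  (ampG _ _ z) (ampP _ _ z) (ampE _ _ z) (cos _ ^+ 2) (a3 z) => el ec k k0 q1 q2 gg p e ch a.
move=> e1 e2 e3 e4 e5 low err.
rewrite (_ : - _ = el * (3 * q1 + 3 * q2) - el * (3 * gg) + 3 * tau * (ec * k - ch * k0) +
   3 * tau * (ch * k0) + ec * (6 * p) - ec * (3 * e)); last by ring.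
exact: combine_errors e1 e2 e3 e4 e5 low err.
Qed.

(** Over whole periods 3 cos ^ 2 - 1 has mean 1/2: the secular mean 3/2 wins over the error budget
    1. The minus sign is that of the capillary term. *)
Lemma P3_lower (k : nat) z : 0 < t -> t * wstar = pi *+ 2 *+ k -> bW z ->
  tau / 2 * (t * N ^+ 2) * a3 z <= - P3 t z.
Proof.
move=> t0 per bz; have [g0 tau0 P5 _ _ _ _ _ _ _ _] := HS.
have w0 : wstar != 0.
  rewrite gt_eqF// sqrtr_gt0 mulr_gt0 ?exprn_gt0//; first lra.
  by rewrite ltr_wpDl// mulr_gt0 ?exprn_gt0//; lra.
have tt : 0 <= t <= t by rewrite lexx ltW.
have tF : tame leb1 (fun s => duh_integrand elow ecos M1 M2 t s z).
  apply: (tame_duh_integrand (mult_elow S g tau t) (mult_ecos S g tau t) _ _ z tt).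
    exact: fam_cubic_h (na0 S HS).
  exact: fam_cubic_psi (na0 S HS).
pose B := tau * N ^+ 2 * a3 z.
have tc : tame leb1 (fun s => \1_`[0, t]%classic s * cos (s * wstar) ^+ 2).
  apply: (@tame_of_bound R _ (measurableTypeR R) leb1 _ 1 `[0, t]%classic).
  - apply: measurable_funM; first exact: measurable_indic.
    apply: measurable_funX; apply: (measurableT_comp (f := @cos R)).
      by apply: continuous_measurable_fun; exact: continuous_cos.
    exact: mulrr_measurable.
  - exact: measurable_itv.
  - exact: lebesgue_itv0_fin.
  - move=> s; rewrite normrM mul1r ger0_norm// ler_piMr// normrX.
    by rewrite exprn_ile1//; exact: cos_max.
have tI := tame_itv0 t.
have E : \int[leb1]_s (B * (3 * (\1_`[0, t]%classic s * cos (s * wstar) ^+ 2) - \1_`[0, t]%classic s)) =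
    tau / 2 * (t * N ^+ 2) * a3 z.
  rewrite integral_tameZ; last exact: tameD (tameZ 3 tc) (tameN tI).
  rewrite integral_tameB//; last exact: tameZ.
  rewrite integral_tameZ// (integral_cos_sqr t0 w0 per) integral_itv0; last exact: ltW.
  by rewrite /B; field.
rewrite -E /third_psi /duh -integral_tameN//; apply: le_integral_tame.
- by apply: tameZ; exact: tameD (tameZ 3 tc) (tameN tI).
- exact: tameN.
- move=> s; rewrite /duh_integrand.
  have [si|nsi] := boolP (s \in (`[0, t]%classic : set R)); last first.
    by rewrite indicE (negbTE nsi) !mul0r mulr0 subr0 oppr0 mulr0.
  rewrite indicE si !mul1r [leLHS]mulrC; have st := itv0P si.
  by apply: integrand_lower => //; exact: cos_reflect per.
Qed.

End Secular.

(** * Sobolev norms and conclusion *)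

Section LnormBounds.
Context d (T : measurableType d) (R : realType) (m : {measure set T -> \bar R}).
Implicit Types (f : T -> R) (b q : R) (U : set T).

Lemma Lnorm2E f : Lnorm m 2%:E (EFin \o f) =
  ((\int[m]_x (f x ^+ 2)%:E) `^ (2^-1))%E.
Proof.
rewrite unlock /=; congr (_ `^ _)%E; apply: eq_integral => x _ /=.
by rewrite -[2]/(2%:R) powR_mulrn// real_normK ?num_real.
Qed.

Lemma measurable_sqrE f : measurable_fun setT f ->
  measurable_fun setT (fun x => (f x ^+ 2)%:E).
Proof. by move=> mf; apply/measurable_EFinP; exact: measurable_funX. Qed.

Lemma poweR_half (b : R) : 0 <= b -> ((b ^+ 2)%:E `^ (2^-1) = b%:E)%E.
Proof. by move=> b0; rewrite poweR_EFin powR12_sqrt ?sqr_ge0// sqrtr_sqr ger0_norm. Qed.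

Lemma poweR_half_le (x y : \bar R) : (0 <= x)%E -> (x <= y)%E ->
  (x `^ (2^-1) <= y `^ (2^-1))%E.
Proof.
move=> x0 xy; apply: gt0_ler_poweR => //; rewrite in_itv /= leey andbT//.
exact: le_trans xy.
Qed.

Lemma int_sqr_cst (b : R) U : measurable U ->
  (\int[m]_x (b ^+ 2 * \1_U x)%:E = (b ^+ 2)%:E * m U)%E.
Proof.
move=> mU; under eq_integral do rewrite EFinM.
rewrite ge0_integralZl//.
- by rewrite integral_indic// setIT.
- by apply/measurable_EFinP; exact: measurable_indic.
- by rewrite lee_fin sqr_ge0.
Qed.

Lemma Lnorm2_le f b U : measurable_fun setT f -> measurable U -> (m U <= 1)%E ->
  0 <= b -> (forall x, `|f x| <= b * \1_U x) -> (Lnorm m 2%:E (EFin \o f) <= b%:E)%E.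
Proof.
move=> mf mU U1 b0 fb; rewrite Lnorm2E -(poweR_half b0).
apply: poweR_half_le; first by apply: integral_ge0 => x _; rewrite lee_fin sqr_ge0.
apply: (@le_trans _ _ (\int[m]_x (b ^+ 2 * \1_U x)%:E)%E).
  apply: ge0_le_integral => //.
  - by move=> x _; rewrite lee_fin sqr_ge0.
  - exact: measurable_sqrE.
  - by apply/measurable_EFinP; apply: measurable_funM => //; exact: measurable_indic.
  - move=> x _; rewrite lee_fin -real_normK ?num_real//.
    have -> : b ^+ 2 * \1_U x = (b * \1_U x) ^+ 2.
      by rewrite exprMn indicE; case: (_ \in _); rewrite ?expr1n ?expr0n.
    by rewrite ler_sqr ?nnegrE// mulr_ge0.
rewrite int_sqr_cst// -[leRHS]mule1; apply: lee_pmul => //.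
by rewrite lee_fin sqr_ge0.
Qed.

Lemma Lnorm2_ge f b q U : measurable_fun setT f -> measurable U ->
  ((q ^+ 2)%:E <= m U)%E -> 0 <= b -> 0 <= q -> (forall x, U x -> b <= `|f x|) ->
  ((b * q)%:E <= Lnorm m 2%:E (EFin \o f))%E.
Proof.
move=> mf mU Uq b0 q0 fb; rewrite Lnorm2E -(poweR_half (mulr_ge0 b0 q0)).
apply: poweR_half_le; first by rewrite lee_fin sqr_ge0.
apply: (@le_trans _ _ (\int[m]_x (b ^+ 2 * \1_U x)%:E)%E).
  rewrite int_sqr_cst// exprMn EFinM; apply: lee_pmul => //; by rewrite lee_fin sqr_ge0.
apply: ge0_le_integral => //.
- by move=> x _; rewrite lee_fin mulr_ge0 ?sqr_ge0.
- by apply/measurable_EFinP; apply: measurable_funM => //; exact: measurable_indic.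
- exact: measurable_sqrE.
- move=> x _; rewrite lee_fin indicE; case: (boolP (x \in U)) => [xU|_].
    rewrite mulr1 -[leRHS]real_normK ?num_real// ler_sqr ?nnegrE//.
    by apply: fb; exact: set_mem xU.
  by rewrite mulr0 sqr_ge0.
Qed.

End LnormBounds.

(** * Comparison of Sobolev weights *)

Section Weights.
Context {R : realType}.
Implicit Types (u v r : R).

(** The exponent may have either sign, so comparability is assumed in both directions; a negative r
    exchanges the roles of u and v. *)
Lemma powR_comparable u v r : 0 < u -> 0 < v -> v <= 3 * u -> u <= 3 * v ->
  v `^ r <= 3 `^ `|r| * u `^ r.
Proof.
move=> u0 v0 vu uv; have [r0|r0] := leP 0 r.
  rewrite ger0_norm// -powRM ?(ltW u0)//; apply: ge0_ler_powR => //; rewrite nnegrE.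
    exact: ltW.
  by rewrite mulr_ge0// ltW.
rewrite ltr0_norm//.
have H : u `^ (- r) <= 3 `^ (- r) * v `^ (- r).
  rewrite -powRM ?(ltW v0)//; apply: ge0_ler_powR; rewrite ?nnegrE ?mulr_ge0 ?(ltW u0) ?(ltW v0)//.
  by rewrite oppr_ge0 ltW.
have pu : 0 < u `^ (- r) by exact: powR_gt0.
have pv : 0 < v `^ (- r) by exact: powR_gt0.
have e (x : R) : x `^ r = (x `^ (- r))^-1 by rewrite -powRN opprK.
by rewrite !e ler_pdivlMr// mulrC ler_pdivrMr.
Qed.

End Weights.

Section Sobolev.
Context {R : realType} (S : freq_space R).
Local Notation V := (freq S).
Local Notation nrm := (@nrm R S).
Implicit Types (xi : V) (a : V -> R) (s : R).

Definition weight s xi : R := (1 + nrm xi ^+ 2) `^ (s / 2).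

Lemma weight_ge0 s xi : 0 <= weight s xi. Proof. exact: powR_ge0. Qed.

Lemma measurable_weight s : measurable_fun setT (weight s).
Proof.
apply: (measurableT_comp (@measurable_powR R (s / 2))).
apply: measurable_funD; first exact: measurable_cst.
by apply: measurable_funX; exact: measurable_nrm.
Qed.

Definition sobolev s a : \bar R := Lnorm (mu S) 2%:E (EFin \o (fun xi => weight s xi * `|a xi|)).

Lemma sobolev_norm_tr s a : nice false a ->
  @is_sobolev_norm R (euc S) s (tr false a) (sobolev s a).
Proof.
move=> na; exists (camp false a); first exact: has_fourier_tr.
apply: eq_Lnorm => xi /=; congr (_ * _)%:E.
by rewrite /Normc.normc /= expr0n addr0 sqrtr_sqr.
Qed.

Lemma measurable_weighted s a : nice false a ->
  measurable_fun setT (fun xi => weight s xi * `|a xi|).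
Proof.
move=> na; apply: measurable_funM; first exact: measurable_weight.
by apply: measurableT_comp => //; case: (nice_tame na).
Qed.

Lemma sobolev0 s : sobolev s (fun=> 0) = 0%E.
Proof.
rewrite /sobolev (_ : EFin \o _ = cst 0%E); last first.
  by apply/funext => xi /=; rewrite normr0 mulr0.
by rewrite Lnorm0// eqe pnatr_eq0.
Qed.

End Sobolev.

(** * The norm of the data and a lower bound on the triple convolution *)

Section PacketNorms.
Context {R : realType} (S : freq_space R).
Local Notation V := (freq S).
Local Notation nrm := (@nrm R S).
Variables (N s : R).
Hypothesis hN : 20 <= N.
Implicit Types (xi eta : V).

(** The inverse of the Sobolev weight at N e_1, which gives the high packet a norm of order one.
    Here s is the exponent for h0; it is later taken to be s + 1/2. *)
Definition amplitude : R := (1 + N ^+ 2) `^ (- (s / 2)).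

Local Notation kap := amplitude.
Local Notation a0 := (@packet R S N kap).
Local Notation a2 := (@packet2 R S N kap).
Local Notation a3 := (@packet3 R S N kap).
Local Notation bL := (@bL R S).
Local Notation bH := (@bH R S N).

Lemma one_sqrN_gt0 : 0 < 1 + N ^+ 2.
Proof. by rewrite ltr_pwDl// sqr_ge0. Qed.

Lemma amplitude_gt0 : 0 < kap.
Proof. exact: powR_gt0 one_sqrN_gt0. Qed.

Lemma amplitudeK : (1 + N ^+ 2) `^ (s / 2) * kap = 1.
Proof.
by rewrite /amplitude powRN mulfV// gt_eqF// powR_gt0// one_sqrN_gt0.
Qed.

(** Contains the support of the packet. Its four boxes have measure at most 1/4 each, so that an L^2
    norm on it is at most the supremum. *)
Definition bU : set V := (bL `|` (@neg R S) @^-1` bL) `|` (bH `|` (@neg R S) @^-1` bH).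

Lemma neg_preimage (A : set V) : measurable A ->
  measurable ((@neg R S) @^-1` A) /\ (mu S : {measure set V -> \bar R}) ((@neg R S) @^-1` A) =
    (mu S : {measure set V -> \bar R}) A.
Proof.
move=> mA; have -> : (@neg R S) @^-1` A = sub (sub point point) @^-1` A.
  by congr (_ @^-1` A); apply/funext => xi; exact: neg_subE.
split; last exact: mu_subE.
by rewrite -[X in measurable X]setTI; exact: measurable_subr.
Qed.

Lemma mu_small_box p q : (mu S (box p q (1 / 10)) <= (4^-1)%:E)%E.
Proof.
rewrite mu_boxE; last by lra.
rewrite lee_fin exprS; apply: (@le_trans _ _ (1 / 10 * 1)); last lra.
by apply: ler_wpM2l; [lra|apply: exprn_ile1; lra].
Qed.

Lemma measurable_bU : measurable bU.
Proof.
have mL : measurable bL by exact: measurable_box.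
have mH : measurable bH by exact: measurable_box.
have [nL _] := neg_preimage mL; have [nH _] := neg_preimage mH.
by apply: measurableU; exact: measurableU.
Qed.

Lemma mu_bU : (mu S bU <= 1)%E.
Proof.
have mL : measurable bL by exact: measurable_box.
have mH : measurable bH by exact: measurable_box.
have [nL eL] := neg_preimage mL; have [nH eH] := neg_preimage mH.
have lL := mu_small_box 1 0; rewrite -[X in (X <= _)%E]eL in lL.
have lH := mu_small_box N 0; rewrite -[X in (X <= _)%E]eH in lH.
have -> : (1 = ((4^-1)%:E + (4^-1)%:E) + ((4^-1)%:E + (4^-1)%:E) :> \bar R)%E.
  by rewrite -!EFinD; congr (_%:E); field.
apply: le_trans (measureU2 _ _ _) _; [exact: measurableU|exact: measurableU|].
apply: leeD.
  apply: le_trans (measureU2 _ mL nL) _.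
  by apply: leeD; [exact: mu_small_box|exact: lL].
apply: le_trans (measureU2 _ mH nH) _.
by apply: leeD; [exact: mu_small_box|exact: lH].
Qed.

Lemma weight_low xi : 1 <= nrm xi <= 14 / 10 -> weight s xi <= 3 `^ `|s / 2|.
Proof.
move=> n1; have := @powR_comparable R 1 (1 + nrm xi ^+ 2) (s / 2); rewrite powR1 !mulr1 -/(weight s xi).
by apply; nra.
Qed.

Lemma nrm_comparable xi : N <= nrm xi <= 112 / 100 * N ->
  1 + nrm xi ^+ 2 <= 3 * (1 + N ^+ 2) /\ 1 + N ^+ 2 <= 3 * (1 + nrm xi ^+ 2).
Proof. by have h := hN; move=> /andP[n1 n2]; split; nra. Qed.

Lemma weight_highE r xi : N <= nrm xi <= 112 / 100 * N ->
  weight r xi <= 3 `^ `|r / 2| * (1 + N ^+ 2) `^ (r / 2).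
Proof.
move=> /nrm_comparable[h1 h2]; apply: powR_comparable => //.
  exact: one_sqrN_gt0.
by rewrite ltr_pwDl// sqr_ge0.
Qed.

Lemma weight_high xi : N <= nrm xi <= 112 / 100 * N -> weight s xi * kap <= 3 `^ `|s / 2|.
Proof.
move=> /weight_highE h; apply: (le_trans (ler_wpM2r (ltW amplitude_gt0) (h s))).
by rewrite -mulrA amplitudeK mulr1.
Qed.

Lemma weighted_packet xi : `|weight s xi * `|a0 xi| | <= 4 * 3 `^ `|s / 2| * \1_bU xi.
Proof.
have A := powR_ge0 3 `|s / 2|; have w0 := weight_ge0 s xi.
have k0 := ltW amplitude_gt0.
have [U|nU] := pselect (bU xi); last first.
  rewrite indicE memNset// mulr0 (_ : a0 xi = 0) ?normr0 ?mulr0 ?normr0//.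
  apply/eqP; apply: contra_notT nU => /packet_case [b|b|b|b];
    by [left; left|left; right|right; left|right; right].
rewrite indicE mem_set// mulr1 normrM normr_id (ger0_norm w0) ger0_norm; last exact: packet_ge0 amplitude_gt0 _.
have low (b : bool) : (b -> 1 <= nrm xi <= 14 / 10) -> weight s xi * b%:R <= 3 `^ `|s / 2|.
  by case: b => [/(_ isT)/weight_low|_]; rewrite ?mulr1 ?mulr0.
have high (b : bool) : (b -> N <= nrm xi <= 112 / 100 * N) -> weight s xi * (kap * b%:R) <= 3 `^ `|s / 2|.
  by case: b => [/(_ isT)/weight_high|_]; rewrite ?mulr1 ?mulr0.
rewrite /packet !indicE.
have l1 := low (xi \in bL) (fun h => nL (set_mem h)).
have l2 := low (neg xi \in bL); have l3 := high (xi \in bH); have l4 := high (neg xi \in bH).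
have {}l2 : weight s xi * (neg xi \in bL)%:R <= 3 `^ `|s / 2|.
  by apply: l2 => /set_mem/nL; rewrite nrm_neg.
have {}l3 : weight s xi * (kap * (xi \in bH)%:R) <= 3 `^ `|s / 2|.
  by apply: l3 => /set_mem h; have [] := nHigh hN (Or31 _ _ h).
have {}l4 : weight s xi * (kap * (neg xi \in bH)%:R) <= 3 `^ `|s / 2|.
  by apply: l4 => /set_mem h; have [] := nHigh hN (Or31 _ _ h); rewrite nrm_neg.
move: l1 l2 l3 l4; rewrite !mulrDr; lra.
Qed.

Lemma sobolev_packet : (sobolev s a0 <= (4 * 3 `^ `|s / 2|)%:E)%E.
Proof.
apply: (Lnorm2_le _ measurable_bU mu_bU _ weighted_packet).
  by apply: measurable_weighted; exact: nice_packet hN amplitude_gt0.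
by rewrite mulr_ge0// powR_ge0.
Qed.

(* For z in [bM] and two frequencies in [bQ], the third one of an interaction
   producing z lies in [bH]. *)
Definition bM : set V := box (N + 2 + 1 / 20) (1 / 20) (1 / 20).
Definition bQ : set V := box 1 0 (1 / 40).

Lemma bM_W xi : bM xi -> bW N xi.
Proof.
move=> [h1 h2]; split; first by move: h1; lra.
by move=> j /h2; lra.
Qed.

Lemma bQ_L xi : bQ xi -> bL xi.
Proof. by apply: box_le; lra. Qed.

Lemma bM_sub z xi eta : bM z -> bQ xi -> bQ eta -> bH (sub (sub z xi) eta).
Proof.
(* Two frequencies of [bQ] take away at most 2/40 in each coordinate beyond their corners, which is
   the offset 1/20 of [bM]. *)
move=> [z1 z2] [x1 x2] [e1 e2]; split; first by rewrite !co_sub; lra.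
by move=> j j0; have := z2 _ j0; have := x2 _ j0; have := e2 _ j0; rewrite !co_sub; lra.
Qed.

Local Notation d := (codim S).+1.

Lemma mu_bQ : mu S bQ = ((1 / 40) ^+ d)%:E.
Proof. by rewrite /bQ mu_boxE//; lra. Qed.

Lemma mu_bQ_fin : (mu S bQ < +oo)%E.
Proof. by rewrite mu_bQ ltry. Qed.

Lemma conv_ge (f h : V -> R) (b b' : R) z : nice false f -> nice false h ->
  (forall xi, 0 <= f xi) -> (forall xi, 0 <= h xi) -> 0 <= b -> 0 <= b' ->
  (forall eta, bQ eta -> b <= f eta /\ b' <= h (sub z eta)) ->
  fcst S * (1 / 40) ^+ d * (b * b') <= convolve f h z.
Proof.
move=> nf nh f0 h0 b0 b0' H; rewrite /convolve -mulrA.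
apply: ler_wpM2l; first exact: ltW (fcst_gt0 S).
have tQ : tame (mu S) (\1_bQ : V -> R).
  apply: (@tame_of_bound _ _ _ _ _ 1 bQ).
  - by apply: measurable_indic; exact: measurable_box.
  - exact: measurable_box.
  - exact: mu_bQ_fin.
  - by move=> eta; rewrite mul1r ger0_norm.
have -> : (1 / 40) ^+ d * (b * b') = \int[mu S]_eta (b * b' * \1_bQ eta).
  rewrite integral_tameZ// mulrC; congr (_ * _).
  rewrite /Rintegral integral_indic ?setIT//; last exact: measurable_box.
  exact: esym (congr1 fine mu_bQ).
apply: le_integral_tame; [exact: tameZ|exact: nice_tame_conv nf nh|].
move=> eta; rewrite indicE; case: (boolP (eta \in bQ)) => [/set_mem/H[h1 h2]|_].
  by rewrite mulr1; exact: ler_pM.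
by rewrite mulr0 mulr_ge0.
Qed.

Lemma packet_L xi : bL xi -> 1 <= a0 xi.
Proof.
move=> b; have k0 := ltW amplitude_gt0.
rewrite /packet indicE mem_set// mulr1n -addrA lerDl addr_ge0// mulr_ge0// addr_ge0//.
Qed.

Lemma packet_H xi : bH xi -> kap <= a0 xi.
Proof.
move=> b; have k0 := ltW amplitude_gt0.
rewrite /packet [\1_bH xi]indicE mem_set// mulr1n mulrDr mulr1 addrCA lerDl.
by rewrite addr_ge0 ?addr_ge0// mulr_ge0.
Qed.

Definition qcst : R := fcst S * (1 / 40) ^+ d.

Lemma qcst_gt0 : 0 < qcst.
Proof. by rewrite mulr_gt0 ?fcst_gt0// exprn_gt0//; lra. Qed.

(** It is enough to keep the interactions whose first two frequencies lie in [bQ], the third being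
    then high; all others contribute nonnegatively. *)
Lemma packet3_M z : bM z -> qcst ^+ 2 * kap <= a3 z.
Proof.
move=> bz; have n0 := nice_packet S hN amplitude_gt0; have n2 := nice_packet2 S hN amplitude_gt0.
have p0 xi : 0 <= a0 xi by exact: packet_ge0 amplitude_gt0 _.
have q0 := ltW qcst_gt0; have k0 := ltW amplitude_gt0.
have low2 eta : bQ eta -> qcst * kap <= a2 (sub z eta).
  move=> bq; rewrite -[X in _ * X <= _]mul1r.
  apply: (conv_ge n0 n0 p0 p0 ler01 k0) => xi bx.
  by split; [exact/packet_L/bQ_L|apply: packet_H; exact: bM_sub].
rewrite expr2 -mulrA -[X in _ * X <= _]mul1r.
apply: (conv_ge n0 n2 p0 _ ler01) => [xi||eta bq].
- exact: packet2_ge0 amplitude_gt0 _.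
- exact: mulr_ge0.
- by split; [exact/packet_L/bQ_L|exact: low2].
Qed.

Lemma sobolev_M r (f : V -> R) (b : R) : nice false f -> 0 <= b ->
  (forall xi, bM xi -> b <= weight r xi * `|f xi|) -> ((b * (1 / 20))%:E <= sobolev r f)%E.
Proof.
move=> nf b0 H; apply: (@Lnorm2_ge _ _ _ (mu S) _ b (1 / 20) bM).
- exact: measurable_weighted.
- exact: measurable_box.
- have -> : (mu S : {measure set V -> \bar R}) bM = ((1 / 20) ^+ d)%:E.
    by apply: mu_boxE; lra.
  (* As d <= 2, the measure (1/20) ^ d is at least (1/20) ^ 2, so the factor 1/20 serves both
     dimensions. *)
  rewrite lee_fin; apply: ler_wiXn2l; [lra|lra|].
  by rewrite ltnS codim_le1.
- exact: b0.
- lra.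
- by move=> xi /H h; rewrite normrM normr_id ger0_norm// weight_ge0.
Qed.

End PacketNorms.

(** * Choice of the scales and norm inflation *)

Section Inflation.
Context {R : realType} (S : freq_space R).
Variables (g tau s : R).
Hypotheses (g0 : 0 <= g) (tau0 : 0 < tau).
Implicit Types (P K c t T : R).

(** Both sides are used with t wstar = 2 pi k: the lower bound yields t P ^ 3 <= K, the upper one
    that t P ^ 3 is at least of order k. *)
Lemma wstar_bounds P : 0 < P -> 3 * g <= tau * P ^+ 4 ->
  Num.sqrt tau * P ^+ 3 <= wstar g tau P <= Num.sqrt (2 * tau) * P ^+ 3.
Proof.
move=> P0 gP; have P3 : 0 <= P ^+ 3 by rewrite exprn_ge0// ltW.
have h1 := g0; have h2 := tau0.
have P6 : 0 <= tau * P ^+ 6 by rewrite mulr_ge0 ?exprn_ge0// ltW.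
have gP2 : 0 <= g * P ^+ 2 by rewrite mulr_ge0 ?sqr_ge0.
have gP6 : 3 * (g * P ^+ 2) <= tau * P ^+ 6.
  by have := ler_wpM2r (sqr_ge0 P) gP; lra.
have E : P ^+ 2 * (g + tau * (P ^+ 2) ^+ 2) = g * P ^+ 2 + tau * P ^+ 6 by ring.
have E0 : 0 <= g * P ^+ 2 + tau * P ^+ 6 by exact: addr_ge0.
have t2 : 0 <= 2 * tau by lra.
have a1 : 0 <= Num.sqrt tau * P ^+ 3 := mulr_ge0 (sqrtr_ge0 _) P3.
have a2 : 0 <= Num.sqrt (2 * tau) * P ^+ 3 := mulr_ge0 (sqrtr_ge0 _) P3.
have a3 : 0 <= wstar g tau P := sqrtr_ge0 _.
have w2 : wstar g tau P ^+ 2 = g * P ^+ 2 + tau * P ^+ 6 by rewrite /wstar E sqr_sqrtr.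
apply/andP; split; rewrite -ler_sqr ?nnegrE// w2 exprMn sqr_sqrtr ?(ltW tau0)// -exprM; lra.
Qed.

(** The exponents s and s + 1/2 leave (1 + P ^ 4) ^ (-1/4), the loss of one factor P due to the half
    derivative between h and psi; moreover 1 + P ^ 4 <= (2 P) ^ 4. *)
Lemma quarter_power P : 1 <= P ->
  (2 * P)^-1 <= (1 + (P ^+ 2) ^+ 2) `^ (s / 2) * amplitude (P ^+ 2) (s + 2^-1).
Proof.
move=> P1; have N0 := one_sqrN_gt0 (P ^+ 2).
rewrite /amplitude -powRD; last by apply/implyP => _; rewrite gt_eqF.
rewrite (_ : s / 2 + _ = - (1 / 4)); last by field.
rewrite powRN lef_pV2 ?posrE ?powR_gt0//; last by lra.
have P20 : 0 <= 2 * P by lra.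
apply: (@le_trans _ _ (((2 * P) ^+ 4) `^ (1 / 4))).
  apply: ge0_ler_powR; rewrite ?nnegrE ?exprn_ge0 ?(ltW N0)//.
  have : 1 <= P ^+ 4 by exact: exprn_ege1.
  lra.
rewrite -powR_mulrn// -powRrM (_ : 4%:R * (1 / 4) = 1); [by rewrite powRr1|by field].
Qed.

Lemma weight_ratio r N (xi : freq S) : 20 <= N -> N <= nrm xi <= 112 / 100 * N ->
  (1 + N ^+ 2) `^ (r / 2) <= 3 `^ `|r / 2| * weight r xi.
Proof.
move=> hN nx; have [h1 h2] := nrm_comparable hN nx.
apply: powR_comparable => //; last exact: one_sqrN_gt0.
by rewrite ltr_pwDl// sqr_ge0.
Qed.

(** Collects the comparison of weights over the window, the factor tau / 2 of [P3_lower], the factor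
    1 / 2 of [quarter_power] and the volumes in [packet3_M]. It depends neither on P nor on k. *)
Definition rate : R := (3 `^ `|s / 2|)^-1 * (tau / 4) * qcst S ^+ 2.

Lemma rate_gt0 : 0 < rate.
Proof.
have h := tau0; rewrite /rate mulr_gt0 ?exprn_gt0 ?qcst_gt0// mulr_gt0//; last lra.
Qed.

Lemma inflation P K c t (k : nat) :
  setup g tau P K c t (amplitude (P ^+ 2) (s + 2^-1)) ->
  1000 * (c ^+ 4 * K ^+ 4) <= tau * P ^+ 2 -> 0 < t ->
  t * wstar g tau P = pi *+ 2 *+ k ->
  ((rate * (t * P ^+ 3) * (1 / 20))%:E <=
   sobolev s (@third_psi R S g tau (@packet R S (P ^+ 2) (amplitude (P ^+ 2) (s + 2^-1))) t))%E.
Proof.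
move=> HS big t0 per; have hN := N20 HS; have [_ _ P5 _ _ _ _ _ _ _ _] := HS.
have P0 : 0 <= P by lra.
have tt : 0 <= t <= t by rewrite lexx ltW.
have e0 := ltW rate_gt0.
apply: (sobolev_M (N := P ^+ 2)).
- exact: nice_slice (fam_third_psi g tau t (na0 S HS)) tt.
- by rewrite mulr_ge0// mulr_ge0 ?exprn_ge0// ltW.
- move=> xi bM; have bw := bM_W bM.
  have low := P3_lower HS big t0 per bw; have a3M := packet3_M (s + 2^-1) hN bM.
  have [nx _] := nHigh hN (Or33 _ _ bw); have w := weight_ratio s hN nx.
  have P1 : 1 <= P by lra.
  have q := quarter_power P1.
  set kp := amplitude _ _ in low a3M q *.
  set A := 3 `^ `|s / 2| in w *; have A0 : 0 < A by exact: powR_gt0.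
  have kp0 : 0 < kp by exact: amplitude_gt0.
  have w0 := weight_ge0 s xi.
  have tN : 0 <= tau / 2 * (t * (P ^+ 2) ^+ 2).
    by have h := tau0; rewrite !mulr_ge0 ?sqr_ge0 ?(ltW t0)//; lra.
  apply: (@le_trans _ _ (weight s xi * (tau / 2 * (t * (P ^+ 2) ^+ 2) * (qcst S ^+ 2 * kp)))); last first.
    apply: ler_wpM2l => //; rewrite -normrN; apply: le_trans (ler_norm _).
    exact: le_trans (ler_wpM2l tN a3M) low.
  have h1 : (2 * P)^-1 <= A * weight s xi * kp.
    by apply: le_trans q _; apply: ler_wpM2r => //; exact: ltW.
  have B0 : 0 <= A^-1 * (tau / 2 * (t * (P ^+ 2) ^+ 2)) * qcst S ^+ 2.
    by rewrite mulr_ge0 ?sqr_ge0// mulr_ge0// invr_ge0 ltW.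
  have h2 := ler_wpM2l B0 h1.
  have An : A != 0 by rewrite gt_eqF.
  have Pn : P != 0 by rewrite gt_eqF//; lra.
  rewrite [leLHS](_ : _ = A^-1 * (tau / 2 * (t * (P ^+ 2) ^+ 2)) * qcst S ^+ 2 * (2 * P)^-1); last first.
    by rewrite /rate -/A; field; rewrite An Pn.
  apply: le_trans h2 _; rewrite le_eqVlt; apply/orP; left; apply/eqP.
  by field.
Qed.

Lemma exists_scales T (k : nat) : 0 < T -> (0 < k)%N -> exists P K c t,
  [/\ setup g tau P K c t (amplitude (P ^+ 2) (s + 2^-1)),
      1000 * (c ^+ 4 * K ^+ 4) <= tau * P ^+ 2, 0 < t <= T,
      t * wstar g tau P = pi *+ 2 *+ k & k%:R / Num.sqrt (2 * tau) <= t * P ^+ 3].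
Proof.
move=> T0 k0; have h1 := g0; have h2 := tau0.
pose sq := Num.sqrt (2 * tau); have sq0 : 0 < sq by rewrite sqrtr_gt0; lra.
pose sq1 := Num.sqrt tau; have sq10 : 0 < sq1 by rewrite sqrtr_gt0.
pose th : R := pi *+ 2 *+ k.
have pi2 : 1 <= pi *+ 2 :> R by have := pi_ge2 R; rewrite mulr2n; lra.
have kR0 : 0 < k%:R :> R by rewrite ltr0n.
have thk : k%:R <= th.
  by rewrite /th -[leRHS]mulr_natr -[leLHS]mul1r; apply: ler_wpM2r => //; exact: ltW.
have th0 : 0 < th by exact: lt_le_trans thk.
(* t P ^ 3 = th P ^ 3 / wstar is at most th / sqrt tau whatever P is, so K can be fixed before P;
   the summand 1 ensures 1 <= K. *)
pose K := 1 + th / sq1.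
have q0 : 0 <= th / sq1 by rewrite divr_ge0// ltW.
have K1 : 1 <= K by rewrite lerDl.
pose c := 1 + 12 * g + 12 * tau + sq.
have c1 : 1 <= c by rewrite /c; lra.
have cg : 12 * g + 12 * tau <= c by rewrite /c; lra.
have cs : sq <= c by rewrite /c; lra.
(* The thresholds make gravity negligible, the error budget valid and t <= T; they are linear in P,
   which is below its own powers. *)
have [P [P5 Pg PK PT]] : exists P, [/\ 5 <= P, 3 * g / tau <= P,
    1000 * (c ^+ 4 * K ^+ 4) / tau <= P & K / T <= P].
  exists (Num.max (Num.max 5 (3 * g / tau)) (Num.max (1000 * (c ^+ 4 * K ^+ 4) / tau) (K / T))).
  by rewrite !le_max !lexx !orbT.
have P0 : 0 < P by lra.
have Ple (n : nat) : P <= P ^+ n.+1.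
  by rewrite -[leLHS]expr1; apply: ler_weXn2l => //; lra.
have gP : 3 * g <= tau * P ^+ 4.
  by rewrite [leRHS]mulrC -ler_pdivrMr//; exact: le_trans Pg (Ple 3).
have big : 1000 * (c ^+ 4 * K ^+ 4) <= tau * P ^+ 2.
  by rewrite [leRHS]mulrC -ler_pdivrMr//; exact: le_trans PK (Ple 1).
have KT : K <= T * P ^+ 3.
  by rewrite [leRHS]mulrC -ler_pdivrMr//; exact: le_trans PT (Ple 2).
have [w1 w2] := andP (wstar_bounds P0 gP); set w := wstar g tau P in w1 w2 *.
have P3 : 0 < P ^+ 3 by rewrite exprn_gt0.
have w0 : 0 < w by apply: lt_le_trans w1; exact: mulr_gt0.
pose t := th / w; have t0 : 0 < t by exact: divr_gt0.
have per : t * w = th by rewrite /t mulfVK// gt_eqF.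
have tP : t * P ^+ 3 <= K.
  apply: (@le_trans _ _ (th / sq1)); last by rewrite lerDr.
  rewrite ler_pdivlMr// -per -mulrA [P ^+ 3 * _]mulrC.
  by apply: ler_wpM2l => //; exact: ltW.
exists P, K, c, t; split=> //.
- by split=> //; [exact: ltW|exact: amplitude_gt0].
- by rewrite t0 -(ler_pM2r P3); exact: le_trans tP KT.
- rewrite ler_pdivrMr// -mulrA [P ^+ 3 * _]mulrC; apply: le_trans thk _.
  by rewrite -per; apply: ler_wpM2l => //; exact: ltW.
Qed.

(** The constant C comes first, k is chosen from it, then the scales. The data depend on P, but the
    bound A of their norm does not. *)
Lemma not_C3 T : 0 < T -> ~ flow_C3_at_origin (euc S) g tau s T.
Proof.
move=> T0 [C HC]; have r0 := rate_gt0; have h2 := tau0.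
pose sg := s + 2^-1; pose A := 4 * 3 `^ `|sg / 2| : R.
have A0 : 0 <= A by rewrite mulr_ge0// powR_ge0.
pose sq := Num.sqrt (2 * tau); have sq0 : 0 < sq by rewrite sqrtr_gt0 mulr_gt0.
pose B := `|C| * A ^+ 3.
(* Makes rate (k / sq) / 20, a lower bound for the norm at time t, larger than B, which bounds C n0
   ^ 3 even if C is negative. *)
pose k := (Num.truncn (B * 20 * sq / rate)).+1.
have [P [K [c [t [HS big /andP[t0 tT] per tP]]]]] := exists_scales T0 (ltn0Sn _ : (0 < k)%N).
pose kap := amplitude (P ^+ 2) sg.
pose a := @packet R S (P ^+ 2) kap.
have na : nice false a := na0 S HS.
have infl := inflation HS big t0 per.
have nle : (sobolev sg a <= A%:E)%E := sobolev_packet S sg (N20 HS).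
pose U3 := @third_h R S g tau a.
pose Q3 := @third_psi R S g tau a.
pose n0 := fine (sobolev sg a).
pose n3 r := (sobolev sg (U3 r) + sobolev s (Q3 r))%E.
have n0E : n0%:E = sobolev sg a.
  by rewrite fineK// ge0_fin_numE ?Lnorm_ge0// (le_lt_trans nle)// ltry.
have n00 : 0 <= n0 by rewrite fine_ge0// Lnorm_ge0.
have n0A : n0 <= A by rewrite -lee_fin n0E.
have X0 : @is_X_norm R (euc S) s (tr false a) (tr false (fun=> 0)) n0%:E.
  exists (sobolev sg a), (@sobolev R S s (fun=> 0)); split.
  - exact: sobolev_norm_tr.
  - by apply: sobolev_norm_tr; exact: nice0.
  - by rewrite sobolev0 adde0.
have X3 r : 0 <= r <= T -> @is_X_norm R (euc S) s (tr false (U3 r)) (tr false (Q3 r)) (n3 r).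
  move=> rT; exists (sobolev sg (U3 r)), (sobolev s (Q3 r)); split=> //.
  - by apply: sobolev_norm_tr; exact: nice_slice (fam_third_h g tau T na) rT.
  - by apply: sobolev_norm_tr; exact: nice_slice (fam_third_psi g tau T na) rT.
have := HC _ _ _ _ n0 n3 X0 (third_variation g tau T na) X3.
apply/negP; rewrite -ltNge.
apply: (@lt_le_trans _ _ (n3 t)); last first.
  by apply: ereal_sup_ubound; exists t => //=; rewrite in_itv /= (ltW t0).
apply: (@lt_le_trans _ _ (rate * (t * P ^+ 3) * (1 / 20))%:E); last first.
  by apply: le_trans infl _; rewrite leeDr// Lnorm_ge0.
rewrite lte_fin; apply: (@le_lt_trans _ _ B).
  apply: (@le_trans _ _ (`|C| * n0 ^+ 3)).
    by apply: ler_wpM2r; [exact: exprn_ge0|exact: ler_norm].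
  by apply: ler_wpM2l => //; apply: lerXn2r.
apply: (@lt_le_trans _ _ (rate * (k%:R / sq) * (1 / 20))); last first.
  apply: ler_wpM2r; first by rewrite divr_ge0.
  by apply: ler_wpM2l => //; exact: ltW.
have : B * 20 * sq / rate < k%:R by rewrite truncnS_gt.
rewrite ltr_pdivrMr// => Bk.
rewrite -(ltr_pM2r (x := 20 * sq)); last by rewrite mulr_gt0.
rewrite mulrA (_ : _ * (20 * sq) = k%:R * rate) //.
by field; rewrite gt_eqF.
Qed.

End Inflation.

Theorem theorem1 (R : realType) (g tau : R) (hg : 0 <= g) (htau : 0 < tau)
    (T : R) (hT : 0 < T) (s : R) :
  (s < 3 -> ~ flow_C3_at_origin (euclid2 R) g tau s T) /\
  (s < 5 / 2 -> ~ flow_C3_at_origin (euclid1 R) g tau s T).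
Proof.
split=> _.
- by rewrite -euc_space2; exact: not_C3.
- by rewrite -euc_space1; exact: not_C3.
Qed.
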